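(* (ZFC) Let $\kappa$ be an iterable cardinal that is a limit of measurable cardinals and let $A$ be a subset of $\mathcal{P}(\kappa)$ that is definable by a $\Sigma_1$-formula with parameters in $H(\kappa)\cup\{\kappa\}$. If $A$ has cardinality greater than $\kappa$, then there exist distinct $x,y\in A$ with the property that $x\cap y$ is unbounded in $\kappa$.
   Context: $\Sigma_1$ refers to the Levy hierarchy of formulas of set theory. $H(\kappa)$ is the set of all sets of hereditary cardinality less than $\kappa$. A class $A$ is definable by a $\Sigma_1$-formula with parameters in a set $P$ if $A=\{x\mid\varphi(x,p_0,\ldots,p_{n-1})\}$ (evaluated in $V$) for some $\Sigma_1$-formula $\varphi$ and $p_0,\ldots,p_{n-1}\in P$. An uncountable cardinal $\kappa$ is iterable if for every $x\subseteq\kappa$ there exist a transitive model $M$ of $\mathrm{ZFC}^-$ (ZFC without the power set axiom) of cardinality $\kappa$ with $\kappa,x\in M$ and a weakly amenable $M$-ultrafilter $U$ on $\kappa$ such that $\langle M,U\rangle$ is iterable. Here $U\subseteq\mathcal{P}(\kappa)\cap M$ is an $M$-ultrafilter on $\kappa$ if $\langle M,\in,U\rangle$ satisfies that $U$ is a non-principal, ${<}\kappa$-complete normal ultrafilter on $\kappa$; it is weakly amenable if for every sequence $\langle x_\alpha\mid\alpha<\kappa\rangle\in M$ of subsets of $\kappa$ the set $\{\alpha<\kappa\mid x_\alpha\in U\}$ is an element of $M$ (so that the ultrapower construction can be iterated, using direct limits at limit stages); and $\langle M,U\rangle$ is iterable if all iterated ultrapowers of $M$ by $U$ and its images, through all the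 ordinals, are well-founded. *)

(* Defs.v *)
From Stdlib Require Import List.
Import ListNotations.

Set Implicit Arguments.
Unset Strict Implicit.
Unset Printing Implicit Defensive.

(** ZFC is treated as a first-order theory: the universe is an arbitrary
    structure [V] for the language of set theory satisfying the axioms, and
    every set-theoretic notion is a first-order property of elements of [V]
    (no Rocq function, predicate, natural number or well-foundedness on the
    type [V] stands for a set-theoretic object).  The notions make sense in any
    structure, so that the ones that have to be evaluated in a set model [M] or
    in an iterate of [M] are obtained by instantiating them there. *)

Record set_structure : Type := SetStructure {
  carrier :> Type;
  mem : carrier -> carrier -> Prop
}.
Arguments mem {_} _ _.
Notation "x ∈ y" := (mem x y) (at level 70, no associativity).
Notation "x ∉ y" := (~ mem x y) (at level 70, no associativity).

(** ** First-order formulas *)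

(** De Bruijn indices; the remaining connectives and the universal quantifier
    are the usual abbreviations. *)
Inductive formula : Type :=
| fIn (i j : nat)
| fEq (i j : nat)
| fNot (p : formula)
| fAnd (p q : formula)
| fEx (p : formula).

Definition scons (X : Type) (x : X) (rho : nat -> X) (n : nat) : X :=
  match n with 0 => x | S m => rho m end.

Fixpoint sat (V : set_structure) (p : formula) (rho : nat -> V) : Prop :=
  match p with
  | fIn i j => rho i ∈ rho j
  | fEq i j => rho i = rho j
  | fNot q => ~ sat q rho
  | fAnd q r => sat q rho /\ sat r rho
  | fEx q => exists x : V, sat q (scons x rho)
  end.

(** [fEx (fAnd (fIn 0 (S i)) p)] is the bounded quantification
    "there is y in x_i with p": under the quantifier, x_i has index [S i]. *)
Inductive Delta0 : formula -> Prop :=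
| D0_In i j : Delta0 (fIn i j)
| D0_Eq i j : Delta0 (fEq i j)
| D0_Not p : Delta0 p -> Delta0 (fNot p)
| D0_And p q : Delta0 p -> Delta0 q -> Delta0 (fAnd p q)
| D0_Ex i p : Delta0 p -> Delta0 (fEx (fAnd (fIn 0 (S i)) p)).

Inductive Sigma1 : formula -> Prop :=
| S1_D0 p : Delta0 p -> Sigma1 p
| S1_Ex p : Sigma1 p -> Sigma1 (fEx p).

(** Variable 0 is the argument and variables 1, ..., n are the parameters.
    (The value of variables beyond n is immaterial, since identifying them with
    variable 0 turns a Sigma_1 formula into a Sigma_1 formula.) *)
Definition defines (V : set_structure) (p : formula) (params : list V) (x : V) : Prop :=
  sat p (fun i => nth i (x :: params) x).

(** ** Basic set theory *)

Section Basic.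
Context {V : set_structure}.
Implicit Types (x y z a b f r s p w : V).

Definition subset x y := forall z, z ∈ x -> z ∈ y.
Definition is_empty x := forall z, z ∉ x.
Definition is_succ y x := forall z, z ∈ y <-> z ∈ x \/ z = x.
Definition is_upair p x y := forall z, z ∈ p <-> z = x \/ z = y.
Definition is_pair p x y :=
  exists a b, is_upair a x x /\ is_upair b x y /\ is_upair p a b.

(** The pair <x,y> belongs to r. *)
Definition rel r x y := exists p, p ∈ r /\ is_pair p x y.

(** f is a function with domain a. *)
Definition is_fun f a :=
  (forall p, p ∈ f -> exists x y, x ∈ a /\ is_pair p x y) /\
  (forall x, x ∈ a -> exists! y, rel f x y).

Definition maps f a b := is_fun f a /\ forall x y, rel f x y -> y ∈ b.
Definition bijection f a b :=
  maps f a b /\ forall y, y ∈ b -> exists! x, rel f x y.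
Definition equinumerous a b := exists f, bijection f a b.

Definition transitive x := forall y, y ∈ x -> subset y x.
(** Adequate in the presence of Foundation. *)
Definition ordinal x := transitive x /\ forall y, y ∈ x -> transitive y.
Definition limit_ordinal x :=
  ordinal x /\ (exists y, y ∈ x) /\ forall y, y ∈ x -> exists z, z ∈ x /\ y ∈ z.
Definition is_omega w := limit_ordinal w /\ forall n, n ∈ w -> ~ limit_ordinal n.

Definition cardinal x := ordinal x /\ forall a, a ∈ x -> ~ equinumerous a x.
Definition has_card x a := cardinal a /\ equinumerous x a.
Definition uncountable_cardinal x := cardinal x /\ exists w, is_omega w /\ w ∈ x.

Definition is_trcl y x :=
  transitive y /\ subset x y /\
  forall z, transitive z -> subset x z -> subset y z.
(** x is an element of H(k). *)
Definition in_H (k x : V) :=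
  exists y a, is_trcl y x /\ has_card y a /\ a ∈ k.

Definition well_orders r a :=
  (forall x, x ∈ a -> ~ rel r x x) /\
  (forall x y z, x ∈ a -> y ∈ a -> z ∈ a -> rel r x y -> rel r y z -> rel r x z) /\
  (forall x y, x ∈ a -> y ∈ a -> rel r x y \/ x = y \/ rel r y x) /\
  (forall s, subset s a -> (exists x, x ∈ s) ->
     exists m, m ∈ s /\ forall y, y ∈ s -> ~ rel r y m).

Definition unbounded_in (k : V) (P : V -> Prop) :=
  forall a, a ∈ k -> exists b, b ∈ k /\ P b /\ a ∈ b.

End Basic.

(** ** The axioms *)

(** [Def] is the collection of binary relations that are first-order definable
    with parameters over the structure.  (Unary definable predicates are
    covered by relations ignoring one argument.)  As usual for ZFC without
    power set, the schema is formulated as Separation and Collection and Choice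
    as the well-ordering principle; with the power set axiom, this is
    equivalent to Replacement and the existence of choice functions. *)
Record ZFC_minus (V : set_structure) (Def : (V -> V -> Prop) -> Prop) : Prop := {
  zfc_ext : forall x y : V, (forall z, z ∈ x <-> z ∈ y) -> x = y;
  zfc_foundation : forall x : V, (exists y, y ∈ x) ->
    exists y, y ∈ x /\ forall z, z ∈ y -> z ∉ x;
  zfc_pairing : forall x y : V, exists p, is_upair p x y;
  zfc_union : forall x : V, exists u, forall z, z ∈ u <-> exists y, y ∈ x /\ z ∈ y;
  zfc_infinity : exists w : V,
    (exists e, is_empty e /\ e ∈ w) /\
    (forall x, x ∈ w -> exists y, is_succ y x /\ y ∈ w);
  zfc_separation : forall Q, Def Q -> forall a q : V,
    exists s, forall z, z ∈ s <-> z ∈ a /\ Q z q;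
  zfc_collection : forall Q, Def Q -> forall a : V,
    (forall x, x ∈ a -> exists y, Q x y) ->
    exists b, forall x, x ∈ a -> exists y, y ∈ b /\ Q x y;
  zfc_choice : forall a : V, exists r, well_orders r a
}.

Definition fo_definable (V : set_structure) (Q : V -> V -> Prop) : Prop :=
  exists (p : formula) (rho : nat -> V),
    forall x y, Q x y <-> sat p (scons x (scons y rho)).

Definition ZFC (V : set_structure) : Prop :=
  ZFC_minus (@fo_definable V) /\
  forall x : V, exists p, forall z, z ∈ p <-> subset z x.

(** ** Set models *)

Definition set_model (V : set_structure) (M : V) : set_structure :=
  {| carrier := {x : V | x ∈ M}; mem x y := proj1_sig x ∈ proj1_sig y |}.

Definition val (V : set_structure) (M : V) (x : set_model M) : V := proj1_sig x.

(** The satisfaction relation of a set model has to be the one of [V], whose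
    natural numbers (hence formulas) need not be standard.  The truth sets
    {s : omega -> M | M |= phi[s]} of formulas phi in the sense of [V] are the
    members of the least family containing those of the atomic formulas and
    closed under Tarski's clauses for negation, conjunction and existential
    quantification. *)
Section Satisfaction.
Context {V : set_structure}.
Variables w M : V.
Implicit Types (s t i j a b S T D : V).

Definition assignment s := maps s w M.

(** t = s[i := a] *)
Definition is_update s i a t :=
  assignment t /\ rel t i a /\
  forall j b, j ∈ w -> j <> i -> rel s j b -> rel t j b.

Definition comprehends T (P : V -> Prop) :=
  forall s, s ∈ T <-> assignment s /\ P s.

Definition closed_truth_family D :=
  (forall i j T, i ∈ w -> j ∈ w ->
     comprehends T (fun s => exists a b, rel s i a /\ rel s j b /\ a ∈ b) -> T ∈ D) /\
  (forall i j T, i ∈ w -> j ∈ w ->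
     comprehends T (fun s => exists a, rel s i a /\ rel s j a) -> T ∈ D) /\
  (forall S T, S ∈ D -> comprehends T (fun s => s ∉ S) -> T ∈ D) /\
  (forall S S' T, S ∈ D -> S' ∈ D ->
     comprehends T (fun s => s ∈ S /\ s ∈ S') -> T ∈ D) /\
  (forall i S T, i ∈ w -> S ∈ D ->
     comprehends T (fun s => exists a t, a ∈ M /\ is_update s i a t /\ t ∈ S) -> T ∈ D).

Definition truth_set T := forall D, closed_truth_family D -> T ∈ D.

End Satisfaction.

(** Q x y iff M |= phi[s], where s maps 0 to x, 1 to y and is fixed elsewhere. *)
Definition internally_definable (V : set_structure) (M : V)
    (Q : set_model M -> set_model M -> Prop) : Prop :=
  exists w i0 i1 T s : V,
    is_omega w /\ is_empty i0 /\ is_succ i1 i0 /\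
    truth_set w M T /\ assignment w M s /\
    forall x y, Q x y <-> exists t u,
      is_update w M s i0 (val x) t /\ is_update w M t i1 (val y) u /\ u ∈ T.

(** ** Ultrafilters *)

(** In these definitions [U] is a unary predicate on the structure [X], so that
    they express statements about <X, mem, U>. *)
Section Ultrafilters.
Context {X : set_structure}.
Variables (k : X) (U : X -> Prop).

Definition ultrafilter : Prop :=
  (forall x, U x -> subset x k) /\
  U k /\
  (forall x y z, U x -> U y -> (forall a, a ∈ z <-> a ∈ x /\ a ∈ y) -> U z) /\
  (forall x y, U x -> subset x y -> subset y k -> U y) /\
  (forall x y, subset x k -> (forall a, a ∈ y <-> a ∈ k /\ a ∉ x) -> (U y <-> ~ U x)).

Definition nonprincipal : Prop :=
  forall a x, a ∈ k -> is_upair x a a -> ~ U x.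

Definition U_sequence (f c : X) : Prop :=
  is_fun f c /\ forall a x, rel f a x -> U x.

(** <k-completeness *)
Definition complete : Prop :=
  forall c f z, c ∈ k -> U_sequence f c ->
    (forall b, b ∈ z <-> b ∈ k /\ forall a x, rel f a x -> b ∈ x) -> U z.

(** Closure under diagonal intersections. *)
Definition normal : Prop :=
  forall f z, U_sequence f k ->
    (forall b, b ∈ z <-> b ∈ k /\ forall a x, a ∈ b -> rel f a x -> b ∈ x) -> U z.

Definition weakly_amenable : Prop :=
  forall f, is_fun f k -> (forall a x, rel f a x -> subset x k) ->
    exists z, forall a, a ∈ z <-> a ∈ k /\ exists x, rel f a x /\ U x.

(** The set of a < k with P a is an element of X and belongs to U. *)
Definition U_almost_all (P : X -> Prop) : Prop :=
  exists z, (forall a, a ∈ z <-> a ∈ k /\ P a) /\ U z.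

End Ultrafilters.

Definition measurable (V : set_structure) (k : V) : Prop :=
  uncountable_cardinal k /\
  exists u : V, ultrafilter k (fun x => x ∈ u) /\
    nonprincipal k (fun x => x ∈ u) /\ complete k (fun x => x ∈ u).

Definition limit_of_measurables (V : set_structure) (k : V) : Prop :=
  unbounded_in k (fun m => measurable m).

(** ** Iterated ultrapowers *)

(** <Y, UY> is the ultrapower of <X, U> by the X-ultrafilter U on k, formed with
    the functions in X: the class of f is the y with [cls f y], and [emb] is the
    ultrapower embedding, which sends a to the class of the constant function.
    The structures need not be well-founded; "f is a function with domain k"
    and "f(a)" are evaluated in X. *)
Definition is_ultrapower (X Y : set_structure) (k : X) (U : X -> Prop)
    (UY : Y -> Prop) (cls : X -> Y -> Prop) (emb : X -> Y -> Prop) : Prop :=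
  (forall f, is_fun f k -> exists! y, cls f y) /\
  (forall y, exists f, is_fun f k /\ cls f y) /\
  (forall f g y z, is_fun f k -> is_fun g k -> cls f y -> cls g z ->
     (y = z <-> U_almost_all k U (fun a => exists b, rel f a b /\ rel g a b)) /\
     (y ∈ z <-> U_almost_all k U (fun a => exists b c, rel f a b /\ rel g a c /\ b ∈ c)) /\
     (UY y <-> U_almost_all k U (fun a => exists b, rel f a b /\ U b))) /\
  (forall x y, emb x y <->
     exists f, is_fun f k /\ (forall a, a ∈ k -> rel f a x) /\ cls f y).

(** A linear system of structures with predicates and maps, coded by sets of V:
    - x belongs to the a-th structure iff <a,x> is in N;
    - y is below z in the a-th structure iff <a,<y,z>> is in R;
    - x satisfies the predicate of the a-th structure iff <a,x> is in W;
    - the map from the a-th to the b-th structure sends x to y iff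
      <<a,b>,<x,y>> is in J;
    - y in the b-th structure (b = a+1) is the class of the function f of the
      a-th structure iff <a,<f,y>> is in C. *)
Section Systems.
Context {V : set_structure}.
Variables N R W J C : V.

Definition stage (a : V) : set_structure :=
  {| carrier := {x : V | rel N a x};
     mem x y := exists p, is_pair p (proj1_sig x) (proj1_sig y) /\ rel R a p |}.

Definition sval (a : V) (x : stage a) : V := proj1_sig x.

Definition stage_filter (a : V) (x : stage a) : Prop := rel W a (sval x).

Definition stage_map (a b : V) (x : stage a) (y : stage b) : Prop :=
  exists p q, is_pair p a b /\ is_pair q (sval x) (sval y) /\ rel J p q.

Definition stage_class (a b : V) (f : stage a) (y : stage b) : Prop :=
  exists q, is_pair q (sval f) (sval y) /\ rel C a q.

Definition commuting_system (th : V) : Prop :=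
  (forall a b, a ∈ th -> b ∈ th -> subset a b ->
     forall x : stage a, exists! y : stage b, stage_map x y) /\
  (forall a (x : stage a), a ∈ th -> stage_map x x) /\
  (forall a b c (x : stage a) (y : stage b) (z : stage c),
     a ∈ th -> b ∈ th -> c ∈ th -> subset a b -> subset b c ->
     stage_map x y -> stage_map y z -> stage_map x z).

(** The stage l is the direct limit of the stages below l. *)
Definition is_direct_limit (l : V) : Prop :=
  (forall y : stage l, exists a (x : stage a), a ∈ l /\ stage_map x y) /\
  (forall a (x x' : stage a) (y y' : stage l), a ∈ l ->
     stage_map x y -> stage_map x' y' ->
     (y = y' <-> exists b (z : stage b),
        b ∈ l /\ subset a b /\ stage_map x z /\ stage_map x' z) /\
     (y ∈ y' <-> exists b (z z' : stage b),
        b ∈ l /\ subset a b /\ stage_map x z /\ stage_map x' z' /\ z ∈ z') /\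
     (stage_filter y <-> exists b (z : stage b),
        b ∈ l /\ subset a b /\ stage_map x z /\ stage_filter z)).

(** The system is the iterated ultrapower of <M, U> of length th, where U is an
    M-ultrafilter on k. *)
Definition is_iteration (k M U th : V) : Prop :=
  commuting_system th /\
  (forall o, is_empty o -> o ∈ th ->
     (forall x, rel N o x <-> x ∈ M) /\
     (forall x y : stage o, x ∈ y <-> sval x ∈ sval y) /\
     (forall x : stage o, stage_filter x <-> sval x ∈ U)) /\
  (forall o a b (k0 : stage o) (ka : stage a),
     is_empty o -> a ∈ th -> b ∈ th -> is_succ b a ->
     sval k0 = k -> stage_map k0 ka ->
     is_ultrapower ka (@stage_filter a) (@stage_filter b)
       (@stage_class a b) (@stage_map a b)) /\
  (forall l, l ∈ th -> limit_ordinal l -> is_direct_limit l).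

Definition stage_wellfounded (a : V) : Prop :=
  forall s : V, (exists x, x ∈ s) -> (forall x, x ∈ s -> rel N a x) ->
    exists m : stage a, sval m ∈ s /\ forall y : stage a, sval y ∈ s -> y ∉ m.

End Systems.

(** The iterated ultrapower of a given length exists and is unique up to
    isomorphism, so all iterated ultrapowers are well-founded iff for each
    length there is one with well-founded stages. *)
Definition iterable_pair (V : set_structure) (k M U : V) : Prop :=
  forall th : V, ordinal th ->
    exists N R W J C : V, is_iteration N R W J C k M U th /\
      forall a, a ∈ th -> stage_wellfounded N R a.

Definition iterable_cardinal (V : set_structure) (k : V) : Prop :=
  uncountable_cardinal k /\
  forall x : V, subset x k ->
    exists (M U : V) (kM : set_model M),
      transitive M /\ ZFC_minus (@internally_definable V M) /\
      has_card M k /\ val kM = k /\ x ∈ M /\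
      (forall y, y ∈ U -> y ∈ M /\ subset y k) /\
      (let UM := fun y : set_model M => val y ∈ U in
       ultrafilter kM UM /\ nonprincipal kM UM /\ complete kM UM /\
       normal kM UM /\ weakly_amenable kM UM) /\
      iterable_pair k M U.

(* Main.v *)
(** Let [i] be the embedding of an iterated ultrapower by a normal measure on a measurable
    cardinal [d < kappa] above the parameters. It fixes [kappa] and the parameters, hence
    [i(x) ∈ A] for [x ∈ A], because Sigma_1 formulas are upwards absolute. If [i(x) = x] for all
    lengths of the iteration below [kappa], then [x] is determined by [x ∩ d]; since [A] has more
    than [kappa] members, there is an [x ∈ A] unbounded in [kappa] which for every [d] is moved by
    some iterate. This yields iterations [i_n], the measurable cardinal of each being above the
    lengths and the measurable cardinals of its predecessors, with [i_n(x) <> x]. By an argument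
    of Kunen every ordinal below [kappa] is moved by only finitely many of the [i_n], so every
    element of [x] belongs to some [x ∩ i_n(x)]. An iterable cardinal does not have cofinality
    omega, thus one of these intersections is unbounded.

    Instead of the universe, transitive sets containing the relevant Sigma_1 witnesses are
    embedded. *)

From Stdlib Require Import List Lia Setoid Classical ClassicalEpsilon FunctionalExtensionality.
Require Import Defs.
Set Implicit Arguments.
Unset Strict Implicit.
Unset Printing Implicit Defensive.

(** * Definability with parameters *)

(** A single ultrapower does not suffice: sets it fixes are determined by their trace on [d] only up
    to the image of [d], and iterates of length [a] push that image past [a]. Such an iterate is not
    built by recursion along [a]; it is collapsed at once from the functions on [a -> d] with finite
    support, so that one notion, a filter with supports, serves for all embeddings. Cardinal
    arithmetic is replaced by one principle: a set is small for a measurable [d] iff every map from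
    [d] into it is constant almost everywhere. It shows that [d] is a strong limit, that the
    parameters are fixed, that images of ordinals below [kappa] stay below [kappa], and that few
    members of [A] are exceptional. Fixing [kappa] also needs that functions into [kappa] are
    bounded almost everywhere. Only cofinality omega is excluded for [kappa], so in the singular
    case [d] is taken above a cofinality witness. Separation and Collection hold only for definable
    relations of an arbitrary model, so every predicate in use has to be shown definable; tactics do
    this. *)

Lemma sat_ext (V : set_structure) p : forall r s : nat -> V,
  (forall n, r n = s n) -> (sat p r <-> sat p s).
Proof.
intros r s H; replace s with r; [tauto | now apply functional_extensionality].
Qed.

Definition ren_up (f : nat -> nat) n := match n with 0 => 0 | S m => S (f m) end.

Fixpoint ren (f : nat -> nat) p := match p with
  | fIn i j => fIn (f i) (f j)
  | fEq i j => fEq (f i) (f j)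
  | fNot q => fNot (ren f q)
  | fAnd q r => fAnd (ren f q) (ren f r)
  | fEx q => fEx (ren (ren_up f) q)
  end.

Lemma sat_ren (V : set_structure) p : forall f (r : nat -> V),
  sat (ren f p) r <-> sat p (fun n => r (f n)).
Proof.
induction p as [i j|i j|p IH|p IHp q IHq|p IH]; intros f r; simpl; try tauto.
- now rewrite IH.
- now rewrite IHp, IHq.
- split; intros [x Hx]; exists x.
  + apply IH in Hx; revert Hx; apply sat_ext; now intros [|n].
  + apply IH; revert Hx; apply sat_ext; now intros [|n].
Qed.

(** One assignment with room for infinitely many variables at the even places and infinitely many
    parameters at the odd ones, so that no arities have to be tracked. *)
Fixpoint mix (X : Type) (r s : nat -> X) (n : nat) : X := match n with
  | 0 => r 0
  | 1 => s 0
  | S (S n) => mix (fun i => r (S i)) (fun i => s (S i)) n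
  end.

Lemma mix_ext (X : Type) n : forall r s r' s' : nat -> X,
  (forall i, r i = r' i) -> (forall i, s i = s' i) -> mix r s n = mix r' s' n.
Proof.
induction n as [n IH] using (well_founded_induction Wf_nat.lt_wf).
intros r s r' s' Hr Hs; destruct n as [|[|n]]; simpl; auto.
Qed.

Lemma mix_map (X Y : Type) (h : X -> Y) n : forall r s,
  h (mix r s n) = mix (fun i => h (r i)) (fun i => h (s i)) n.
Proof.
induction n as [n IH] using (well_founded_induction Wf_nat.lt_wf).
intros r s; destruct n as [|[|n]]; simpl; auto.
Qed.

Lemma mix_even (X : Type) n : forall r s : nat -> X, mix r s (2 * n) = r n.
Proof.
induction n as [|n IH]; intros r s; [reflexivity|].
replace (2 * S n) with (S (S (2 * n))) by lia; apply IH.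
Qed.

Lemma mix_odd (X : Type) n : forall r s : nat -> X, mix r s (S (2 * n)) = s n.
Proof.
induction n as [|n IH]; intros r s; [reflexivity|].
replace (S (2 * S n)) with (S (S (S (2 * n)))) by lia; apply IH.
Qed.

Class ZFCm (V : set_structure) := zfcm : ZFC_minus (@fo_definable V).

Section Definable.
Context {V : set_structure} {HZ : ZFCm V}.
Implicit Types (r : nat -> V).

(** The parameters [s] are interleaved with the variables. *)
Definition definable (P : (nat -> V) -> Prop) :=
  exists p s, forall r, P r <-> sat p (mix r s).

Definition definable_term (t : (nat -> V) -> V) := definable (fun r => r 0 = t (fun n => r (S n))).

Lemma V_inhabited : inhabited V.
Proof. destruct (zfc_infinity zfcm) as [w _]; exact (inhabits w). Qed.

Lemma D_ext P Q : (forall r, P r <-> Q r) -> definable P -> definable Q.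
Proof.
intros H [p [s Hp]]; exists p, s; intros r; rewrite <- H; apply Hp.
Qed.

Lemma sat_mix2 p (k l : nat -> nat) r s (R : nat -> V) :
  (forall i, r i = R (k i)) -> (forall i, s i = R (l i)) ->
  sat p (mix r s) <-> sat (ren (mix k l) p) R.
Proof.
intros Hr Hs; rewrite sat_ren; apply sat_ext; intros n.
rewrite (mix_map R); now apply mix_ext.
Qed.

Lemma D_not P : definable P -> definable (fun r => ~ P r).
Proof. intros [p [s Hp]]; exists (fNot p), s; intros r; simpl; now rewrite Hp. Qed.

Lemma D_and P Q : definable P -> definable Q -> definable (fun r => P r /\ Q r).
Proof.
intros [p [s Hp]] [q [t Hq]].
exists (fAnd (ren (mix (fun i => 2 * i) (fun j => S (2 * (2 * j)))) p)
             (ren (mix (fun i => 2 * i) (fun j => S (2 * (S (2 * j))))) q)), (mix s t).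
intros r; cbn [sat]; rewrite Hp, Hq.
rewrite <- (@sat_mix2 p _ _ r s), <- (@sat_mix2 q _ _ r t);
  [tauto | | | |]; intros i; now rewrite ?mix_even, ?mix_odd, ?mix_even, ?mix_odd.
Qed.

Lemma D_ex (P : (nat -> V) -> V -> Prop) :
  definable (fun r => P (fun n => r (S n)) (r 0)) -> definable (fun r => exists y, P r y).
Proof.
intros [p [s Hp]].
exists (fEx (ren (mix (fun i => match i with 0 => 0 | S i => S (2 * i) end)
                      (fun j => S (S (2 * j)))) p)), s.
intros r; simpl; split; intros [y Hy]; exists y; revert Hy.
- intros Hy; rewrite <- (@sat_mix2 p _ _ (scons y r) s).
  + now apply Hp.
  + intros [|i]; simpl; rewrite ?mix_even; auto using mix_even.
    symmetry; apply (mix_even i r s).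
  + intros i; symmetry; apply (mix_odd i r s).
- intros Hy; rewrite <- (@sat_mix2 p _ _ (scons y r) s) in Hy.
  + now apply Hp in Hy.
  + intros [|i]; simpl; [reflexivity|].
    symmetry; apply (mix_even i r s).
  + intros i; symmetry; apply (mix_odd i r s).
Qed.

Lemma D_ren (f : nat -> nat) P : definable P -> definable (fun r => P (fun n => r (f n))).
Proof.
intros [p [s Hp]].
exists (ren (mix (fun i => 2 * f i) (fun j => S (2 * j))) p), s; intros r.
rewrite Hp; apply sat_mix2; intros i; now rewrite ?mix_even, ?mix_odd.
Qed.

Lemma D_eq_var i j : definable (fun r => r i = r j).
Proof.
destruct V_inhabited as [v]; exists (fEq (2 * i) (2 * j)), (fun _ => v); intros r.
cbn [sat]; now rewrite !mix_even.
Qed.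

Lemma D_mem_var i j : definable (fun r => r i ∈ r j).
Proof.
destruct V_inhabited as [v]; exists (fIn (2 * i) (2 * j)), (fun _ => v); intros r.
cbn [sat]; now rewrite !mix_even.
Qed.

Lemma T_const a : definable_term (fun _ => a).
Proof.
exists (fEq (2 * 0) (S (2 * 0))), (fun _ => a); intros r.
cbn [sat]; now rewrite mix_even, mix_odd.
Qed.

Lemma T_var i : definable_term (fun r => r i).
Proof. apply D_eq_var. Qed.

(** By excluded middle a constant predicate is always true or always false, so no formula has to be
    found for [P] itself. *)
Lemma D_prop (P : Prop) : definable (fun _ => P).
Proof.
destruct (classic P) as [H|H].
- apply (@D_ext (fun r => r 0 = r 0)); [tauto | apply D_eq_var].
- apply (@D_ext (fun r => ~ r 0 = r 0)); [tauto | apply D_not, D_eq_var].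
Qed.

(** The language has no function symbols, so substituting a term means quantifying over its
    value. *)
Lemma D_bind t (P : (nat -> V) -> V -> Prop) :
  definable_term t -> definable (fun r => P (fun n => r (S n)) (r 0)) -> definable (fun r => P r (t r)).
Proof.
intros Ht HP; apply (@D_ext (fun r => exists y, y = t r /\ P r y)).
- intros r; split; [now intros [y [-> Hy]] | now exists (t r)].
- apply D_ex, D_and; assumption.
Qed.

Lemma T_ren (f : nat -> nat) t : definable_term t -> definable_term (fun r => t (fun n => r (f n))).
Proof. exact (@D_ren (ren_up f) _). Qed.

Lemma T_bind t (F : (nat -> V) -> V -> V) :
  definable_term t -> definable_term (fun r => F (fun n => r (S n)) (r 0)) -> definable_term (fun r => F r (t r)).
Proof.
intros Ht HF; apply (@D_bind (fun r => t (fun n => r (S n)))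
  (fun r y => r 0 = F (fun n => r (S n)) y)).
- exact (T_ren S Ht).
- exact (D_ren (fun n => match n with 0 => 1 | 1 => 0 | m => m end) HF).
Qed.

Lemma D_eq a b : definable_term a -> definable_term b -> definable (fun r => a r = b r).
Proof.
intros Ha Hb; apply (@D_bind a (fun r x => x = b r)); [assumption | exact Hb].
Qed.

Lemma D_mem a b : definable_term a -> definable_term b -> definable (fun r => a r ∈ b r).
Proof.
intros Ha Hb; apply (@D_bind a (fun r x => x ∈ b r)); [assumption |].
apply (@D_bind (fun r => b (fun n => r (S n))) (fun r x => r 0 ∈ x)).
- exact (T_ren S Hb).
- apply D_mem_var.
Qed.

Lemma D_or P Q : definable P -> definable Q -> definable (fun r => P r \/ Q r).
Proof.
intros HP HQ; apply (@D_ext (fun r => ~ (~ P r /\ ~ Q r))).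
- intros r; tauto.
- auto using D_not, D_and.
Qed.

Lemma D_imp (P Q : (nat -> V) -> Prop) : definable P -> definable Q -> definable (fun r => P r -> Q r).
Proof.
intros HP HQ; apply (@D_ext (fun r => ~ (P r /\ ~ Q r))).
- intros r; tauto.
- auto using D_not, D_and.
Qed.

Lemma D_iff P Q : definable P -> definable Q -> definable (fun r => P r <-> Q r).
Proof. intros HP HQ; apply D_and; now apply D_imp. Qed.

Lemma D_all (P : (nat -> V) -> V -> Prop) :
  definable (fun r => P (fun n => r (S n)) (r 0)) -> definable (fun r => forall y, P r y).
Proof.
intros H; apply (@D_ext (fun r => ~ exists y, ~ P r y)).
- intros r; split; [|firstorder].
  intros H1 y; apply NNPP; intros H2; apply H1; eauto.
- apply D_not, D_ex, D_not, H.
Qed.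

Lemma D_exu (P : (nat -> V) -> V -> Prop) :
  definable (fun r => P (fun n => r (S n)) (r 0)) -> definable (fun r => exists! y, P r y).
Proof.
intros H; unfold unique; apply D_ex, D_and; [exact H|].
apply D_all, D_imp.
- exact (D_ren (fun n => match n with 0 => 0 | S m => S (S m) end) H).
- apply D_eq; [exact (T_var 1) | exact (T_var 0)].
Qed.

(** Needed for Łoś's theorem, where [q] is an arbitrary formula. Infinitely many terms [t n] are
    supplied, but recursion on [q] meets only finitely many of them. *)
Lemma D_sat q : forall t : nat -> (nat -> V) -> V,
  (forall n, definable_term (t n)) -> definable (fun r => sat q (fun n => t n r)).
Proof.
induction q as [i j|i j|p IH|p IHp q IHq|p IH]; intros t Ht; simpl.
- now apply D_mem.
- now apply D_eq.
- now apply D_not, IH.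
- now apply D_and; [apply IHp | apply IHq].
- apply D_ex.
  apply (@D_ext (fun r => sat p (fun n => match n with 0 => fun r => r 0
    | S m => fun r => t m (fun n => r (S n)) end r))).
  + intros r; apply sat_ext; now intros [|n].
  + apply IH; intros [|n]; [apply T_var | exact (T_ren S (Ht n))].
Qed.

(** These classes register the definability of named notions; the tactic [dfn] combines the
    instances along the shape of a compound expression. *)
Class DP1 (P : V -> Prop) := dp1 : definable (fun r => P (r 0)).
Class DP2 (P : V -> V -> Prop) := dp2 : definable (fun r => P (r 0) (r 1)).
Class DP3 (P : V -> V -> V -> Prop) := dp3 : definable (fun r => P (r 0) (r 1) (r 2)).
Class DP4 (P : V -> V -> V -> V -> Prop) :=
  dp4 : definable (fun r => P (r 0) (r 1) (r 2) (r 3)).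
Class DP5 (P : V -> V -> V -> V -> V -> Prop) :=
  dp5 : definable (fun r => P (r 0) (r 1) (r 2) (r 3) (r 4)).
Class DF1 (F : V -> V) := df1 : definable_term (fun r => F (r 0)).
Class DF2 (F : V -> V -> V) := df2 : definable_term (fun r => F (r 0) (r 1)).
Class DF3 (F : V -> V -> V -> V) := df3 : definable_term (fun r => F (r 0) (r 1) (r 2)).
Class DF4 (F : V -> V -> V -> V -> V) :=
  df4 : definable_term (fun r => F (r 0) (r 1) (r 2) (r 3)).
Class DF5 (F : V -> V -> V -> V -> V -> V) :=
  df5 : definable_term (fun r => F (r 0) (r 1) (r 2) (r 3) (r 4)).

Lemma D_app1 P a : DP1 P -> definable_term a -> definable (fun r => P (a r)).
Proof.
intros H Ha; apply (@D_bind a (fun r x => P x)); [exact Ha | exact H].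
Qed.

Lemma D_app2 P a b : DP2 P -> definable_term a -> definable_term b -> definable (fun r => P (a r) (b r)).
Proof.
intros H Ha Hb; apply (@D_bind a (fun r x => P x (b r))); [exact Ha |].
apply (@D_bind (fun r => b (fun n => r (S n))) (fun r x => P (r 0) x));
  [exact (T_ren S Hb) |].
exact (D_ren (fun n => match n with 0 => 1 | 1 => 0 | m => m end) H).
Qed.

Lemma D_app3 P a b c : DP3 P -> definable_term a -> definable_term b -> definable_term c -> definable (fun r => P (a r) (b r) (c r)).
Proof.
intros H Ha Hb Hc; apply (@D_bind a (fun r x => P x (b r) (c r))); [exact Ha |].
apply (@D_bind (fun r => b (fun n => r (S n))) (fun r x => P (r 0) x (c (fun n => r (S n)))));
  [exact (T_ren S Hb) |].
apply (@D_bind (fun r => c (fun n => r (S (S n)))) (fun r x => P (r 1) (r 0) x));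
  [exact (T_ren (fun n => S (S n)) Hc) |].
exact (D_ren (fun n => match n with 0 => 2 | 1 => 1 | 2 => 0 | m => m end) H).
Qed.

Lemma D_app4 P a b c d : DP4 P -> definable_term a -> definable_term b -> definable_term c -> definable_term d ->
  definable (fun r => P (a r) (b r) (c r) (d r)).
Proof.
intros H Ha Hb Hc Hd; apply (@D_bind a (fun r x => P x (b r) (c r) (d r))); [exact Ha |].
apply (@D_bind (fun r => b (fun n => r (S n)))
  (fun r x => P (r 0) x (c (fun n => r (S n))) (d (fun n => r (S n)))));
  [exact (T_ren S Hb) |].
apply (@D_bind (fun r => c (fun n => r (S (S n))))
  (fun r x => P (r 1) (r 0) x (d (fun n => r (S (S n))))));
  [exact (T_ren (fun n => S (S n)) Hc) |].
apply (@D_bind (fun r => d (fun n => r (S (S (S n))))) (fun r x => P (r 2) (r 1) (r 0) x));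
  [exact (T_ren (fun n => S (S (S n))) Hd) |].
exact (D_ren (fun n => match n with 0 => 3 | 1 => 2 | 2 => 1 | 3 => 0 | m => m end) H).
Qed.

Lemma D_app5 P a b c d e : DP5 P -> definable_term a -> definable_term b -> definable_term c -> definable_term d -> definable_term e ->
  definable (fun r => P (a r) (b r) (c r) (d r) (e r)).
Proof.
intros H Ha Hb Hc Hd He; apply (@D_bind a (fun r x => P x (b r) (c r) (d r) (e r))); [exact Ha |].
apply (@D_bind (fun r => b (fun n => r (S n)))
  (fun r x => P (r 0) x (c (fun n => r (S n))) (d (fun n => r (S n))) (e (fun n => r (S n)))));
  [exact (T_ren S Hb) |].
apply (@D_bind (fun r => c (fun n => r (S (S n))))
  (fun r x => P (r 1) (r 0) x (d (fun n => r (S (S n)))) (e (fun n => r (S (S n))))));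
  [exact (T_ren (fun n => S (S n)) Hc) |].
apply (@D_bind (fun r => d (fun n => r (S (S (S n)))))
  (fun r x => P (r 2) (r 1) (r 0) x (e (fun n => r (S (S (S n)))))));
  [exact (T_ren (fun n => S (S (S n))) Hd) |].
apply (@D_bind (fun r => e (fun n => r (S (S (S (S n)))))) (fun r x => P (r 3) (r 2) (r 1) (r 0) x));
  [exact (T_ren (fun n => S (S (S (S n)))) He) |].
exact (D_ren (fun n => match n with 0 => 4 | 1 => 3 | 2 => 2 | 3 => 1 | 4 => 0 | m => m end) H).
Qed.

Lemma T_app1 F a : DF1 F -> definable_term a -> definable_term (fun r => F (a r)).
Proof.
intros H Ha.
apply (@D_app2 (fun y x => y = F x) (fun r => r 0) (fun r => a (fun n => r (S n))));
  [exact H | apply T_var | exact (T_ren S Ha)].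
Qed.

Lemma T_app2 F a b : DF2 F -> definable_term a -> definable_term b -> definable_term (fun r => F (a r) (b r)).
Proof.
intros H Ha Hb.
apply (@D_app3 (fun y x z => y = F x z) (fun r => r 0) (fun r => a (fun n => r (S n)))
  (fun r => b (fun n => r (S n))));
  [exact H | apply T_var | exact (T_ren S Ha) | exact (T_ren S Hb)].
Qed.

Lemma T_app3 F a b c : DF3 F -> definable_term a -> definable_term b -> definable_term c -> definable_term (fun r => F (a r) (b r) (c r)).
Proof.
intros H Ha Hb Hc.
apply (@D_app4 (fun y x z w => y = F x z w) (fun r => r 0) (fun r => a (fun n => r (S n)))
  (fun r => b (fun n => r (S n))) (fun r => c (fun n => r (S n))));
  [exact H | apply T_var | exact (T_ren S Ha) | exact (T_ren S Hb) | exact (T_ren S Hc)].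
Qed.

Lemma T_app4 F a b c d : DF4 F -> definable_term a -> definable_term b -> definable_term c -> definable_term d ->
  definable_term (fun r => F (a r) (b r) (c r) (d r)).
Proof.
intros H Ha Hb Hc Hd.
apply (@D_app5 (fun y x z w v => y = F x z w v) (fun r => r 0) (fun r => a (fun n => r (S n)))
  (fun r => b (fun n => r (S n))) (fun r => c (fun n => r (S n))) (fun r => d (fun n => r (S n))));
  [exact H | apply T_var | exact (T_ren S Ha) | exact (T_ren S Hb) | exact (T_ren S Hc) | exact (T_ren S Hd)].
Qed.

Lemma T_app5 F a b c d e : DF5 F -> definable_term a -> definable_term b -> definable_term c -> definable_term d -> definable_term e ->
  definable_term (fun r => F (a r) (b r) (c r) (d r) (e r)).
Proof.
intros H Ha Hb Hc Hd He.
apply (@T_bind a (fun r x => F x (b r) (c r) (d r) (e r))); [exact Ha |].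
apply (@T_bind (fun r => b (fun n => r (S n)))
  (fun r x => F (r 0) x (c (fun n => r (S n))) (d (fun n => r (S n))) (e (fun n => r (S n)))));
  [exact (T_ren S Hb) |].
apply (@T_bind (fun r => c (fun n => r (S (S n))))
  (fun r x => F (r 1) (r 0) x (d (fun n => r (S (S n)))) (e (fun n => r (S (S n))))));
  [exact (T_ren (fun n => S (S n)) Hc) |].
apply (@T_bind (fun r => d (fun n => r (S (S (S n)))))
  (fun r x => F (r 2) (r 1) (r 0) x (e (fun n => r (S (S (S n)))))));
  [exact (T_ren (fun n => S (S (S n))) Hd) |].
apply (@T_bind (fun r => e (fun n => r (S (S (S (S n)))))) (fun r x => F (r 3) (r 2) (r 1) (r 0) x));
  [exact (T_ren (fun n => S (S (S (S n)))) He) |].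
exact (T_ren (fun n => match n with 0 => 4 | 1 => 3 | 2 => 2 | 3 => 1 | 4 => 0 | m => m end) H).
Qed.

(** Passes to the form in which Separation and Collection are stated. The variables from 2 on, on
    which the relation does not depend, are filled with the parameter [s 0]. *)
Lemma D2_fo Q : DP2 Q -> fo_definable Q.
Proof.
intros [p [s Hp]].
exists (ren (mix (fun i => match i with 0 => 0 | 1 => 1 | S (S i) => S (S (2 * i)) end)
   (fun j => S (S (S (2 * j))))) p), (mix (fun _ => s 0) s).
intros x y.
rewrite (Hp (scons x (scons y (fun _ => s 0)))).
apply sat_mix2.
- intros [|[|i]]; auto; symmetry; apply (mix_even i (fun _ => s 0) s).
- intros i; symmetry; apply (mix_odd i (fun _ => s 0) s).
Qed.

End Definable.

(** * Sets, functions and ordinals *)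

Section Iota.
Context {V : set_structure} {HZ : ZFCm V}.

Definition emp : V := epsilon V_inhabited is_empty.

(** Definite description, with the junk value [emp] when there is no unique witness. *)
Definition iota (P : V -> Prop) : V :=
  if excluded_middle_informative (exists! z, P z) then epsilon V_inhabited P else emp.

Lemma ext (x y : V) : (forall z, z ∈ x <-> z ∈ y) -> x = y.
Proof. apply (zfc_ext zfcm). Qed.

Lemma not_in_emp (z : V) : z ∉ emp.
Proof.
revert z; unfold emp; apply (epsilon_spec V_inhabited is_empty).
destruct (zfc_infinity zfcm) as [w [[e [He _]] _]]; now exists e.
Qed.

Lemma iota_spec P : (exists! z, P z) -> P (iota P).
Proof.
intros H; unfold iota; destruct (excluded_middle_informative _) as [_|n]; [|contradiction].
apply epsilon_spec; destruct H as [z [Hz _]]; now exists z.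
Qed.

Lemma iota_junk P : ~ (exists! z, P z) -> iota P = emp.
Proof.
intros H; unfold iota; destruct (excluded_middle_informative _) as [n|_]; [contradiction|reflexivity].
Qed.

Lemma iota_eq (P : V -> Prop) a : P a -> (forall z, P z -> z = a) -> iota P = a.
Proof.
intros Ha Hu; apply Hu, iota_spec; exists a; split; [assumption|].
intros z Hz; symmetry; auto.
Qed.

(** The junk value [emp] is recognized by having no elements, so both cases of a description have a
    definable graph. *)
Lemma T_iota (P : (nat -> V) -> V -> Prop) :
  definable (fun r => P (fun n => r (S n)) (r 0)) -> definable_term (fun r => iota (P r)).
Proof.
intros H.
apply (@D_ext V (fun r => ((exists! z, P (fun n => r (S n)) z) /\ P (fun n => r (S n)) (r 0)) \/
   (~ (exists! z, P (fun n => r (S n)) z) /\ forall z, z ∉ r 0))).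
- intros r; split.
  + intros [[Hu Hz]|[Hu Hz]].
    * pose proof (iota_spec Hu) as Hi; destruct Hu as [z [_ Hu]].
      now rewrite <- (Hu _ Hz), <- (Hu _ Hi).
    * rewrite (iota_junk Hu); apply ext; intros z; split; intros H1; [now destruct (Hz z)|].
      now destruct (not_in_emp H1).
  + intros E; destruct (classic (exists! z, P (fun n => r (S n)) z)) as [Hu|Hu].
    * left; split; [assumption|]; rewrite E; now apply iota_spec.
    * right; split; [assumption|]; rewrite E, (iota_junk Hu); apply not_in_emp.
- assert (HE : definable (fun r => exists! z, P (fun n => r (S n)) z)).
  { apply D_exu; exact (D_ren (fun n => match n with 0 => 0 | S m => S (S m) end) H). }
  apply D_or; apply D_and; auto using D_not.
  apply D_all, D_not, D_mem; [exact (T_var 0) | exact (T_var 1)].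
Qed.

End Iota.

Ltac dhook := fail.

Ltac dapp :=
  match goal with
  | |- definable (fun r => ?P (@?a r) (@?b r) (@?c r) (@?d r) (@?e r)) =>
      apply (D_app5 (P:=P) (a:=a) (b:=b) (c:=c) (d:=d) (e:=e)); [solve [typeclasses eauto] | ..]
  | |- definable (fun r => ?P (@?a r) (@?b r) (@?c r) (@?d r)) =>
      apply (D_app4 (P:=P) (a:=a) (b:=b) (c:=c) (d:=d)); [solve [typeclasses eauto] | ..]
  | |- definable (fun r => ?P (@?a r) (@?b r) (@?c r)) =>
      apply (D_app3 (P:=P) (a:=a) (b:=b) (c:=c)); [solve [typeclasses eauto] | ..]
  | |- definable (fun r => ?P (@?a r) (@?b r)) =>
      apply (D_app2 (P:=P) (a:=a) (b:=b)); [solve [typeclasses eauto] | ..]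
  | |- definable (fun r => ?P (@?a r)) =>
      apply (D_app1 (P:=P) (a:=a)); [solve [typeclasses eauto] | ..]
  | |- definable_term (fun r => ?P (@?a r) (@?b r) (@?c r) (@?d r) (@?e r)) =>
      apply (T_app5 (F:=P) (a:=a) (b:=b) (c:=c) (d:=d) (e:=e)); [solve [typeclasses eauto] | ..]
  | |- definable_term (fun r => ?P (@?a r) (@?b r) (@?c r) (@?d r)) =>
      apply (T_app4 (F:=P) (a:=a) (b:=b) (c:=c) (d:=d)); [solve [typeclasses eauto] | ..]
  | |- definable_term (fun r => ?P (@?a r) (@?b r) (@?c r)) =>
      apply (T_app3 (F:=P) (a:=a) (b:=b) (c:=c)); [solve [typeclasses eauto] | ..]
  | |- definable_term (fun r => ?P (@?a r) (@?b r)) =>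
      apply (T_app2 (F:=P) (a:=a) (b:=b)); [solve [typeclasses eauto] | ..]
  | |- definable_term (fun r => ?P (@?a r)) =>
      apply (T_app1 (F:=P) (a:=a)); [solve [typeclasses eauto] | ..]
  end.

Ltac dstep :=
  lazymatch goal with
  | |- DP1 _ => red
  | |- DP2 _ => red
  | |- DP3 _ => red
  | |- DP4 _ => red
  | |- DP5 _ => red
  | |- DF1 _ => red
  | |- DF2 _ => red
  | |- DF3 _ => red
  | |- DF4 _ => red
  | |- DF5 _ => red
  | |- definable (fun _ => ?P) => apply D_prop
  | |- definable (fun r => @?P r /\ @?Q r) => apply (D_and (P:=P) (Q:=Q))
  | |- definable (fun r => @?P r \/ @?Q r) => apply (D_or (P:=P) (Q:=Q))
  | |- definable (fun r => @?P r <-> @?Q r) => apply (D_iff (P:=P) (Q:=Q))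
  | |- definable (fun r => ~ @?P r) => apply (D_not (P:=P))
  | |- definable (fun r => exists! y, @?P r y) => apply (D_exu (P:=P))
  | |- definable (fun r => exists y, @?P r y) => apply (D_ex (P:=P))
  | |- definable (fun r => forall y : carrier _, @?P r y) => apply (D_all (P:=P))
  | |- definable (fun r => @?P r -> @?Q r) => apply (D_imp (P:=P) (Q:=Q))
  | |- definable (fun r => @?a r = @?b r) => apply (@D_eq _ a b)
  | |- definable (fun r => @?a r ∈ @?b r) => apply (D_mem (a:=a) (b:=b))
  | |- definable_term (fun _ => ?a) => apply T_const
  | |- definable_term (fun r => r ?n) => apply T_var
  | |- definable_term (fun r => iota (@?P r)) => apply (T_iota (P:=P))
  | |- _ => first [dhook | dapp | assumption]
  end; cbn beta.

Ltac dfn := solve [cbn beta; repeat dstep].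

#[global] Hint Extern 5 (DP1 (fun _ => _)) => dfn : typeclass_instances.
#[global] Hint Extern 5 (DP2 (fun _ => _)) => dfn : typeclass_instances.
#[global] Hint Extern 5 (DF1 (fun _ => _)) => dfn : typeclass_instances.
#[global] Hint Extern 5 (DF2 (fun _ => _)) => dfn : typeclass_instances.

Section Sets.
Context {V : set_structure} {HZ : ZFCm V}.
Implicit Types (x y z a b c f : V).

Definition sep (a : V) (P : V -> Prop) : V := iota (fun s => forall z, z ∈ s <-> z ∈ a /\ P z).

Lemma in_sep (P : V -> Prop) {HP : DP1 P} a z : z ∈ sep a P <-> z ∈ a /\ P z.
Proof.
revert z; unfold sep; apply iota_spec.
destruct (@zfc_separation _ _ zfcm (fun z _ => P z)) with (a := a) (q := a) as [s Hs].
- apply D2_fo; dfn.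
- exists s; split; [exact Hs|]; intros t Ht; apply ext; intros z; now rewrite Hs, Ht.
Qed.

Lemma T_sep (a : (nat -> V) -> V) (P : (nat -> V) -> V -> Prop) :
  definable_term a -> definable (fun r => P (fun n => r (S n)) (r 0)) -> definable_term (fun r => sep (a r) (P r)).
Proof.
intros Ha HP; unfold sep.
pose proof (T_ren (fun n => S (S n)) Ha) as Ha2.
pose proof (D_ren (fun n => match n with 0 => 0 | S m => S (S m) end) HP) as HP2.
dfn.
Qed.

Definition repl (a : V) (F : V -> V) : V :=
  iota (fun s => forall z, z ∈ s <-> exists x, x ∈ a /\ z = F x).

Lemma in_repl (F : V -> V) {HF : DF1 F} a z : z ∈ repl a F <-> exists x, x ∈ a /\ z = F x.
Proof.
revert z; unfold repl; apply iota_spec.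
destruct (@zfc_collection _ _ zfcm (fun x y => y = F x)) with (a := a) as [b Hb].
- apply D2_fo; dfn.
- intros x _; now exists (F x).
- exists (sep b (fun z => exists x, x ∈ a /\ z = F x)); split.
  + intros z; rewrite in_sep by dfn; split; [tauto|].
    intros [x [Hx ->]]; split; [|now exists x].
    destruct (Hb x Hx) as [y [Hy ->]]; assumption.
  + intros t Ht; apply ext; intros z; rewrite in_sep by dfn; rewrite Ht; split; [tauto|].
    intros [x [Hx ->]]; split; [|now exists x].
    destruct (Hb x Hx) as [y [Hy ->]]; assumption.
Qed.

Lemma T_repl (a : (nat -> V) -> V) (F : (nat -> V) -> V -> V) :
  definable_term a -> definable_term (fun r => F (fun n => r (S n)) (r 0)) -> definable_term (fun r => repl (a r) (F r)).
Proof.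
intros Ha HF; unfold repl.
pose proof (T_ren (fun n => S (S (S n))) Ha) as Ha2.
pose proof (T_ren (fun n => match n with 0 => 0 | S m => S (S (S m)) end) HF) as HF2.
dfn.
Qed.

Definition upair (a b : V) : V := iota (fun p => is_upair p a b).
Definition pair (a b : V) : V := upair (upair a a) (upair a b).
Definition union (a : V) : V := iota (fun u => forall z, z ∈ u <-> exists y, y ∈ a /\ z ∈ y).
Definition cup (a b : V) : V := union (upair a b).
Definition succ (a : V) : V := cup a (upair a a).
Definition app (f x : V) : V := iota (fun y => pair x y ∈ f).
Definition lam (a : V) (F : V -> V) : V := repl a (fun x => pair x (F x)).

#[global] Instance DP3_is_upair : DP3 (@is_upair V).
Proof. unfold is_upair; dfn. Qed.
#[global] Instance DF2_upair : DF2 upair.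
Proof. unfold upair; dfn. Qed.
#[global] Instance DF2_pair : DF2 pair.
Proof. unfold pair; dfn. Qed.
#[global] Instance DF1_union : DF1 union.
Proof. unfold union; dfn. Qed.
#[global] Instance DF2_cup : DF2 cup.
Proof. unfold cup; dfn. Qed.
#[global] Instance DF1_succ : DF1 succ.
Proof. unfold succ; dfn. Qed.
#[global] Instance DF2_app : DF2 app.
Proof. unfold app; dfn. Qed.

Lemma T_lam (a : (nat -> V) -> V) (F : (nat -> V) -> V -> V) :
  definable_term a -> definable_term (fun r => F (fun n => r (S n)) (r 0)) -> definable_term (fun r => lam (a r) (F r)).
Proof.
intros Ha HF; unfold lam; apply T_repl; [assumption|].
dfn.
Qed.

End Sets.

Ltac dhook ::= lazymatch goal with
  | |- definable_term (fun r => sep (@?a r) (@?P r)) => apply (T_sep (a:=a) (P:=P))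
  | |- definable_term (fun r => repl (@?a r) (@?F r)) => apply (T_repl (a:=a) (F:=F))
  | |- definable_term (fun r => lam (@?a r) (@?F r)) => apply (T_lam (a:=a) (F:=F))
  end.

Section Sets2.
Context {V : set_structure} {HZ : ZFCm V}.
Implicit Types (x y z a b c f : V).

Lemma in_upair a b z : z ∈ upair a b <-> z = a \/ z = b.
Proof.
revert z; change (is_upair (upair a b) a b); unfold upair; apply iota_spec.
destruct (zfc_pairing zfcm a b) as [p Hp].
exists p; split; [exact Hp|]; intros t Ht; apply ext; intros z; now rewrite (Hp z), (Ht z).
Qed.

Lemma in_sing a z : z ∈ upair a a <-> z = a.
Proof. rewrite in_upair; tauto. Qed.

Lemma upair_eq p a b : is_upair p a b <-> p = upair a b.
Proof.
split; intros H.
- apply ext; intros z; now rewrite (H z), in_upair.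
- subst p; intros z; apply in_upair.
Qed.

Lemma upair_inj_r a b c : upair a b = upair a c -> b = c.
Proof.
intros E.
assert (H : b ∈ upair a c) by (rewrite <- E, in_upair; tauto).
assert (H' : c ∈ upair a b) by (rewrite E, in_upair; tauto).
rewrite in_upair in H, H'; intuition congruence.
Qed.

Lemma pair_inj a b c d : pair a b = pair c d -> a = c /\ b = d.
Proof.
unfold pair; intros E.
assert (a = c).
{ assert (H : upair c c ∈ upair (upair a a) (upair a b)) by (rewrite E, in_upair; tauto).
  apply in_upair in H; destruct H as [H|H].
  - assert (H1 : a ∈ upair c c) by (rewrite H, in_upair; tauto); now apply in_sing in H1.
  - assert (H1 : a ∈ upair c c) by (rewrite H, in_upair; tauto); now apply in_sing in H1. }
subst c; split; [reflexivity|].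
apply upair_inj_r in E; now apply upair_inj_r in E.
Qed.

Lemma is_pair_eq p a b : is_pair p a b <-> p = pair a b.
Proof.
unfold is_pair, pair; split.
- intros [u [v [Hu [Hv Hp]]]]; apply upair_eq in Hu, Hv, Hp; congruence.
- intros ->; exists (upair a a), (upair a b); rewrite !upair_eq; tauto.
Qed.

Lemma rel_iff f a b : rel f a b <-> pair a b ∈ f.
Proof.
unfold rel; split.
- intros [p [Hp E]]; apply is_pair_eq in E; now subst.
- intros H; exists (pair a b); rewrite is_pair_eq; tauto.
Qed.

Lemma in_union a z : z ∈ union a <-> exists y, y ∈ a /\ z ∈ y.
Proof.
revert z; unfold union; apply iota_spec.
destruct (zfc_union zfcm a) as [u Hu].
exists u; split; [exact Hu|]; intros t Ht; apply ext; intros z; now rewrite Hu, Ht.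
Qed.

Lemma in_cup a b z : z ∈ cup a b <-> z ∈ a \/ z ∈ b.
Proof.
unfold cup; rewrite in_union; split.
- intros [y [Hy Hz]]; rewrite in_upair in Hy; destruct Hy; subst; tauto.
- intros [H|H]; [exists a|exists b]; rewrite in_upair; tauto.
Qed.

Lemma in_succ a z : z ∈ succ a <-> z ∈ a \/ z = a.
Proof. unfold succ; now rewrite in_cup, in_sing. Qed.

Lemma is_succ_eq a b : is_succ b a <-> b = succ a.
Proof.
unfold is_succ; split.
- intros H; apply ext; intros z; now rewrite (H z), in_succ.
- intros ->; apply in_succ.
Qed.

Lemma is_empty_eq a : is_empty a <-> a = emp.
Proof.
unfold is_empty; split.
- intros H; apply ext; intros z; split; intros Hz; [now destruct (H z)|now destruct (not_in_emp Hz)].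
- intros -> z; apply not_in_emp.
Qed.

Lemma nonempty a : a <> emp -> exists x, x ∈ a.
Proof.
intros H; apply NNPP; intros N; apply H, is_empty_eq; intros z Hz; eauto.
Qed.

#[global] Instance DP3_is_pair : DP3 (@is_pair V).
Proof. unfold is_pair; dfn. Qed.
#[global] Instance DP3_rel : DP3 (@rel V).
Proof. unfold rel; dfn. Qed.
#[global] Instance DP2_subset : DP2 (@subset V).
Proof. unfold subset; dfn. Qed.
#[global] Instance DP2_is_fun : DP2 (@is_fun V).
Proof. unfold is_fun; dfn. Qed.
#[global] Instance DP3_maps : DP3 (@maps V).
Proof. unfold maps; dfn. Qed.
#[global] Instance DP1_transitive : DP1 (@transitive V).
Proof. unfold transitive; dfn. Qed.
#[global] Instance DP1_ordinal : DP1 (@ordinal V).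
Proof. unfold ordinal; dfn. Qed.
#[global] Instance DP1_limit_ordinal : DP1 (@limit_ordinal V).
Proof. unfold limit_ordinal; dfn. Qed.
#[global] Instance DP1_is_omega : DP1 (@is_omega V).
Proof. unfold is_omega; dfn. Qed.
#[global] Instance DP3_bijection : DP3 (@bijection V).
Proof. unfold bijection; dfn. Qed.
#[global] Instance DP2_equinumerous : DP2 (@equinumerous V).
Proof. unfold equinumerous; dfn. Qed.
#[global] Instance DP1_cardinal : DP1 (@cardinal V).
Proof. unfold cardinal; dfn. Qed.
#[global] Instance DP1_uncountable_cardinal : DP1 (@uncountable_cardinal V).
Proof. unfold uncountable_cardinal; dfn. Qed.

Lemma app_unique f a x y : is_fun f a -> pair x y ∈ f -> x ∈ a /\ app f x = y.
Proof.
intros [H1 H2] Hp.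
assert (Hx : x ∈ a).
{ destruct (H1 _ Hp) as [x' [y' [Hx E]]]; apply is_pair_eq, pair_inj in E.
  destruct E; now subst. }
split; [assumption|].
apply iota_eq; [assumption|]; intros z Hz.
destruct (H2 x Hx) as [w [_ Hw]]; rewrite <- (Hw y), <- (Hw z); trivial; now apply rel_iff.
Qed.

Lemma app_in f a x : is_fun f a -> x ∈ a -> pair x (app f x) ∈ f.
Proof.
intros H Hx; destruct (proj2 H x Hx) as [w [Hw _]]; apply rel_iff in Hw.
now destruct (app_unique H Hw) as [_ ->].
Qed.

Lemma rel_app f a x y : is_fun f a -> (rel f x y <-> x ∈ a /\ y = app f x).
Proof.
intros H; rewrite rel_iff; split.
- intros Hp; destruct (app_unique H Hp); auto.
- intros [Hx ->]; now apply app_in with a.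
Qed.

Lemma in_fun f a p : is_fun f a -> (p ∈ f <-> exists x, x ∈ a /\ p = pair x (app f x)).
Proof.
intros H; split.
- intros Hp; destruct (proj1 H p Hp) as [x [y [Hx E]]]; apply is_pair_eq in E; subst p.
  exists x; split; [assumption|]; now rewrite (proj2 (app_unique H Hp)).
- intros [x [Hx ->]]; now apply app_in with a.
Qed.

Lemma fun_ext f g a : is_fun f a -> is_fun g a ->
  (forall x, x ∈ a -> app f x = app g x) -> f = g.
Proof.
intros Hf Hg H; apply ext; intros p; rewrite (in_fun p Hf), (in_fun p Hg).
split; intros [x [Hx ->]]; exists x; rewrite H; auto.
Qed.

Lemma maps_iff f a b : maps f a b <-> is_fun f a /\ forall x, x ∈ a -> app f x ∈ b.
Proof.
unfold maps; split; intros [H1 H2]; (split; [assumption|]).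
- intros x Hx; apply (H2 x); now apply rel_app with a.
- intros x y Hr; apply (rel_app x y H1) in Hr; destruct Hr as [Hx ->]; auto.
Qed.

Lemma lam_fun a (F : V -> V) {HF : DF1 F} : is_fun (lam a F) a.
Proof.
unfold lam; split.
- intros p; rewrite in_repl by dfn; intros [x [Hx ->]].
  exists x, (F x); rewrite is_pair_eq; tauto.
- intros x Hx; exists (F x); split.
  + rewrite rel_iff, in_repl by dfn; eauto.
  + intros y; rewrite rel_iff, in_repl by dfn; intros [x' [Hx' E]].
    apply pair_inj in E; destruct E; congruence.
Qed.

Lemma app_lam a (F : V -> V) {HF : DF1 F} x : x ∈ a -> app (lam a F) x = F x.
Proof.
intros Hx; apply (@app_unique (lam a F) a); [now apply lam_fun|].
unfold lam; rewrite in_repl by dfn; eauto.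
Qed.

Lemma lam_ext a (F G : V -> V) {HF : DF1 F} {HG : DF1 G} :
  (forall x, x ∈ a -> F x = G x) -> lam a F = lam a G.
Proof.
intros H; apply (@fun_ext _ _ a); try now apply lam_fun.
intros x Hx; rewrite !app_lam; auto.
Qed.

Lemma lam_maps a b (F : V -> V) {HF : DF1 F} :
  (forall x, x ∈ a -> F x ∈ b) -> maps (lam a F) a b.
Proof.
intros H; apply maps_iff; split; [now apply lam_fun|].
intros x Hx; rewrite app_lam; auto.
Qed.

Lemma fnd (P : V -> Prop) {HP : DP1 P} a : (exists x, x ∈ a /\ P x) ->
  exists x, x ∈ a /\ P x /\ forall y, y ∈ x -> y ∈ a -> ~ P y.
Proof.
intros [x [Hx Px]].
destruct (@zfc_foundation _ _ zfcm (sep a P)) as [y [Hy Hm]].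
- exists x; rewrite in_sep by dfn; tauto.
- rewrite in_sep in Hy by dfn; exists y; repeat split; try tauto.
  intros z Hz Hza Pz; apply (Hm z Hz); now rewrite in_sep by dfn.
Qed.

Lemma trans_ind (P : V -> Prop) {HP : DP1 P} a : transitive a ->
  (forall x, x ∈ a -> (forall y, y ∈ x -> P y) -> P x) -> forall x, x ∈ a -> P x.
Proof.
intros Ht H x Hx; apply NNPP; intros N.
destruct (@fnd (fun x => ~ P x) _ a) as [y [Hy [Hn Hm]]]; [now exists x|].
apply Hn, H; [assumption|]; intros z Hz; apply NNPP; intros Nz.
apply (Hm z); auto; now apply (Ht y).
Qed.

Lemma irrefl x : x ∉ x.
Proof.
intros H.
destruct (@fnd (fun _ => True) _ (upair x x)) as [y [Hy [_ Hm]]].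
- exists x; now rewrite in_sing.
- apply in_sing in Hy; subst y; apply (Hm x); auto; now apply in_sing.
Qed.

Lemma asym x y : x ∈ y -> y ∉ x.
Proof.
intros H1 H2.
destruct (@fnd (fun _ => True) _ (upair x y)) as [z [Hz [_ Hm]]].
- exists x; rewrite in_upair; tauto.
- apply in_upair in Hz; destruct Hz; subst z; [apply (Hm y)|apply (Hm x)]; auto;
    rewrite in_upair; auto.
Qed.

Lemma ord_elem a b : ordinal a -> b ∈ a -> ordinal b.
Proof.
intros [H1 H2] Hb; split; [now apply H2|].
intros y Hy; apply H2; now apply (H1 b).
Qed.

Lemma ord_trans a b c : ordinal a -> b ∈ a -> c ∈ b -> c ∈ a.
Proof. intros [H _] Hb Hc; now apply (H b). Qed.

Lemma ord_min (P : V -> Prop) {HP : DP1 P} a : ordinal a -> P a ->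
  exists b, ordinal b /\ P b /\ forall c, c ∈ b -> ~ P c.
Proof.
intros Ha Pa.
destruct (@fnd P _ (succ a)) as [b [Hb [Pb Hm]]].
- exists a; rewrite in_succ; auto.
- exists b; rewrite in_succ in Hb; split; [|split; [assumption|]].
  + destruct Hb; [eapply ord_elem; eauto|now subst].
  + intros c Hc; apply Hm; auto; rewrite in_succ; left.
    destruct Hb; [now apply (@ord_trans a b)|now subst].
Qed.

Lemma ord_ind (P : V -> Prop) {HP : DP1 P} :
  (forall a, ordinal a -> (forall b, b ∈ a -> P b) -> P a) -> forall a, ordinal a -> P a.
Proof.
intros H a Ha; apply NNPP; intros N.
destruct (@ord_min (fun x => ~ P x) _ a Ha N) as [b [Hb [Nb Hm]]].
apply Nb, H; auto; intros c Hc; apply NNPP; now apply Hm.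
Qed.

Lemma ord_tri a b : ordinal a -> ordinal b -> a ∈ b \/ a = b \/ b ∈ a.
Proof.
intros Ha Hb; revert a Ha b Hb.
apply (@ord_ind (fun a => forall b, ordinal b -> a ∈ b \/ a = b \/ b ∈ a)); [dfn|].
intros a Ha IHa.
apply (@ord_ind (fun b => a ∈ b \/ a = b \/ b ∈ a)); [dfn|].
intros b Hb IHb; apply NNPP; intros N; apply N; right; left.
apply ext; intros z; split; intros Hz.
- destruct (IHa z Hz b Hb) as [H|[H|H]]; auto.
  + subst z; tauto.
  + destruct N; right; right; now apply (ord_trans Ha Hz).
- destruct (IHb z Hz) as [H|[H|H]]; auto.
  + destruct N; left; now apply (ord_trans Hb Hz).
  + subst z; tauto.
Qed.

Lemma ord_le a b : ordinal a -> ordinal b -> (subset a b <-> a ∈ b \/ a = b).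
Proof.
intros Ha Hb; split.
- intros H; destruct (ord_tri Ha Hb) as [H1|[H1|H1]]; auto.
  destruct (irrefl (H b H1)).
- intros [H|H]; [exact (proj1 Hb a H)|subst; intros z; auto].
Qed.

Lemma ord_not_lt a b : ordinal a -> ordinal b -> a ∉ b -> subset b a.
Proof.
intros Ha Hb H; destruct (ord_tri Ha Hb) as [H1|[H1|H1]]; try tauto.
- subst; intros z; auto.
- exact (proj1 Ha b H1).
Qed.

Lemma ord_succ a : ordinal a -> ordinal (succ a).
Proof.
intros Ha; split.
- intros y Hy z Hz; rewrite in_succ in *; left; destruct Hy as [Hy|Hy];
    [now apply (ord_trans Ha Hy)|now subst].
- intros y Hy; rewrite in_succ in Hy; destruct Hy as [Hy|Hy];
    [now apply (proj2 Ha)|subst; exact (proj1 Ha)].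
Qed.

Lemma ord_le_lt a b c : ordinal c -> subset a b -> ordinal a -> b ∈ c -> a ∈ c.
Proof.
intros Hc Hs Ha Hb; pose proof (ord_elem Hc Hb) as Ho.
apply (ord_le Ha Ho) in Hs; destruct Hs; [now apply (ord_trans Hc Hb)|now subst].
Qed.

End Sets2.

(** * Recursion and choice *)

Tactic Notation "insep" := repeat (rewrite in_sep by dfn).
Tactic Notation "insep" "in" hyp(H) := repeat (rewrite in_sep in H by dfn).
Tactic Notation "inrepl" := repeat (rewrite in_repl by dfn).
Tactic Notation "inrepl" "in" hyp(H) := repeat (rewrite in_repl in H by dfn).

Section Recursion.
Context {V : set_structure} {HZ : ZFCm V}.
Implicit Types (x y z a b c f g d X : V).

Definition wf_on (E : V -> V -> Prop) X :=
  forall S, subset S X -> (exists x, x ∈ S) -> exists m, m ∈ S /\ forall y, y ∈ S -> ~ E y m.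

Lemma wf_ind (E : V -> V -> Prop) X (P : V -> Prop) {HP : DP1 P} :
  wf_on E X -> (forall x, x ∈ X -> (forall y, y ∈ X -> E y x -> P y) -> P x) ->
  forall x, x ∈ X -> P x.
Proof.
intros Hwf H x Hx; apply NNPP; intros N.
destruct (Hwf (sep X (fun x => ~ P x))) as [m [Hm Hmin]].
- intros z; insep; tauto.
- exists x; insep; tauto.
- insep in Hm; apply (proj2 Hm), H; [tauto|]; intros y Hy HE; apply NNPP; intros Ny.
  apply (Hmin y); [insep; tauto | assumption].
Qed.

Section Rec.
Variables (E : V -> V -> Prop) (X : V) (G : V -> V -> V).
Context {HE : DP2 E} {HG : DF2 G}.
Hypothesis Hwf : wf_on E X.

(** Partial solutions of the recursion. Closure of [d] under [E]-predecessors makes any two of them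
    agree on common arguments. *)
Definition attempt f d := is_fun f d /\ subset d X /\
  (forall z, z ∈ d -> forall y, y ∈ X -> E y z -> y ∈ d) /\
  forall z, z ∈ d -> app f z = G z (lam (sep X (fun y => E y z)) (fun y => app f y)).

Instance attempt_dp : DP2 attempt.
Proof. unfold attempt; dfn. Qed.

Lemma attempt_agree f d g e x : attempt f d -> attempt g e -> x ∈ d -> x ∈ e ->
  app f x = app g x.
Proof.
intros [Hf [Hd [Hdc Hfr]]] [Hg [He [Hec Hgr]]] Hx Hxe.
apply (@wf_ind E X (fun x => x ∈ d -> x ∈ e -> app f x = app g x) _ Hwf); auto.
clear x Hx Hxe; intros x _ IH Hx Hxe; rewrite Hfr, Hgr by assumption; f_equal.
apply lam_ext; try dfn.
intros y; insep; intros [Hy HEy]; apply IH; eauto.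
Qed.

Definition Val z := iota (fun v => exists f d, attempt f d /\ z ∈ d /\ v = app f z).
Instance Val_df : DF1 Val.
Proof. unfold Val; dfn. Qed.

Lemma Val_eq f d z : attempt f d -> z ∈ d -> Val z = app f z.
Proof.
intros Hf Hz; apply iota_eq; [now exists f, d|].
intros v [g [e [Hg [Hze ->]]]]; eapply attempt_agree; eauto.
Qed.

Lemma attempt_total x : x ∈ X -> exists f d, attempt f d /\ x ∈ d.
Proof.
apply (@wf_ind E X (fun x => exists f d, attempt f d /\ x ∈ d) _ Hwf).
clear x; intros x Hx IH.
pose (F := fun z => G z (lam (sep X (fun y => E y z)) Val)).
assert (HF : DF1 F) by (unfold F; dfn).
(* [E] need not be transitive, so the predecessors of [x] do not form a closed domain. All points
   covered by some attempt are taken instead. *)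
pose (d := sep X (fun z => z = x \/ exists f d, attempt f d /\ z ∈ d)).
assert (Hin : forall z, z ∈ d -> forall y, y ∈ X -> E y z -> exists f d, attempt f d /\ y ∈ d).
{ intros z; unfold d; insep; intros [Hz [-> |[f [e [Hf Hze]]]]] y Hy HEy; auto.
  exists f, e; split; auto; apply (proj1 (proj2 (proj2 Hf))) with z; auto. }
assert (HFV : forall z f e, attempt f e -> z ∈ e -> F z = Val z).
{ intros z f e Hf Hz; rewrite (Val_eq Hf Hz); unfold F.
  rewrite (proj2 (proj2 (proj2 Hf)) z Hz); f_equal; apply lam_ext; try dfn.
  intros y; insep; intros [Hy HEy]; apply (@Val_eq f e y Hf).
  now apply (proj1 (proj2 (proj2 Hf))) with z. }
exists (lam d F), d; split; [|unfold d; insep; auto].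
split; [apply lam_fun; dfn|split; [intros z; unfold d; insep; tauto|split]].
- intros z Hz y Hy HEy; unfold d; insep; split; auto; right; eauto.
- intros z Hz; rewrite app_lam by (assumption || dfn); unfold F at 1; f_equal; apply lam_ext; try dfn.
  intros y; insep; intros [Hy HEy].
  destruct (Hin z Hz y Hy HEy) as [f [e [Hf Hye]]].
  rewrite app_lam.
  + symmetry; eapply HFV; eauto.
  + dfn.
  + unfold d; insep; split; auto; right; eauto.
Qed.

Theorem wf_rec : exists f, is_fun f X /\
  forall x, x ∈ X -> app f x = G x (lam (sep X (fun y => E y x)) (fun y => app f y)).
Proof.
exists (lam X Val); split; [apply lam_fun; dfn|]; intros x Hx.
rewrite app_lam by (assumption || dfn).
destruct (attempt_total Hx) as [f [d [Hf Hxd]]]; rewrite (Val_eq Hf Hxd).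
rewrite (proj2 (proj2 (proj2 Hf)) x Hxd); f_equal; apply lam_ext; try dfn.
intros y; insep; intros [Hy HEy]; rewrite app_lam by (assumption || dfn).
symmetry; apply (@Val_eq f d y Hf); now apply (proj1 (proj2 (proj2 Hf))) with x.
Qed.

End Rec.

Lemma repl_ext a (F H : V -> V) {HF : DF1 F} {HH : DF1 H} :
  (forall x, x ∈ a -> F x = H x) -> repl a F = repl a H.
Proof.
intros Hx; apply ext; intros z; inrepl; split; intros [y [Hy ->]]; exists y; split; auto.
symmetry; auto.
Qed.

(** Mostowski's map. [E] is not assumed extensional, so [c] may identify points; in the ultrapower
    of a transitive set these will be the functions that agree almost everywhere. *)
Lemma collapse (E : V -> V -> Prop) {HE : DP2 E} X : wf_on E X ->
  exists c, is_fun c X /\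
    forall x, x ∈ X -> app c x = repl (sep X (fun y => E y x)) (fun y => app c y).
Proof.
intros Hwf.
pose (G := fun x r => repl (sep X (fun y => E y x)) (fun y => app r y)).
assert (HG : DF2 G) by (unfold G; dfn).
destruct (@wf_rec E X G _ _ Hwf) as [c [Hc Hr]].
exists c; split; auto; intros x Hx; rewrite (Hr x Hx); unfold G; apply repl_ext; try dfn.
intros y Hy; now rewrite app_lam by (assumption || dfn).
Qed.

Lemma wo_collapse (E : V -> V -> Prop) {HE : DP2 E} X : wf_on E X ->
  (forall x, x ∈ X -> ~ E x x) ->
  (forall x y z, x ∈ X -> y ∈ X -> z ∈ X -> E x y -> E y z -> E x z) ->
  (forall x y, x ∈ X -> y ∈ X -> E x y \/ x = y \/ E y x) ->
  exists c, is_fun c X /\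
    (forall x, x ∈ X -> app c x = repl (sep X (fun y => E y x)) (fun y => app c y)) /\
    (forall x y, x ∈ X -> y ∈ X -> app c x = app c y -> x = y) /\
    (forall x, x ∈ X -> ordinal (app c x)) /\
    ordinal (repl X (fun x => app c x)).
Proof.
intros Hwf Hirr Htr Htri; destruct (collapse Hwf) as [c [Hc Hr]].
exists c; do 2 (split; [assumption|]).
assert (Hlt : forall x y, x ∈ X -> y ∈ X -> E x y -> app c x ∈ app c y).
{ intros x y Hx Hy Hxy; rewrite (Hr y Hy); inrepl; exists x; insep; auto. }
assert (Hinj : forall x y, x ∈ X -> y ∈ X -> app c x = app c y -> x = y).
{ intros x y Hx Hy Exy; destruct (Htri x y Hx Hy) as [H|[H|H]]; auto;
    apply Hlt in H; auto; rewrite Exy in H; destruct (irrefl H). }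
assert (Ht : forall x, x ∈ X -> transitive (app c x)).
{ intros x Hx z Hz u Hu; rewrite (Hr x Hx) in Hz |- *; inrepl in Hz.
  destruct Hz as [y [Hy ->]]; insep in Hy; destruct Hy as [Hy Hyx].
  rewrite (Hr y Hy) in Hu; inrepl in Hu; destruct Hu as [v [Hv ->]]; insep in Hv.
  destruct Hv as [Hv Hvy]; inrepl; exists v; insep; split; auto; split; auto.
  apply (Htr v y x); auto. }
assert (Ho : forall x, x ∈ X -> ordinal (app c x)).
{ intros x Hx; split; auto; intros y Hy; rewrite (Hr x Hx) in Hy; inrepl in Hy.
  destruct Hy as [z [Hz ->]]; insep in Hz; apply Ht; tauto. }
split; [assumption|split; [assumption|split]].
- intros y Hy z Hz; inrepl in Hy; destruct Hy as [x [Hx ->]].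
  rewrite (Hr x Hx) in Hz; inrepl in Hz; destruct Hz as [u [Hu ->]]; insep in Hu.
  inrepl; exists u; tauto.
- intros y Hy; inrepl in Hy; destruct Hy as [x [Hx ->]]; auto.
Qed.

Lemma wo_choice X : exists r, well_orders r X.
Proof. apply (zfc_choice zfcm). Qed.

Lemma enum_ord X : exists th g, ordinal th /\ maps g th X /\
  (forall i j, i ∈ th -> j ∈ th -> app g i = app g j -> i = j) /\
  (forall x, x ∈ X -> exists i, i ∈ th /\ app g i = x).
Proof.
destruct (wo_choice X) as [r [Hirr [Htr [Htri Hwf]]]].
destruct (@wo_collapse (fun x y => rel r x y) _ X Hwf Hirr Htr Htri)
  as [c [Hc [Hr [Hinj [Ho Hth]]]]].
pose (th := repl X (fun x => app c x)).
pose (h := fun i => iota (fun x => x ∈ X /\ app c x = i)).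
assert (Hh : DF1 h) by (unfold h; dfn).
assert (Hhc : forall x, x ∈ X -> h (app c x) = x).
{ intros x Hx; apply iota_eq; [auto|]; intros z [Hz E]; now apply Hinj. }
exists th, (lam th h); split; [assumption|split; [|split]].
- apply lam_maps; [dfn|]; intros i Hi; unfold th in Hi; inrepl in Hi.
  destruct Hi as [x [Hx ->]]; now rewrite Hhc.
- intros i j Hi Hj; rewrite !app_lam by (assumption || dfn).
  unfold th in Hi, Hj; inrepl in Hi; inrepl in Hj.
  destruct Hi as [x [Hx ->]], Hj as [y [Hy ->]]; rewrite !Hhc; congruence.
- intros x Hx; exists (app c x).
  assert (app c x ∈ th) by (unfold th; inrepl; eauto).
  split; auto; rewrite app_lam by (assumption || dfn); auto.
Qed.

(** Collection bounds the witnesses by a set [b], and the least witness in a well-order of [b] is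
    definable. *)
Lemma choice_fun X (R : V -> V -> Prop) {HR : DP2 R} :
  (forall x, x ∈ X -> exists y, R x y) ->
  exists f, is_fun f X /\ forall x, x ∈ X -> R x (app f x).
Proof.
intros H; destruct (@zfc_collection _ _ zfcm R (D2_fo HR) X H) as [b Hb].
destruct (wo_choice b) as [r [Hirr [Htr [Htri Hwf]]]].
pose (h := fun x => iota (fun y => y ∈ b /\ R x y /\ forall z, z ∈ b -> R x z -> ~ rel r z y)).
assert (Hh : DF1 h) by (unfold h; dfn).
exists (lam X h); split; [apply lam_fun; dfn|]; intros x Hx.
rewrite app_lam by (assumption || dfn).
enough (Hs : h x ∈ b /\ R x (h x) /\ forall z, z ∈ b -> R x z -> ~ rel r z (h x)) by tauto.
apply iota_spec.
destruct (Hwf (sep b (fun y => R x y))) as [m [Hm Hmin]].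
- intros z; insep; tauto.
- destruct (Hb x Hx) as [y [Hy HRy]]; exists y; insep; auto.
- insep in Hm; exists m; split.
  + split; [tauto|split; [tauto|]]; intros z Hz HRz; apply Hmin; insep; auto.
  + intros z [Hz [HRz Hzm]]; destruct (Htri m z) as [H1|[H1|H1]]; auto; try tauto.
    * destruct (Hzm m); tauto.
    * destruct (Hmin z); auto; insep; auto.
Qed.

Section Omega.
Variable w : V.
Hypothesis Hw : is_omega w.

Lemma omega_ord : ordinal w.
Proof. exact (proj1 (proj1 Hw)). Qed.

Lemma omega_succ n : n ∈ w -> succ n ∈ w.
Proof.
intros Hn; destruct (proj2 (proj2 (proj1 Hw)) n Hn) as [m [Hm Hnm]].
apply (@ord_le_lt _ _ _ m); auto using omega_ord.
- intros z; rewrite in_succ; intros [H| ->]; auto.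
  now apply (ord_trans (ord_elem omega_ord Hm) Hnm).
- apply ord_succ, (ord_elem omega_ord Hn).
Qed.

Lemma omega_case n : n ∈ w -> n = emp \/ exists m, m ∈ w /\ n = succ m.
Proof.
intros Hn; destruct (classic (n = emp)) as [H|H]; [auto|right].
pose proof (ord_elem omega_ord Hn) as Ho.
apply nonempty in H.
assert (Hm : exists m, m ∈ n /\ forall z, z ∈ n -> m ∉ z).
{ apply NNPP; intros N; apply (proj2 Hw n Hn); split; [assumption|split; [assumption|]].
  intros y Hy; apply NNPP; intros N1; apply N; exists y; split; auto; intros z Hz Hyz.
  apply N1; eauto. }
destruct Hm as [m [Hm Hmax]]; exists m; split; [now apply (ord_trans omega_ord Hn)|].
apply ext; intros z; rewrite in_succ; split; intros Hz.
- destruct (ord_tri (ord_elem Ho Hz) (ord_elem Ho Hm)) as [H1|[H1|H1]]; auto.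
  now destruct (Hmax z Hz).
- destruct Hz as [Hz| ->]; auto; now apply (ord_trans Ho Hm).
Qed.

Lemma omega_emp : emp ∈ w.
Proof.
destruct (proj1 (proj2 (proj1 Hw))) as [y Hy].
destruct (@fnd V HZ (fun x => x ∈ w) _ w) as [b [Hb [_ Hm]]]; [now exists y|].
replace emp with b; auto; apply is_empty_eq; intros z Hz.
assert (z ∈ w) by now apply (ord_trans omega_ord Hb).
now apply (Hm z).
Qed.

Lemma omega_ind (P : V -> Prop) {HP : DP1 P} :
  P emp -> (forall n, n ∈ w -> P n -> P (succ n)) -> forall n, n ∈ w -> P n.
Proof.
intros H0 HS; apply (trans_ind (P:=P) (a:=w)); [exact (proj1 omega_ord)|].
intros n Hn IH; destruct (omega_case Hn) as [-> |[m [Hm ->]]]; auto.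
apply HS; auto; apply IH; rewrite in_succ; auto.
Qed.

Lemma union_succ n : n ∈ w -> union (succ n) = n.
Proof.
intros Hn; apply ext; intros z; rewrite in_union; split.
- intros [y [Hy Hz]]; rewrite in_succ in Hy; destruct Hy as [Hy| ->]; auto.
  now apply (ord_trans (ord_elem omega_ord Hn) Hy).
- intros Hz; exists n; rewrite in_succ; auto.
Qed.

Lemma emp_succ n : succ n <> emp.
Proof.
intros E; apply (@not_in_emp _ _ n); rewrite <- E, in_succ; auto.
Qed.

Lemma omega_rec x0 (H : V -> V) {HH : DF1 H} : exists f, is_fun f w /\
  app f emp = x0 /\ forall n, n ∈ w -> app f (succ n) = H (app f n).
Proof.
(* [union n] is the predecessor of a successor [n]. *)
pose (G := fun n r => iota (fun v => (n = emp /\ v = x0) \/ (n <> emp /\ v = H (app r (union n))))).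
assert (HG : DF2 G) by (unfold G; dfn).
assert (Hwf : wf_on (fun x y => x ∈ y) w).
{ intros S HS HSn; destruct (@fnd V HZ (fun x => True) _ S) as [b [Hb [_ Hm]]].
  - destruct HSn as [x Hx]; now exists x.
  - exists b; split; auto; intros y Hy Hyb; now apply (Hm y). }
destruct (@wf_rec (fun x y => x ∈ y) w G _ _ Hwf) as [f [Hf Hr]].
exists f; split; [assumption|split].
- rewrite (Hr _ omega_emp); unfold G; apply iota_eq; [auto|]; intros z; intuition.
- intros n Hn; rewrite (Hr _ (omega_succ Hn)); unfold G; rewrite (union_succ Hn).
  rewrite app_lam; [|dfn|insep; rewrite in_succ; auto].
  apply iota_eq; [right; split; [apply emp_succ|auto]|].
  intros z [[E _]|[_ Hz]]; auto; now destruct (emp_succ E).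
Qed.

Lemma dep_choice X (R : V -> V -> Prop) {HR : DP2 R} x0 : x0 ∈ X ->
  (forall x, x ∈ X -> exists y, y ∈ X /\ R x y) ->
  exists f, maps f w X /\ app f emp = x0 /\
    forall n, n ∈ w -> R (app f n) (app f (succ n)).
Proof.
intros Hx0 HX.
destruct (@choice_fun X (fun x y => y ∈ X /\ R x y) _ HX) as [h [Hh Hhr]].
destruct (@omega_rec x0 (fun x => app h x) _) as [f [Hf [Hf0 HfS]]].
assert (HfX : forall n, n ∈ w -> app f n ∈ X).
{ apply omega_ind; [dfn|congruence|].
  intros n Hn H; rewrite HfS by auto; now apply Hhr. }
exists f; split; [now apply maps_iff|split; auto].
intros n Hn; rewrite HfS by auto; now apply Hhr, HfX.
Qed.

Lemma trans_superset B : exists N : V, transitive N /\ subset B N.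
Proof.
destruct (@omega_rec B (fun x => union x) _) as [f [Hf [Hf0 HfS]]].
exists (union (repl w (fun n => app f n))); split.
- intros y Hy z Hz; rewrite in_union in *; destruct Hy as [u [Hu Hy]]; inrepl in Hu.
  destruct Hu as [n [Hn ->]]; exists (app f (succ n)); split.
  + inrepl; exists (succ n); split; auto using omega_succ.
  + rewrite HfS, in_union by auto; eauto.
- intros z Hz; rewrite in_union; exists B; split; auto; inrepl; exists emp.
  split; auto using omega_emp.
Qed.

Lemma wf_from_seq (E : V -> V -> Prop) {HE : DP2 E} X :
  ~ (exists f, maps f w X /\ forall n, n ∈ w -> E (app f (succ n)) (app f n)) -> wf_on E X.
Proof.
intros H S HS [x0 Hx0]; apply NNPP; intros N; apply H.
destruct (@dep_choice S (fun x y => E y x) _ x0 Hx0) as [f [Hf [_ Hr]]].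
- intros x Hx; apply NNPP; intros N1; apply N; exists x; split; auto.
  intros y Hy HEy; apply N1; eauto.
- exists f; split; auto; apply maps_iff in Hf; apply maps_iff; split; [tauto|].
  intros n Hn; apply HS, Hf, Hn.
Qed.

Lemma no_descent f : ~ (is_fun f w /\ forall n, n ∈ w -> app f (succ n) ∈ app f n).
Proof.
intros [Hf H].
destruct (@fnd V HZ (fun x => exists n, n ∈ w /\ x = app f n) _
  (repl w (fun n => app f n))) as [b [Hb [[n [Hn ->]] Hm]]].
- exists (app f emp); inrepl; split; exists emp; auto using omega_emp.
- apply (Hm (app f (succ n))).
  + auto.
  + inrepl; exists (succ n); auto using omega_succ.
  + exists (succ n); auto using omega_succ.
Qed.

End Omega.
End Recursion.

(** * Ultrafilters and smallness *)

Section UF.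
Context {V : set_structure} {HZ : ZFCm V}.
Variables (k : V) (U : V -> Prop).
Hypotheses (Hu : ultrafilter k U) (Hn : nonprincipal k U) (Hc : complete k U).

(** [U] is only a predicate, so that these facts apply to measures of the universe and, inside a set
    model, to an ultrafilter that need not belong to the model. *)
Lemma uf_mono (P Q : V -> Prop) {HP : DP1 P} {HQ : DP1 Q} :
  U (sep k P) -> (forall b, b ∈ k -> P b -> Q b) -> U (sep k Q).
Proof.
intros H HPQ; apply (proj1 (proj2 (proj2 (proj2 Hu))) (sep k P)); auto.
- intros z; insep; intros [Hz Pz]; auto.
- intros z; insep; tauto.
Qed.

Lemma uf_and (P Q : V -> Prop) {HP : DP1 P} {HQ : DP1 Q} :
  U (sep k P) -> U (sep k Q) -> U (sep k (fun b => P b /\ Q b)).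
Proof.
intros H1 H2; apply (proj1 (proj2 (proj2 Hu)) _ _ _ H1 H2); intros z; insep; tauto.
Qed.

Lemma uf_all (P : V -> Prop) {HP : DP1 P} : (forall b, b ∈ k -> P b) -> U (sep k P).
Proof.
intros H; replace (sep k P) with k; [apply Hu|].
apply ext; intros z; insep; intuition.
Qed.

Lemma uf_dich (P : V -> Prop) {HP : DP1 P} : U (sep k P) \/ U (sep k (fun b => ~ P b)).
Proof.
destruct (classic (U (sep k P))) as [H|H]; [auto|right].
apply (proj2 (proj2 (proj2 (proj2 Hu))) (sep k P)); auto.
- intros z; insep; tauto.
- intros z; insep; tauto.
Qed.

Lemma uf_contra (P : V -> Prop) {HP : DP1 P} :
  U (sep k P) -> U (sep k (fun b => ~ P b)) -> False.
Proof.
intros H1 H2.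
apply (proj2 (proj2 (proj2 (proj2 Hu))) (sep k P) (sep k (fun b => ~ P b))) in H2; auto.
- intros z; insep; tauto.
- intros z; insep; tauto.
Qed.

Lemma uf_ex (P : V -> Prop) {HP : DP1 P} : U (sep k P) -> exists b, b ∈ k /\ P b.
Proof.
intros H; apply NNPP; intros N; apply (@uf_contra P HP H).
apply uf_all; [dfn|]; intros b Hb Pb; apply N; eauto.
Qed.

Lemma uf_inter (th : V) (Q : V -> V -> Prop) {HQ : DP2 Q} : th ∈ k ->
  (forall i, i ∈ th -> U (sep k (fun b => Q i b))) ->
  U (sep k (fun b => forall i, i ∈ th -> Q i b)).
Proof.
intros Hth H.
apply (Hc (c := th) (f := lam th (fun i => sep k (fun b => Q i b)))); auto.
- split; [apply lam_fun; dfn|]; intros i x.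
  rewrite (rel_app i x (lam_fun (F := fun i => sep k (fun b => Q i b)) th)).
  intros [Hi ->]; rewrite app_lam by (assumption || dfn); auto.
- intros b; insep; split; intros [Hb Hx]; (split; [assumption|]).
  + intros i x; rewrite (rel_app i x (lam_fun (F := fun i => sep k (fun b => Q i b)) th)).
    intros [Hi ->]; rewrite app_lam by (assumption || dfn); insep; auto.
  + intros i Hi; specialize (Hx i (sep k (fun b => Q i b))).
    rewrite (rel_app i _ (lam_fun (F := fun i => sep k (fun b => Q i b)) th)) in Hx.
    rewrite app_lam in Hx by (assumption || dfn).
    specialize (Hx (conj Hi eq_refl)); insep in Hx; tauto.
Qed.

Lemma uf_ne a : a ∈ k -> U (sep k (fun b => b <> a)).
Proof.
intros Ha; destruct (@uf_dich (fun b => b = a) _) as [H|H]; auto.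
destruct (Hn (a := a) (x := upair a a)); auto.
- intros z; rewrite in_upair; tauto.
- replace (upair a a) with (sep k (fun b => b = a)); auto.
  apply ext; intros z; insep; rewrite in_sing; intuition congruence.
Qed.

(** Nonprincipality avoids each single ordinal up to [a], and completeness avoids all of them at
    once. *)
Lemma uf_final (Hk : ordinal k) a : a ∈ k -> U (sep k (fun b => a ∈ b)).
Proof.
intros Ha.
pose proof (@uf_inter a (fun i b => b <> i) _ Ha) as H.
assert (H1 : U (sep k (fun b => (forall i, i ∈ a -> b <> i) /\ b <> a))).
{ apply uf_and; try dfn; [|now apply uf_ne].
  apply H; intros i Hi; apply uf_ne; now apply (ord_trans Hk Ha). }
eapply (@uf_mono _ _ _ _ H1); intros b Hb [Hb1 Hb2].
destruct (ord_tri (ord_elem Hk Ha) (ord_elem Hk Hb)) as [H2|[H2|H2]]; auto.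
- now destruct Hb2.
- now destruct (Hb1 b H2).
Unshelve. all: dfn.
Qed.

End UF.

Class Powm (V : set_structure) := powm : forall x : V, exists p, forall z, z ∈ p <-> subset z x.

Section Power.
Context {V : set_structure} {HZ : ZFCm V} {HPow : Powm V}.
Implicit Types (x y z a b c f g d X Y : V).

Definition pow (a : V) : V := iota (fun p => forall z, z ∈ p <-> subset z a).
Definition prod (a b : V) : V := union (repl a (fun x => repl b (fun y => pair x y))).
Definition funs (a b : V) : V := sep (pow (prod a b)) (fun f => maps f a b).

#[global] Instance DF1_pow : DF1 pow.
Proof. unfold pow; dfn. Qed.
#[global] Instance DF2_prod : DF2 prod.
Proof. unfold prod; dfn. Qed.
#[global] Instance DF2_funs : DF2 funs.
Proof. unfold funs; dfn. Qed.

Lemma in_pow a z : z ∈ pow a <-> subset z a.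
Proof.
revert z; unfold pow; apply iota_spec.
destruct (powm a) as [p Hp]; exists p; split; [exact Hp|].
intros t Ht; apply ext; intros z; now rewrite (Hp z), (Ht z).
Qed.

Lemma in_prod a b z : z ∈ prod a b <-> exists x y, x ∈ a /\ y ∈ b /\ z = pair x y.
Proof.
unfold prod; rewrite in_union; split.
- intros [u [Hu Hz]]; inrepl in Hu; destruct Hu as [x [Hx ->]]; inrepl in Hz.
  destruct Hz as [y [Hy ->]]; eauto.
- intros [x [y [Hx [Hy ->]]]]; exists (repl b (fun y => pair x y)); split; inrepl; eauto.
Qed.

Lemma in_funs a b f : f ∈ funs a b <-> maps f a b.
Proof.
unfold funs; insep; rewrite in_pow; split; [tauto|]; intros H; split; auto.
intros p Hp; apply maps_iff in H; destruct H as [H1 H2].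
apply (in_fun p H1) in Hp; destruct Hp as [x [Hx ->]]; rewrite in_prod; exists x, (app f x); auto.
Qed.

Lemma funs_fun a b f : f ∈ funs a b -> is_fun f a.
Proof. rewrite in_funs; intros H; apply H. Qed.

Lemma funs_app a b f x : f ∈ funs a b -> x ∈ a -> app f x ∈ b.
Proof. rewrite in_funs, maps_iff; intros [_ H]; auto. Qed.

Lemma lam_funs a b (F : V -> V) {HF : DF1 F} :
  (forall x, x ∈ a -> F x ∈ b) -> lam a F ∈ funs a b.
Proof. intros H; apply in_funs, lam_maps; auto. Qed.

(** Replaces cardinality less than [d]. A cover by an ordinal below [d], possibly with repetitions
    and values outside [C], passes to subsets and images without any computation of cardinals. *)
Definition small (d C : V) : Prop := exists th g, th ∈ d /\ is_fun g th /\
  forall c, c ∈ C -> exists i, i ∈ th /\ app g i = c.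

Lemma small_sub d C C' : small d C -> subset C' C -> small d C'.
Proof. intros [th [g [H1 [H2 H3]]]] H; exists th, g; auto. Qed.

Lemma small_repl d C (F : V -> V) {HF : DF1 F} : small d C -> small d (repl C F).
Proof.
intros [th [g [H1 [H2 H3]]]]; exists th, (lam th (fun i => F (app g i))).
split; [assumption|split; [apply lam_fun; dfn|]].
intros c Hc; inrepl in Hc; destruct Hc as [x [Hx ->]]; destruct (H3 x Hx) as [i [Hi <-]].
exists i; rewrite app_lam by (assumption || dfn); auto.
Qed.

Lemma small_ord d th : th ∈ d -> small d th.
Proof.
intros H; exists th, (lam th (fun i => i)); split; [assumption|split; [apply lam_fun; dfn|]].
intros i Hi; exists i; rewrite app_lam by (assumption || dfn); auto.
Qed.

Definition is_measure (d v : V) : Prop := uncountable_cardinal d /\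
  ultrafilter d (fun x => x ∈ v) /\ nonprincipal d (fun x => x ∈ v) /\
  complete d (fun x => x ∈ v).

#[global] Instance DP2_meas : DP2 is_measure.
Proof. unfold is_measure, ultrafilter, nonprincipal, complete, U_sequence; dfn. Qed.

Section Meas.
Variables (d v : V).
Hypothesis Hm : is_measure d v.

Lemma meas_ord : ordinal d.
Proof. exact (proj1 (proj1 (proj1 Hm))). Qed.

Let Hu := proj1 (proj2 Hm).
Let Hn := proj1 (proj2 (proj2 Hm)).
Let Hc := proj2 (proj2 (proj2 Hm)).

Lemma meas_inter_small I (Q : V -> V -> Prop) {HQ : DP2 Q} : small d I ->
  (forall i, i ∈ I -> sep d (fun b => Q i b) ∈ v) ->
  sep d (fun b => forall i, i ∈ I -> Q i b) ∈ v.
Proof.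
intros [th [g [Hth [Hg Hs]]]] H.
assert (H1 : sep d (fun b => forall j, j ∈ th -> app g j ∈ I -> Q (app g j) b) ∈ v).
{ apply (@uf_inter _ _ d _ Hc th (fun j b => app g j ∈ I -> Q (app g j) b)); auto.
  { dfn. }
  intros j Hj; destruct (classic (app g j ∈ I)) as [Hi|Hi].
  - refine (@uf_mono _ _ d _ Hu (fun b => Q (app g j) b) _ _ _ (H _ Hi) _); try dfn; auto.
  - apply (@uf_all _ _ d _ Hu); [dfn|tauto]. }
refine (@uf_mono _ _ d _ Hu _ _ _ _ H1 _); try dfn.
intros b _ Hb i Hi; destruct (Hs i Hi) as [j [Hj <-]]; auto.
Qed.

Lemma meas_const_ae C (h : V -> V) {Hh : DF1 h} : small d C ->
  sep d (fun t => h t ∈ C) ∈ v -> exists c, c ∈ C /\ sep d (fun t => h t = c) ∈ v.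
Proof.
intros Hs H; apply NNPP; intros N.
assert (H1 : sep d (fun b => forall c, c ∈ C -> h b <> c) ∈ v).
{ apply (@meas_inter_small C (fun c b => h b <> c)); auto; [dfn|].
  intros c Hcc; destruct (@uf_dich _ _ d _ Hu (fun b => h b = c) _) as [H1|H1]; auto.
  destruct N; eauto. }
destruct (@uf_ex _ _ d _ Hu _ _ (@uf_and _ _ d _ Hu _ _ _ _ H H1)) as [b [Hb [H2 H3]]].
now apply (H3 (h b)).
Qed.

Lemma meas_const C (h : V -> V) {Hh : DF1 h} : small d C ->
  (forall t, t ∈ d -> h t ∈ C) -> exists c, c ∈ C /\ sep d (fun t => h t = c) ∈ v.
Proof.
intros Hs H; apply meas_const_ae; auto; apply (@uf_all _ _ d _ Hu); [dfn|assumption].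
Qed.

(** Otherwise an injective enumeration of [C] has length at least [d]; its restriction to [d] is
    injective and cannot be constant on a set of a nonprincipal ultrafilter. *)
Lemma const_small C :
  (forall h, maps h d C -> exists c, sep d (fun t => app h t = c) ∈ v) -> small d C.
Proof.
intros H; destruct (enum_ord C) as [th [g [Hth [Hg [Hinj Hsurj]]]]].
apply maps_iff in Hg; destruct Hg as [Hg HgC].
destruct (classic (th ∈ d)) as [Hin|Hin]; [now exists th, g|].
pose proof (ord_not_lt Hth meas_ord Hin) as Hsub.
destruct (H (lam d (fun t => app g t))) as [c Hcc].
{ apply lam_maps; [dfn|]; auto. }
assert (H1 : sep d (fun t => app g t = c) ∈ v).
{ refine (@uf_mono _ _ d _ Hu _ _ _ _ Hcc _); try dfn.
  intros b Hb; now rewrite app_lam by (assumption || dfn). }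
destruct (@uf_ex _ _ d _ Hu _ _ H1) as [a [Ha Hac]].
pose proof (@uf_ne _ _ d _ Hu Hn a Ha) as H2.
assert (H3 : sep d (fun t => app g t = c /\ t <> a) ∈ v) by (apply (@uf_and _ _ d _ Hu); auto; dfn).
destruct (@uf_ex _ _ d _ Hu _ _ H3) as [b [Hb [Hbc Hba]]].
destruct Hba; apply Hinj; auto; congruence.
Qed.

(** A map into [pow C] is constant almost everywhere: the measure decides for each [y ∈ C] whether
    [y ∈ app h t], and completeness combines these decisions into one value [c]. *)
Lemma small_pow C : small d C -> small d (pow C).
Proof.
intros Hs; apply const_small; intros h Hh; apply maps_iff in Hh; destruct Hh as [Hh HhC].
pose (c := sep C (fun y => sep d (fun t => y ∈ app h t) ∈ v)).
exists c.
assert (H : sep d (fun t => forall y, y ∈ C -> (y ∈ app h t <-> y ∈ c)) ∈ v).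
{ apply (@meas_inter_small C (fun y t => y ∈ app h t <-> y ∈ c)); auto; [dfn|].
  intros y Hy; unfold c; destruct (@uf_dich _ _ d _ Hu (fun t => y ∈ app h t) _) as [H|H].
  - refine (@uf_mono _ _ d _ Hu _ _ _ _ H _); try dfn.
    intros t _ Ht; insep; tauto.
  - refine (@uf_mono _ _ d _ Hu _ _ _ _ H _); try dfn.
    intros t _ Ht; insep; split; [tauto|]; intros [_ H1].
    destruct (@uf_contra _ _ d _ Hu _ _ H1 H). }
refine (@uf_mono _ _ d _ Hu _ _ _ _ H _); try dfn.
intros t Ht H1; apply ext; intros y.
pose proof (HhC t Ht) as H2; rewrite in_pow in H2; split; intros Hy; [apply H1; auto|].
apply H1; auto; unfold c in Hy; insep in Hy; tauto.
Qed.

Lemma small_prod C E : small d C -> small d E -> small d (prod C E).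
Proof.
intros HC HE; apply const_small; intros h Hh; apply maps_iff in Hh; destruct Hh as [Hh HhC].
pose (p1 := fun t => iota (fun x => exists y, app h t = pair x y)).
pose (p2 := fun t => iota (fun y => exists x, app h t = pair x y)).
assert (D1 : DF1 p1) by (unfold p1; dfn).
assert (D2 : DF1 p2) by (unfold p2; dfn).
assert (Hp : forall t, t ∈ d -> p1 t ∈ C /\ p2 t ∈ E /\ app h t = pair (p1 t) (p2 t)).
{ intros t Ht; apply HhC in Ht; apply in_prod in Ht; destruct Ht as [x [y [Hx [Hy Et]]]].
  assert (p1 t = x).
  { apply iota_eq; [eauto|]; intros z [y' Ez]; rewrite Et in Ez; apply pair_inj in Ez.
    symmetry; tauto. }
  assert (p2 t = y).
  { apply iota_eq; [eauto|]; intros z [x' Ez]; rewrite Et in Ez; apply pair_inj in Ez.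
    symmetry; tauto. }
  subst x y; auto. }
destruct (@meas_const C p1 _ HC) as [x [Hx H1]]; [intros; now apply Hp|].
destruct (@meas_const E p2 _ HE) as [y [Hy H2]]; [intros; now apply Hp|].
exists (pair x y).
refine (@uf_mono _ _ d _ Hu _ _ _ _ (@uf_and _ _ d _ Hu _ _ _ _ H1 H2) _); try dfn.
intros t Ht [<- <-]; now apply Hp.
Qed.

Lemma small_funs C E : small d C -> small d E -> small d (funs C E).
Proof.
intros HC HE; apply small_sub with (pow (prod C E)).
- auto using small_pow, small_prod.
- intros z; unfold funs; insep; tauto.
Qed.

Lemma small_not_ge C : small d C -> ~ subset d C.
Proof.
intros HC H.
destruct (@meas_const C (fun t => t) _ HC) as [c [Hcc H1]]; auto.
destruct (@uf_ex _ _ d _ Hu _ _ H1) as [b [Hb ->]].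
pose proof (@uf_ne _ _ d _ Hu Hn c Hb) as H2.
apply (@uf_contra _ _ d _ Hu _ _ H1 H2).
Qed.

End Meas.
End Power.

(** * Normal measures *)

Section Normal.
Context {V : set_structure} {HZ : ZFCm V} {HPow : Powm V}.

Definition is_normal_measure (d n : V) : Prop := is_measure d n /\
  forall H, (forall t, t ∈ d -> app H t ∈ n) ->
    sep d (fun b => forall t, t ∈ b -> b ∈ app H t) ∈ n.

#[global] Instance DP2_nmeas : DP2 is_normal_measure.
Proof. unfold is_normal_measure; dfn. Qed.

(** Scott's argument: among the functions from [d] to [d] that exceed every constant modulo [v], let
    [g] be minimal in the well-founded ultrapower ordering. The image [n] of [v] under [g] is
    normal. *)
Lemma nmeas_exists d v : is_measure d v -> exists n, is_normal_measure d n.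
Proof.
intros Hm; pose proof (meas_ord Hm) as Hd.
destruct (proj2 (proj1 Hm)) as [w [Hw Hwd]].
pose proof (proj1 (proj2 Hm)) as Hu.
pose proof (proj1 (proj2 (proj2 Hm))) as Hn.
pose proof (proj2 (proj2 (proj2 Hm))) as Hc.
pose (E := fun g f => sep d (fun t => app g t ∈ app f t) ∈ v).
assert (HE : DP2 E) by (unfold E; dfn).
assert (Hwf : wf_on E (funs d d)).
{ apply (@wf_from_seq _ _ w Hw E HE); intros [f [Hf HfE]].
  pose proof (@uf_inter _ _ d _ Hc w
    (fun i t => app (app f (succ i)) t ∈ app (app f i) t) ltac:(dfn) Hwd HfE) as H.
  destruct (@uf_ex _ _ d _ Hu _ _ H) as [t [Ht Hdesc]].
  apply (@no_descent _ _ w Hw (lam w (fun i => app (app f i) t))); split; [apply lam_fun; dfn|].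
  intros i Hi; rewrite !app_lam by (auto using omega_succ || dfn); auto. }
destruct (Hwf (sep (funs d d) (fun g => forall b, b ∈ d -> sep d (fun t => b ∈ app g t) ∈ v)))
  as [g [Hg Hmin]].
{ intros z; insep; tauto. }
{ exists (lam d (fun t => t)); insep; split; [now apply lam_funs; try dfn|].
  intros b Hb; refine (@uf_mono _ _ d _ Hu _ _ _ _ (@uf_final _ _ d _ Hu Hn Hc Hd b Hb) _); try dfn.
  intros t Ht; now rewrite app_lam by (assumption || dfn). }
insep in Hg; destruct Hg as [Hg Hgu].
pose (n := sep (pow d) (fun x => sep d (fun t => app g t ∈ x) ∈ v)).
assert (Hin : forall x, x ∈ n <-> subset x d /\ sep d (fun t => app g t ∈ x) ∈ v).
{ intros x; unfold n; insep; now rewrite in_pow. }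
assert (Hgd : forall t, t ∈ d -> app g t ∈ d) by (intros t; now apply funs_app).
exists n; split; [split; [apply Hm|split; [|split]]|].
- split; [|split; [|split; [|split]]].
  + intros x; rewrite Hin; tauto.
  + apply Hin; split; [now intros z|]; apply (@uf_all _ _ d _ Hu); [dfn|auto].
  + intros x y z; rewrite !Hin; intros [Hx1 Hx2] [Hy1 Hy2] Hz; split.
    * intros a Ha; apply Hx1, Hz, Ha.
    * refine (@uf_mono _ _ d _ Hu _ _ _ _ (@uf_and _ _ d _ Hu _ _ _ _ Hx2 Hy2) _); try dfn.
      intros t _ [H1 H2]; now apply Hz.
  + intros x y; rewrite !Hin; intros [Hx1 Hx2] Hxy Hy; split; auto.
    refine (@uf_mono _ _ d _ Hu _ _ _ _ Hx2 _); try dfn; auto.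
  + intros x y Hx Hy; rewrite !Hin; split.
    * intros [H1 H2] [H3 H4].
      destruct (@uf_ex _ _ d _ Hu _ _ (@uf_and _ _ d _ Hu _ _ _ _ H2 H4)) as [t [Ht [H5 H6]]].
      apply Hy in H5; tauto.
    * intros H; split; [intros z Hz; apply Hy, Hz|].
      destruct (@uf_dich _ _ d _ Hu (fun t => app g t ∈ x) _) as [H1|H1]; [tauto|].
      refine (@uf_mono _ _ d _ Hu _ _ _ _ H1 _); try dfn.
      intros t Ht H2; apply Hy; auto.
- intros a x Ha Hx H; apply Hin in H; destruct H as [_ H].
  destruct (@uf_ex _ _ d _ Hu _ _ (@uf_and _ _ d _ Hu _ _ _ _ H (Hgu a Ha))) as [t [Ht [H1 H2]]].
  apply Hx in H1; assert (app g t = a) as E1 by tauto; rewrite E1 in H2; destruct (irrefl H2).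
- intros c f z Hcd [Hf Hs] Hz; apply Hin; split; [intros b Hb; now apply Hz|].
  assert (H : sep d (fun t => forall i, i ∈ c -> app g t ∈ app f i) ∈ v).
  { apply (@uf_inter _ _ d _ Hc c (fun i t => app g t ∈ app f i)); auto; [dfn|].
    intros i Hi; apply (Hin (app f i)), (Hs i), (rel_app i _ Hf); auto. }
  refine (@uf_mono _ _ d _ Hu _ _ _ _ H _); try dfn.
  intros t Ht H1; apply Hz; split; auto.
  intros i x Hr; apply (rel_app i x Hf) in Hr; destruct Hr as [Hi ->]; auto.
- intros H HH; apply Hin; split; [intros z; insep; tauto|].
  apply NNPP; intros N.
  assert (HB : sep d (fun s => ~ forall t, t ∈ app g s -> app g s ∈ app H t) ∈ v).
  { destruct (@uf_dich _ _ d _ Hu (fun s => forall t, t ∈ app g s -> app g s ∈ app H t) _)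
      as [H1|H1]; auto.
    destruct N; refine (@uf_mono _ _ d _ Hu _ _ _ _ H1 _); try dfn.
    intros b Hb H2; insep; auto. }
  (* [h] picks an index below [g s] witnessing the failure of the diagonal intersection at [g s],
     wherever there is one. *)
  destruct (@choice_fun _ _ d (fun s t => t ∈ d /\
    ((exists t, t ∈ app g s /\ app g s ∉ app H t) -> t ∈ app g s /\ app g s ∉ app H t)) _)
    as [h [Hh Hhr]].
  { intros s Hs; destruct (classic (exists t, t ∈ app g s /\ app g s ∉ app H t)) as [[t Ht]|Hno].
    - exists t; split; auto; apply (ord_trans Hd (Hgd s Hs)); tauto.
    - exists s; tauto. }
  assert (Hhg : sep d (fun s => app h s ∈ app g s /\ app g s ∉ app H (app h s)) ∈ v).
  { refine (@uf_mono _ _ d _ Hu _ _ _ _ HB _); try dfn.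
    intros s Hs Hno; apply (proj2 (Hhr s Hs)).
    apply NNPP; intros N1; apply Hno; intros t Ht; apply NNPP; intros N2; eauto. }
  assert (Hhd : h ∈ funs d d).
  { apply in_funs, maps_iff; split; auto; intros s Hs; now apply Hhr. }
  (* Since [h] is below [g] almost everywhere, minimality of [g] keeps it from exceeding every
     constant. Being bounded it is constant almost everywhere, with a value [c] that contradicts
     [app H c ∈ n]. *)
  assert (Hnot : exists b, b ∈ d /\ sep d (fun t => b ∈ app h t) ∉ v).
  { apply NNPP; intros N1; apply (Hmin h).
    - insep; split; auto; intros b Hb; apply NNPP; intros N2; eauto.
    - refine (@uf_mono _ _ d _ Hu _ _ _ _ Hhg _); try dfn; tauto. }
  destruct Hnot as [b [Hb Hbn]].
  assert (Hle : sep d (fun t => app h t ∈ succ b) ∈ v).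
  { destruct (@uf_dich _ _ d _ Hu (fun t => b ∈ app h t) _) as [H1|H1]; [tauto|].
    refine (@uf_mono _ _ d _ Hu _ _ _ _ H1 _); try dfn.
    intros t Ht H2; rewrite in_succ.
    destruct (@ord_tri _ _ (app h t) b) as [H3|[H3|H3]]; auto; try tauto;
      apply (ord_elem Hd); auto; now apply Hhr. }
  assert (Hsb : small d (succ b)).
  { exists (succ b); revert Hle; clear - Hb Hd Hm Hw Hwd Hu Hn Hc; intros _.
    destruct (@uf_ex _ _ d _ Hu _ _ (@uf_final _ _ d _ Hu Hn Hc Hd b Hb)) as [s [Hs Hbs]].
    exists (lam (succ b) (fun i => i)); split; [|split; [apply lam_fun; dfn|]].
    - apply (@ord_le_lt _ _ _ s); auto.
      + intros z; rewrite in_succ; intros [Hz| ->]; auto.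
        now apply (ord_trans (ord_elem Hd Hs) Hbs).
      + apply ord_succ, (ord_elem Hd Hb).
    - intros c Hcc; exists c; rewrite app_lam by (assumption || dfn); auto. }
  destruct (@meas_const_ae _ _ d v Hm (succ b) (fun t => app h t) _ Hsb Hle) as [c [Hcb Hcc]].
  assert (Hcd : c ∈ d).
  { destruct (@uf_ex _ _ d _ Hu _ _ Hcc) as [t [Ht <-]]; now apply Hhr. }
  pose proof (proj2 (proj1 (Hin _) (HH c Hcd))) as H1.
  destruct (@uf_ex _ _ d _ Hu _ _ (@uf_and _ _ d _ Hu _ _ _ _ H1
    (@uf_and _ _ d _ Hu _ _ _ _ Hcc Hhg))) as [t [Ht [H2 [H3 [_ H4]]]]].
  rewrite H3 in H4; tauto.
Qed.

End Normal.

(** * Ultrapowers by admissible functions *)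

Section SysDefs.
Context {V : set_structure} {HZ : ZFCm V} {HPow : Powm V}.

Definition ae (Om mu : V) (P : V -> Prop) : Prop := sep Om P ∈ mu.

Lemma D_ae (Om mu : (nat -> V) -> V) (P : (nat -> V) -> V -> Prop) :
  definable_term Om -> definable_term mu -> definable (fun r => P (fun n => r (S n)) (r 0)) -> definable (fun r => ae (Om r) (mu r) (P r)).
Proof. intros H1 H2 H3; unfold ae; apply D_mem; auto; now apply T_sep. Qed.

Definition invar (Om E : V) (h : V -> V) : Prop :=
  forall s s', s ∈ Om -> s' ∈ Om -> pair s s' ∈ E -> h s = h s'.

(** Functions with a support. For iterations these are the functions of finitely many coordinates,
    on which alone the filter has to behave like an ultrafilter. *)
Definition Adm (Om EE N : V) : V := sep (funs Om N) (fun f => exists E, E ∈ EE /\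
  forall s s', s ∈ Om -> s' ∈ Om -> pair s s' ∈ E -> app f s = app f s').

#[global] Instance DF3_Adm : DF3 Adm.
Proof. unfold Adm; dfn. Qed.

End SysDefs.

Ltac dhook ::= lazymatch goal with
  | |- definable_term (fun r => sep (@?a r) (@?P r)) => apply (T_sep (a:=a) (P:=P))
  | |- definable_term (fun r => repl (@?a r) (@?F r)) => apply (T_repl (a:=a) (F:=F))
  | |- definable_term (fun r => lam (@?a r) (@?F r)) => apply (T_lam (a:=a) (F:=F))
  | |- definable (fun r => ae (@?a r) (@?b r) (@?P r)) => apply (D_ae (Om:=a) (mu:=b) (P:=P))
  end.

Section SysDefs2.
Context {V : set_structure} {HZ : ZFCm V} {HPow : Powm V}.

(** The collapsing map of the ultrapower of the structure [N]; the class of [f] is sent to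
    [app (rho Om mu EE N) f]. *)
Definition rho (Om mu EE N : V) : V := iota (fun c => is_fun c (Adm Om EE N) /\
  forall f, f ∈ Adm Om EE N -> app c f =
    repl (sep (Adm Om EE N) (fun g => ae Om mu (fun s => app g s ∈ app f s))) (fun g => app c g)).

#[global] Instance DF4_rho : DF4 rho.
Proof. unfold rho; dfn. Qed.

(** A limit of ultrapowers is presented by a single filter [mu] on [Om], which need only decide
    sets invariant under one of the equivalence relations in [EE] (the supports). *)
Record Sys (w d Om mu EE : V) : Prop := {
  sy_up : forall B C, B ∈ mu -> subset B C -> subset C Om -> C ∈ mu;
  sy_all : Om ∈ mu;
  sy_and : forall B C I, B ∈ mu -> C ∈ mu -> (forall z, z ∈ I <-> z ∈ B /\ z ∈ C) -> I ∈ mu;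
  sy_dir : forall E1 E2, E1 ∈ EE -> E2 ∈ EE ->
    exists E, E ∈ EE /\ subset E E1 /\ subset E E2;
  sy_ne : exists E, E ∈ EE;
  sy_two : small d (upair emp (upair emp emp));
  sy_const : forall C f, small d C -> f ∈ Adm Om EE C ->
    exists c, c ∈ C /\ ae Om mu (fun s => app f s = c);
  sy_ccc : forall B, (forall n, n ∈ w -> app B n ∈ mu) ->
    exists s, s ∈ Om /\ forall n, n ∈ w -> s ∈ app B n
}.

End SysDefs2.

Section SysTheory.
Context {V : set_structure} {HZ : ZFCm V} {HPow : Powm V}.
Variables (w d Om mu EE : V).
Hypothesis Hw : is_omega w.
Hypothesis HS : Sys w d Om mu EE.
Notation AE P := (ae Om mu P).
Notation A := (Adm Om EE).

Lemma ae_mono (P Q : V -> Prop) {HP : DP1 P} {HQ : DP1 Q} :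
  AE P -> (forall s, s ∈ Om -> P s -> Q s) -> AE Q.
Proof.
intros H HPQ; apply (sy_up HS (B := sep Om P)); auto.
- intros s; insep; intros [Hs Ps]; auto.
- intros s; insep; tauto.
Qed.

Lemma ae_and (P Q : V -> Prop) {HP : DP1 P} {HQ : DP1 Q} :
  AE P -> AE Q -> AE (fun s => P s /\ Q s).
Proof. intros H1 H2; apply (sy_and HS H1 H2); intros z; insep; tauto. Qed.

Lemma ae_all (P : V -> Prop) {HP : DP1 P} : (forall s, s ∈ Om -> P s) -> AE P.
Proof.
intros H; unfold ae; replace (sep Om P) with Om; [apply (sy_all HS)|].
apply ext; intros z; insep; intuition.
Qed.

Lemma ae_ex (P : V -> Prop) {HP : DP1 P} : AE P -> exists s, s ∈ Om /\ P s.
Proof.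
intros H; destruct (sy_ccc HS (B := lam w (fun _ => sep Om P))) as [s [Hs Hn]].
- intros n Hn; now rewrite app_lam by (assumption || dfn).
- specialize (Hn emp (omega_emp Hw)); rewrite app_lam in Hn by (auto using omega_emp || dfn).
  insep in Hn; exists s; tauto.
Qed.

Lemma ae_contra (P : V -> Prop) {HP : DP1 P} : AE P -> AE (fun s => ~ P s) -> False.
Proof.
intros H1 H2; destruct (@ae_ex (fun s => P s /\ ~ P s) ltac:(dfn)) as [s Hs]; [|tauto].
apply ae_and; auto; dfn.
Qed.

Lemma in_Adm N f : f ∈ A N <-> f ∈ funs Om N /\ exists E, E ∈ EE /\ invar Om E (app f).
Proof. unfold Adm; insep; unfold invar; tauto. Qed.

Lemma Adm_app N f s : f ∈ A N -> s ∈ Om -> app f s ∈ N.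
Proof. rewrite in_Adm; intros [H _]; now apply funs_app. Qed.

Lemma Adm_inv N f : f ∈ A N -> exists E, E ∈ EE /\ invar Om E (app f).
Proof. rewrite in_Adm; tauto. Qed.

Lemma Adm_inv2 N M f g : f ∈ A N -> g ∈ A M ->
  exists E, E ∈ EE /\ invar Om E (app f) /\ invar Om E (app g).
Proof.
intros Hf Hg; apply Adm_inv in Hf, Hg.
destruct Hf as [E1 [H1 Hf]], Hg as [E2 [H2 Hg]].
destruct (sy_dir HS H1 H2) as [E [HE [S1 S2]]].
exists E; split; [assumption|]; split; intros s s' Hs Hs' Hp; [apply Hf|apply Hg]; auto.
Qed.

Lemma adm_lam N E (h : V -> V) {Hh : DF1 h} : E ∈ EE -> invar Om E h ->
  (forall s, s ∈ Om -> h s ∈ N) -> lam Om h ∈ A N.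
Proof.
intros HE Hi HN; rewrite in_Adm; split; [now apply lam_funs|].
exists E; split; [assumption|]; intros s s' Hs Hs' Hp.
rewrite !app_lam by (assumption || dfn); now apply Hi.
Qed.

Lemma adm_const N a : a ∈ N -> lam Om (fun _ => a) ∈ A N.
Proof.
intros Ha; destruct (sy_ne HS) as [E HE]; apply (@adm_lam N E); auto; [dfn|].
intros s s'; auto.
Qed.

Lemma Adm_sub N N' f : subset N N' -> f ∈ A N -> f ∈ A N'.
Proof.
intros Hs; rewrite !in_Adm; intros [Hf HE]; split; auto.
rewrite in_funs, maps_iff in *; intuition.
Qed.

(** Constancy is applied to the characteristic function of [P], with the values [emp] and
    [upair emp emp]; [sy_two] makes this range small. *)
Lemma ae_dich (P : V -> Prop) {HP : DP1 P} E : E ∈ EE ->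
  (forall s s', s ∈ Om -> s' ∈ Om -> pair s s' ∈ E -> P s -> P s') ->
  (forall s s', s ∈ Om -> s' ∈ Om -> pair s s' ∈ E -> P s' -> P s) ->
  AE P \/ AE (fun s => ~ P s).
Proof.
intros HE H1 H2.
pose (h := fun s => sep (upair emp emp) (fun _ => P s)).
assert (Hh : DF1 h) by (unfold h; dfn).
assert (Hin : forall s, emp ∈ h s <-> P s) by (intros s; unfold h; insep; rewrite in_sing; tauto).
assert (Hf : lam Om h ∈ A (upair emp (upair emp emp))).
{ apply (@adm_lam _ E); auto.
  - intros s s' Hs Hs' Hp; apply ext; intros z; unfold h; insep.
    specialize (H1 s s' Hs Hs' Hp); specialize (H2 s s' Hs Hs' Hp); tauto.
  - intros s Hs; rewrite in_upair; unfold h; destruct (classic (P s)) as [Ps|Ps]; [right|left];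
      apply ext; intros z; insep; [tauto|].
    split; [tauto|intros Hz; now destruct (not_in_emp Hz)]. }
destruct (sy_const HS (sy_two HS) Hf) as [c [_ Hc]].
destruct (classic (emp ∈ c)) as [He|He]; [left|right];
  refine (@ae_mono _ _ _ _ Hc _); try dfn;
  intros s Hs; rewrite app_lam by (assumption || dfn); intros <-; now rewrite Hin in He.
Qed.

Lemma ae_dich2 N M f g (R : V -> V -> Prop) {HR : DP2 R} : f ∈ A N -> g ∈ A M ->
  AE (fun s => R (app f s) (app g s)) \/ AE (fun s => ~ R (app f s) (app g s)).
Proof.
intros Hf Hg; destruct (Adm_inv2 Hf Hg) as [E [HE [H1 H2]]].
apply (@ae_dich (fun s => R (app f s) (app g s)) _ E); auto;
  intros s s' Hs Hs' Hp; rewrite (H1 s s'), (H2 s s'); auto.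
Qed.

(** Values outside [C] are replaced by one value [app g s0] inside [C], which preserves the
    support. *)
Lemma adm_modify N C g : g ∈ A N -> AE (fun s => app g s ∈ C) ->
  exists g', g' ∈ A C /\ AE (fun s => app g s = app g' s).
Proof.
intros Hg Hae; destruct (@ae_ex _ _ Hae) as [s0 [Hs0 Hc0]].
destruct (Adm_inv Hg) as [E [HE Hi]].
pose (h := fun s => iota (fun v => (app g s ∈ C /\ v = app g s) \/ (app g s ∉ C /\ v = app g s0))).
assert (Hh : DF1 h) by (unfold h; dfn).
assert (H1 : forall s, app g s ∈ C -> h s = app g s).
{ intros s Hs; apply iota_eq; [auto|]; intros z; tauto. }
assert (H2 : forall s, app g s ∉ C -> h s = app g s0).
{ intros s Hs; apply iota_eq; [auto|]; intros z; tauto. }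
exists (lam Om h); split.
- apply (@adm_lam C E); auto.
  + intros s s' Hs Hs' Hp; unfold h; now rewrite (Hi s s' Hs Hs' Hp).
  + intros s Hs; destruct (classic (app g s ∈ C)) as [H|H]; [rewrite H1|rewrite H2]; auto.
- refine (@ae_mono _ _ _ _ Hae _); try dfn.
  intros s Hs Hc; rewrite app_lam by (assumption || dfn); symmetry; auto.
Qed.

Lemma ae_const N C f : small d C -> f ∈ A N -> AE (fun s => app f s ∈ C) ->
  exists c, c ∈ C /\ AE (fun s => app f s = c).
Proof.
intros HC Hf Hae; destruct (adm_modify Hf Hae) as [g [Hg Hfg]].
destruct (sy_const HS HC Hg) as [c [Hc Hgc]]; exists c; split; [assumption|].
refine (@ae_mono _ _ _ _ (@ae_and _ _ _ _ Hfg Hgc) _); try dfn; intros s _ [-> ->]; reflexivity.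
Qed.

Notation Emu := (fun g f => AE (fun s => app g s ∈ app f s)).

(** By [sy_ccc] a descending sequence of functions descends at a single point [s], contradicting
    Foundation. *)
Lemma mu_wf N : wf_on Emu (A N).
Proof.
apply (@wf_from_seq _ _ w Hw Emu _); intros [f [Hf HfE]].
apply maps_iff in Hf.
destruct (sy_ccc HS (B := lam w (fun i => sep Om (fun s => app (app f (succ i)) s ∈ app (app f i) s))))
  as [s [Hs Hn]].
- intros n Hn; rewrite app_lam by (assumption || dfn); now apply HfE.
- apply (@no_descent _ _ w Hw (lam w (fun i => app (app f i) s))); split; [apply lam_fun; dfn|].
  intros i Hi; rewrite !app_lam by (auto using omega_succ || dfn).
  specialize (Hn i Hi); rewrite app_lam in Hn by (assumption || dfn); insep in Hn; tauto.
Qed.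

Lemma rho_spec N : is_fun (rho Om mu EE N) (A N) /\ forall f, f ∈ A N -> app (rho Om mu EE N) f =
    repl (sep (A N) (fun g => Emu g f)) (fun g => app (rho Om mu EE N) g).
Proof.
unfold rho; apply iota_spec.
destruct (@collapse _ _ Emu _ (A N) (@mu_wf N)) as [c [Hc Hr]].
exists c; split; [split; assumption|].
intros c' [Hc' Hr']; apply (fun_ext Hc Hc').
apply (@wf_ind _ _ Emu (A N) (fun f => app c f = app c' f) _ (@mu_wf N)).
intros f Hf IH; rewrite Hr, Hr' by assumption; apply repl_ext; try dfn.
intros g; insep; intros [Hg HE]; now apply IH.
Qed.

Section Collapse.
Variable N : V.
Notation c := (app (rho Om mu EE N)).

Lemma in_rho f z : f ∈ A N -> (z ∈ c f <-> exists g, g ∈ A N /\ Emu g f /\ z = c g).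
Proof.
intros Hf; rewrite (proj2 (rho_spec N) f Hf) at 1; inrepl; split.
- intros [g [Hg ->]]; insep in Hg; exists g; tauto.
- intros [g [Hg [HE ->]]]; exists g; insep; tauto.
Qed.

Lemma rho_mem f g : f ∈ A N -> g ∈ A N -> Emu g f -> c g ∈ c f.
Proof. intros Hf Hg H; rewrite (in_rho _ Hf); eauto. Qed.

Lemma rho_eq_ae f g : f ∈ A N -> g ∈ A N -> AE (fun s => app f s = app g s) -> c f = c g.
Proof.
intros Hf Hg H; apply ext; intros z; rewrite (in_rho _ Hf), (in_rho _ Hg).
split; intros [h [Hh [HE ->]]]; exists h; split; auto; split; auto;
  refine (@ae_mono _ _ _ _ (@ae_and _ _ _ _ H HE) _); try dfn; intros s _ [E1 E2]; congruence.
Qed.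

(** The choice depends on the set [S] only. Points equivalent under a support offer the same [S] and
    receive the same witness, so that functions chosen in this way are admissible. *)
Lemma selector : (exists x, x ∈ N) ->
  exists K, forall S, subset S N -> app K S ∈ N /\ ((exists z, z ∈ S) -> app K S ∈ S).
Proof.
intros [x0 Hx0].
destruct (@choice_fun _ _ (pow N) (fun S y => y ∈ N /\ ((exists z, z ∈ S) -> y ∈ S)) _)
  as [K [HK HKr]].
- intros S HSN; rewrite in_pow in HSN; destruct (classic (exists z, z ∈ S)) as [[z Hz]|H].
  + exists z; auto.
  + exists x0; tauto.
- exists K; intros S HSN; apply HKr; now apply in_pow.
Qed.

Hypothesis HN : transitive N.

(** If [f] and [g] differ almost everywhere, then almost everywhere one of them, say [f], has an
    element outside the other, and such elements form an admissible [h]. The collapse of [h] lies in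
    that of [g], so by induction [h] agrees almost everywhere with some member of [g], a
    contradiction. *)
Lemma rho_eq f g : f ∈ A N -> g ∈ A N -> c f = c g -> AE (fun s => app f s = app g s).
Proof.
intros Hf; revert f Hf g.
apply (@wf_ind _ _ Emu (A N) (fun f => forall g, g ∈ A N -> c f = c g ->
  AE (fun s => app f s = app g s)) _ (@mu_wf N)).
intros f Hf IH g Hg Efg.
destruct (@ae_dich2 _ _ f g (fun x y => x = y) _ Hf Hg) as [H|H]; auto; exfalso.
destruct (ae_ex H) as [s0 [Hs0 _]].
destruct selector as [K HK]; [exists (app f s0); now apply Adm_app|].
destruct (Adm_inv2 Hf Hg) as [E [HE [Hif Hig]]].
assert (Hsub : forall h, h ∈ A N -> forall s, s ∈ Om -> forall P : V -> Prop, DP1 P ->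
  subset (sep (app h s) P) N).
{ intros h Hh s Hs P HP z; insep; intros [Hz _]; apply (HN (Adm_app Hh Hs) Hz). }
assert (Hsel : forall f g, f ∈ A N -> g ∈ A N -> invar Om E (app f) -> invar Om E (app g) ->
  AE (fun s => exists z, z ∈ app f s /\ z ∉ app g s) ->
  exists h, h ∈ A N /\ Emu h f /\ AE (fun s => app h s ∉ app g s)).
{ clear f g Hf Hg Hif Hig IH Efg H s0 Hs0; intros f g Hf Hg Hif Hig H.
  pose (h := fun s => app K (sep (app f s) (fun z => z ∉ app g s))).
  assert (Hh : DF1 h) by (unfold h; dfn).
  exists (lam Om h).
  assert (Hhs : AE (fun s => h s ∈ app f s /\ h s ∉ app g s)).
  { refine (@ae_mono _ _ _ _ H _); try dfn.
    intros s Hs Hz; destruct (HK (sep (app f s) (fun z => z ∉ app g s))) as [_ H1].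
    - apply Hsub; auto; dfn.
    - assert (H2 : h s ∈ sep (app f s) (fun z => z ∉ app g s)).
      { apply H1; destruct Hz as [z Hz]; exists z; insep; auto. }
      insep in H2; auto. }
  split; [|split].
  - apply (@adm_lam N E); auto.
    + intros s s' Hs Hs' Hp; unfold h; now rewrite (Hif s s'), (Hig s s').
    + intros s Hs; apply HK, Hsub; auto; dfn.
  - refine (@ae_mono _ _ _ _ Hhs _); try dfn; intros s Hs; rewrite app_lam by (assumption || dfn); tauto.
  - refine (@ae_mono _ _ _ _ Hhs _); try dfn; intros s Hs; rewrite app_lam by (assumption || dfn); tauto. }
destruct (@ae_dich2 _ _ f g (fun x y => exists z, z ∈ x /\ z ∉ y) _ Hf Hg) as [H1|H1].
- destruct (Hsel f g Hf Hg Hif Hig H1) as [h [Hh [Hhf Hhg]]].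
  pose proof (rho_mem Hf Hh Hhf) as H2; rewrite Efg in H2; apply (in_rho _ Hg) in H2.
  destruct H2 as [g' [Hg' [Hgg' E2]]].
  pose proof (IH h Hh Hhf g' Hg' E2) as H3.
  destruct (ae_ex (ae_and (ae_and H3 Hgg') Hhg)) as [s [Hs [[E3 H4] H5]]].
  rewrite E3 in H5; tauto.
- assert (H2 : AE (fun s => exists z, z ∈ app g s /\ z ∉ app f s)).
  { refine (@ae_mono _ _ _ _ (ae_and H H1) _); try dfn.
    intros s Hs [Hne Hno]; apply NNPP; intros N1; apply Hne, ext; intros z; split; intros Hz;
      apply NNPP; intros N2; [apply Hno | apply N1]; eauto. }
  destruct (Hsel g f Hg Hf Hig Hif H2) as [h [Hh [Hhg Hhf]]].
  pose proof (rho_mem Hg Hh Hhg) as H3; rewrite <- Efg in H3; apply (in_rho _ Hf) in H3.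
  destruct H3 as [f' [Hf' [Hff' E2]]].
  pose proof (IH f' Hf' Hff' h Hh (eq_sym E2)) as H4.
  destruct (ae_ex (ae_and (ae_and H4 Hff') Hhf)) as [s [Hs [[E3 H5] H6]]].
  rewrite E3 in H5; tauto.
Qed.

Lemma rho_mem_iff f g : f ∈ A N -> g ∈ A N -> (c g ∈ c f <-> Emu g f).
Proof.
intros Hf Hg; split; [|now apply rho_mem].
intros H; apply (in_rho _ Hf) in H; destruct H as [h [Hh [HE E1]]].
pose proof (rho_eq Hg Hh E1) as H1.
refine (@ae_mono _ _ _ _ (ae_and H1 HE) _); try dfn; intros s _ [-> H2]; exact H2.
Qed.

Lemma DP1_sat p (F : nat -> V) : DP1 (fun s => sat p (fun n => app (F n) s)).
Proof. apply (@D_sat _ _ p (fun n r => app (F n) (r 0))); intros n; dfn. Qed.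

Definition satx p (F : nat -> V) s x : Prop := sat p (scons x (fun n => app (F n) s)).

Instance DP2_satx p (F : nat -> V) : DP2 (satx p F).
Proof.
unfold satx.
apply (@D_ext _ (fun r => sat p (fun n => match n with 0 => fun r => r 1
  | S m => fun r => app (F m) (r 0) end r))).
- intros r; apply sat_ext; now intros [|n].
- apply D_sat; intros [|n]; dfn.
Qed.

(** Łoś's theorem. Transitivity of [N] keeps the witnesses of bounded quantifiers in [N]. A common
    support is required because infinitely many supports need not have a common refinement. *)
Lemma los_Delta0 p : Delta0 p -> forall F : nat -> V, (forall n, F n ∈ A N) ->
  (exists E, E ∈ EE /\ forall n, invar Om E (app (F n))) ->
  (sat p (fun n => c (F n)) <-> AE (fun s => sat p (fun n => app (F n) s))).
Proof.
intros Hp; induction Hp as [i j|i j|p Hp IH|p q Hp IHp Hq IHq|i p Hp IH];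
  intros F HF [E [HE HFE]]; cbn [sat].
- now apply rho_mem_iff.
- split; [now apply rho_eq|now apply rho_eq_ae].
- rewrite (IH F HF (ex_intro _ E (conj HE HFE))).
  pose proof (DP1_sat p F) as HD; split; intros H.
  + destruct (@ae_dich _ HD E HE) as [H1|H1]; auto; try tauto;
      intros s s' Hs Hs' Hpr; apply sat_ext; intros n; [symmetry|]; now apply HFE.
  + intros H1; apply (ae_contra H1 H).
- rewrite (IHp F HF (ex_intro _ E (conj HE HFE))), (IHq F HF (ex_intro _ E (conj HE HFE))).
  pose proof (DP1_sat p F) as HD; pose proof (DP1_sat q F) as HD'; split.
  + intros [H1 H2]; now apply ae_and.
  + intros H; split; (refine (@ae_mono _ _ _ _ H _); try dfn; tauto).
- change ((exists x, x ∈ c (F i) /\ sat p (scons x (fun n => c (F n)))) <->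
    AE (fun s => exists x, x ∈ app (F i) s /\ satx p F s x)).
  (* Adding one function to the assignment only requires refining the common support once. *)
  assert (Hsc : forall g, g ∈ A N ->
    (sat p (scons (c g) (fun n => c (F n))) <->
     AE (fun s => satx p F s (app g s)))).
  { intros g Hg.
    assert (H1 : exists E, E ∈ EE /\ forall n, invar Om E (app (scons g F n))).
    { destruct (Adm_inv Hg) as [E1 [HE1 Hi]].
      destruct (sy_dir HS HE HE1) as [E2 [HE2 [Hs1 Hs2]]]; exists E2; split; auto.
      intros [|n] s s' Hs Hs' Hpr; [apply Hi|apply HFE]; auto. }
    specialize (IH (scons g F)); rewrite (@sat_ext _ p _ (fun n => c (scons g F n)));
      [|now intros [|n]].
    rewrite IH; [|intros [|n]; cbn; auto|assumption].
    unfold ae; replace (sep Om (fun s => sat p (fun n => app (scons g F n) s))) with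
      (sep Om (fun s => satx p F s (app g s))); [tauto|].
    apply ext; intros z; rewrite (in_sep (HP := DP1_sat p (scons g F))).
    rewrite in_sep by dfn; unfold satx.
    rewrite (@sat_ext _ p _ (fun n => app (scons g F n) z)); [tauto|now intros [|n]]. }
  split.
  + intros [x [Hx Hsat]]; apply (in_rho _ (HF i)) in Hx.
    destruct Hx as [g [Hg [HgE ->]]]; apply (Hsc g Hg) in Hsat.
    refine (@ae_mono _ _ _ _ (ae_and HgE Hsat) _); try dfn.
    intros s Hs H; exists (app g s); exact H.
  + intros H.
    destruct (@ae_ex _ _ H) as [s0 [Hs0 _]].
    destruct selector as [K HK]; [exists (app (F i) s0); now apply Adm_app|].
    pose (S := fun s => sep (app (F i) s) (fun x => satx p F s x)).
    assert (HSN : forall s, s ∈ Om -> subset (S s) N).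
    { intros s Hs z; unfold S; insep; intros [Hz _]; exact (HN (Adm_app (HF i) Hs) Hz). }
    pose (h := fun s => app K (S s)).
    assert (Hh : DF1 h) by (unfold h, S; dfn).
    assert (HhA : lam Om h ∈ A N).
    { apply (@adm_lam N E); auto.
      - intros s s' Hs Hs' Hpr; unfold h; f_equal; apply ext; intros z; unfold S; insep; unfold satx.
        rewrite (HFE i s s') by assumption.
        rewrite (@sat_ext _ p (scons z (fun n => app (F n) s)) (scons z (fun n => app (F n) s')));
          [tauto|]; intros [|n]; [reflexivity|]; now apply HFE.
      - intros s Hs; now apply HK, HSN. }
    assert (Hhs : AE (fun s => h s ∈ app (F i) s /\ satx p F s (h s))).
    { refine (@ae_mono _ _ _ _ H _); try dfn.
      intros s Hs [x Hx]; destruct (HK _ (HSN s Hs)) as [_ H1].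
      assert (H2 : h s ∈ S s) by (apply H1; exists x; unfold S; insep; exact Hx).
      unfold S in H2; insep in H2; exact H2. }
    exists (c (lam Om h)); split.
    * apply rho_mem; auto.
      refine (@ae_mono _ _ _ _ Hhs _); try dfn.
      intros s Hs H1; rewrite app_lam by (assumption || dfn); tauto.
    * apply Hsc; auto.
      refine (@ae_mono _ _ _ _ Hhs _); try dfn.
      intros s Hs H1; rewrite app_lam by (assumption || dfn); tauto.
Qed.

End Collapse.
End SysTheory.

(** * Sigma_1 truth and embeddings of transitive sets *)

Section Reflect.
Context {V : set_structure} {HZ : ZFCm V} {HPow : Powm V}.

Lemma list_set (l : list V) : exists B : V, forall x, In x l -> x ∈ B.
Proof.
induction l as [|a l [B HB]].
- exists emp; intros x [].
- exists (cup B (upair a a)); intros x [->|Hx]; rewrite in_cup, in_sing; auto.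
Qed.

(** [N] contains the witnesses of the leading quantifiers, and their images witness the formula for
    the images of [r]. Hence [i] has to be elementary on the set [N] only. *)
Lemma sigma1_reflect (w : V) (Hw : is_omega w) phi : Sigma1 phi ->
  forall (r : nat -> V) (B : V), (forall n, r n ∈ B) -> sat phi r ->
  exists N, transitive N /\ subset B N /\ forall i : V -> V,
    (forall p (s : nat -> V), Delta0 p -> (forall n, s n ∈ N) -> sat p s -> sat p (fun n => i (s n))) ->
    sat phi (fun n => i (r n)).
Proof.
intros H; induction H as [p Hp|p Hp IH]; intros r B HB Hs.
- destruct (trans_superset Hw B) as [N [HN HBN]]; exists N; split; [|split]; auto.
- destruct Hs as [x Hx].
  destruct (IH (scons x r) (cup B (upair x x))) as [N [HN [HBN Hi]]]; auto.
  { intros [|n]; cbn [scons]; rewrite in_cup, in_sing; auto. }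
  exists N; split; [assumption|split].
  + intros z Hz; apply HBN; rewrite in_cup; auto.
  + intros i Hel; exists (i x); specialize (Hi i Hel); revert Hi; apply sat_ext.
    now intros [|n].
Qed.

End Reflect.

(** * Embeddings that fix [k] and the parameters *)

Section Image.
Context {V : set_structure} {HZ : ZFCm V} {HPow : Powm V}.

(** The image of a subset [x] of [k] under the ultrapower embedding. *)
Definition iset (Om mu EE k x : V) : V :=
  repl (sep (Adm Om EE k) (fun f => ae Om mu (fun s => app f s ∈ x)))
       (fun f => app (rho Om mu EE k) f).

#[global] Instance DF5_iset : DF5 iset.
Proof. unfold iset; dfn. Qed.

Variables (w d Om mu EE : V).
Hypothesis Hw : is_omega w.
Hypothesis HS : Sys w d Om mu EE.
Notation AE P := (ae Om mu P).
Notation A := (Adm Om EE).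
Notation c N := (app (rho Om mu EE N)).
Notation kst a := (lam Om (fun _ => a)).
Let adm_k := @adm_const _ _ _ _ _ _ _ _ HS.

Lemma app_kst a s : s ∈ Om -> app (kst a) s = a.
Proof. intros Hs; now rewrite app_lam by (assumption || dfn). Qed.

(** A function with values in a small [z] is constant almost everywhere, so the image of [z]
    acquires no new elements. *)
Lemma rho_const_step N z : transitive N -> z ∈ N -> small d z ->
  (forall u, u ∈ z -> c N (kst u) = u) -> c N (kst z) = z.
Proof.
intros HN Hz Hsm Hu; apply ext; intros v; rewrite (in_rho Hw HS _ (adm_k Hz)); split.
- intros [g [Hg [HE ->]]].
  assert (HE' : AE (fun s => app g s ∈ z)).
  { refine (ae_mono HS HE _); try dfn; intros s Hs; now rewrite app_kst. }
  destruct (ae_const Hw HS Hsm Hg HE') as [u [Huz Hgu]].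
  rewrite (rho_eq_ae Hw HS (N:=N) (f:=g) (g:=kst u)); auto.
  + now rewrite Hu.
  + apply adm_k, (HN z); auto.
  + refine (ae_mono HS Hgu _); try dfn; intros s Hs; now rewrite app_kst.
- intros Hv; exists (kst v); split; [apply adm_k, (HN z); auto|split].
  + apply (ae_all HS); [dfn|]; intros s Hs; now rewrite !app_kst.
  + symmetry; now apply Hu.
Qed.

Lemma rho_const_small N T0 y : transitive N -> transitive T0 -> subset T0 N -> small d T0 ->
  y ∈ N -> subset y T0 -> c N (kst y) = y.
Proof.
intros HN HT HTN Hsm Hy HyT.
assert (H : forall u, u ∈ T0 -> c N (kst u) = u).
{ apply (@trans_ind _ _ (fun u => c N (kst u) = u) _ T0 HT).
  intros u Hu IH; apply rho_const_step; auto.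
  apply small_sub with T0; auto. }
apply rho_const_step; auto; apply small_sub with T0; auto.
Qed.

(** A function below [f] agrees almost everywhere with one into [N], because [N] is transitive. So
    the collapse of [f] does not depend on the structure in which it is taken. *)
Lemma rho_agree N N' f : transitive N -> subset N N' -> f ∈ A N -> c N' f = c N f.
Proof.
intros HN HNN Hf; revert f Hf.
apply (@wf_ind _ _ (fun g f => AE (fun s => app g s ∈ app f s)) (A N) (fun f => c N' f = c N f)
  _ (mu_wf Hw HS (N:=N))).
intros f Hf IH; apply ext; intros z.
pose proof (Adm_sub HNN Hf) as Hf'.
rewrite (in_rho Hw HS _ Hf), (in_rho Hw HS _ Hf'); split.
- intros [g [Hg [HE ->]]].
  assert (HgN : AE (fun s => app g s ∈ N)).
  { refine (ae_mono HS HE _); try dfn; intros s Hs Hgf; exact (HN _ (Adm_app Hf Hs) _ Hgf). }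
  destruct (adm_modify Hw HS Hg HgN) as [g' [Hg' Hgg']].
  assert (HE' : AE (fun s => app g' s ∈ app f s)).
  { refine (ae_mono HS (ae_and HS HE Hgg') _); try dfn; intros s Hs [H1 <-]; exact H1. }
  exists g'; split; [assumption|split; [assumption|]].
  rewrite <- (IH g' Hg' HE'); apply (rho_eq_ae Hw HS Hg (Adm_sub HNN Hg') Hgg').
- intros [g [Hg [HE ->]]]; exists g; split; [now apply Adm_sub with N|split; auto].
  now rewrite IH.
Qed.

Variable k : V.
Hypothesis Hk : ordinal k.
Hypothesis Hbd : forall f, f ∈ A k -> exists b, b ∈ k /\ AE (fun s => app f s ∈ b).
Hypothesis Hsz : forall b, b ∈ k -> exists e v, e ∈ k /\ is_measure e v /\ small e b /\ small e Om.

Lemma rk_ord f : f ∈ A k -> ordinal (c k f).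
Proof.
revert f; apply (@wf_ind _ _ (fun g f => AE (fun s => app g s ∈ app f s)) (A k)
  (fun f => ordinal (c k f)) _ (mu_wf Hw HS (N:=k))).
intros f Hf IH; split.
- intros y Hy z Hz; apply (in_rho Hw HS _ Hf) in Hy; destruct Hy as [g [Hg [Hgf ->]]].
  apply (in_rho Hw HS _ Hg) in Hz; destruct Hz as [h [Hh [Hhg ->]]].
  apply (rho_mem Hw HS Hf Hh).
  refine (ae_mono HS (ae_and HS Hgf Hhg) _); try dfn; intros s Hs [H1 H2].
  exact (ord_trans (ord_elem Hk (Adm_app Hf Hs)) H1 H2).
- intros y Hy; apply (in_rho Hw HS _ Hf) in Hy; destruct Hy as [g [Hg [Hgf ->]]].
  exact (proj1 (IH g Hg Hgf)).
Qed.

(** [f] is bounded by some [b] almost everywhere, so the ordinals below its collapse are represented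
    by functions from [Om] to [b]. These are few for the strong limit [e], hence the collapse is
    below [e]. *)
Lemma rk_in f : f ∈ A k -> c k f ∈ k.
Proof.
intros Hf; destruct (Hbd Hf) as [b [Hb Hfb]].
destruct (Hsz Hb) as [e [v [He [Hm [Hsb HsO]]]]].
apply (ord_trans Hk He).
destruct (ord_tri (rk_ord Hf) (meas_ord Hm)) as [H|H]; auto.
exfalso; apply (small_not_ge Hm (C := c k f)).
- apply small_sub with (repl (A b) (fun g => c k g)).
  + apply small_repl; [dfn|]; apply small_sub with (funs Om b); [now apply (small_funs Hm)|].
    intros z; rewrite in_Adm; tauto.
  + intros z Hz; apply (in_rho Hw HS _ Hf) in Hz; destruct Hz as [g [Hg [Hgf ->]]].
    assert (Hgb : AE (fun s => app g s ∈ b)).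
    { refine (ae_mono HS (ae_and HS Hfb Hgf) _); try dfn; intros s Hs [H1 H2].
      exact (ord_trans (ord_elem Hk Hb) H1 H2). }
    destruct (adm_modify Hw HS Hg Hgb) as [g' [Hg' Hgg']].
    inrepl; exists g'; split; [assumption|].
    apply (rho_eq_ae Hw HS Hg); auto.
    apply Adm_sub with b; auto; intros z Hz; exact (ord_trans Hk Hb Hz).
- destruct H as [H|H]; [rewrite H; now intros z|].
  exact (proj1 (rk_ord Hf) e H).
Qed.

Lemma rk_ge a : a ∈ k -> subset a (c k (kst a)).
Proof.
intros Ha; revert a Ha.
apply (@trans_ind _ _ (fun a => subset a (c k (kst a))) _ k (proj1 Hk)).
intros a Ha IH b Hb.
assert (Hbk : b ∈ k) by exact (ord_trans Hk Ha Hb).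
apply (@ord_le_lt _ _ _ (c k (kst b))).
- apply rk_ord, adm_k, Ha.
- now apply IH.
- exact (ord_elem Hk Hbk).
- apply (rho_mem Hw HS (adm_k Ha) (adm_k Hbk)), (ae_all HS); [dfn|].
  intros s Hs; now rewrite !app_kst.
Qed.

Lemma rk_onto a : a ∈ k -> exists f, f ∈ A k /\ c k f = a.
Proof.
intros Ha; pose proof (adm_k Ha) as Hka.
destruct (ord_tri (ord_elem Hk Ha) (rk_ord Hka)) as [H|[H|H]].
- apply (in_rho Hw HS _ Hka) in H; destruct H as [g [Hg [_ ->]]]; eauto.
- eauto.
- destruct (irrefl (rk_ge Ha H)).
Qed.

Lemma rk_iset x f : f ∈ A k -> (c k f ∈ iset Om mu EE k x <-> AE (fun s => app f s ∈ x)).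
Proof.
intros Hf; unfold iset; inrepl; split.
- intros [g [Hg E]]; insep in Hg; destruct Hg as [Hg Hgx].
  refine (ae_mono HS (ae_and HS (rho_eq Hw HS (proj1 Hk) Hf Hg E) Hgx) _); try dfn.
  intros s _ [-> H]; exact H.
- intros H; exists f; insep; auto.
Qed.

Lemma iset_sub x : subset (iset Om mu EE k x) k.
Proof.
intros z; unfold iset; inrepl; intros [f [Hf ->]]; insep in Hf; apply rk_in; tauto.
Qed.

Lemma rho_const_sub N x : transitive N -> k ∈ N -> x ∈ N -> subset x k ->
  c N (kst x) = iset Om mu EE k x.
Proof.
intros HN HkN Hx Hxk; assert (Hsub : subset k N) by exact (HN k HkN).
apply ext; intros z; rewrite (in_rho Hw HS _ (adm_k Hx)); unfold iset; inrepl; split.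
- intros [g [Hg [HE ->]]].
  assert (Hgk : AE (fun s => app g s ∈ k)).
  { refine (ae_mono HS HE _); try dfn; intros s Hs; rewrite app_kst by assumption; auto. }
  destruct (adm_modify Hw HS Hg Hgk) as [g' [Hg' Hgg']].
  exists g'; split.
  + insep; split; auto; refine (ae_mono HS (ae_and HS HE Hgg') _); try dfn.
    intros s Hs; rewrite app_kst by assumption; intros [H1 <-]; exact H1.
  + rewrite (rho_eq_ae Hw HS Hg (Adm_sub Hsub Hg') Hgg').
    apply rho_agree; auto; exact (proj1 Hk).
- intros [g [Hg ->]]; insep in Hg; destruct Hg as [Hg Hgx].
  exists g; split; [now apply Adm_sub with k|split].
  + refine (ae_mono HS Hgx _); try dfn; intros s Hs; now rewrite app_kst.
  + symmetry; apply rho_agree; auto; exact (proj1 Hk).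
Qed.

Lemma iset_k : iset Om mu EE k k = k.
Proof.
apply ext; intros z; split; [apply iset_sub|].
intros Hz; destruct (rk_onto Hz) as [f [Hf <-]]; apply rk_iset; auto.
apply (ae_all HS); [dfn|]; intros s Hs; now apply (Adm_app Hf).
Qed.

Lemma iset_defines phi params x : Sigma1 phi ->
  Forall (fun p => (exists y, is_trcl y p /\ small d y) \/ p = k) params ->
  subset x k -> defines phi params x -> defines phi params (iset Om mu EE k x).
Proof.
intros Hphi Hpar Hx Hdef; unfold defines in *.
destruct (list_set (k :: x :: params)) as [B HB].
destruct (@sigma1_reflect _ _ w Hw phi Hphi (fun n => nth n (x :: params) x) B) as [N [HN [HBN Hi]]].
{ intros n; destruct (nth_in_or_default n (x :: params) x) as [H|H]; cbv beta.
  - apply HB; right; exact H.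
  - rewrite H; apply HB; cbn; auto. }
{ exact Hdef. }
assert (HxN : x ∈ N) by (apply HBN, HB; cbn; auto).
assert (HkN : k ∈ N) by (apply HBN, HB; cbn; auto).
pose (i := fun a => c N (kst a)).
assert (Hel : sat phi (fun n => i (nth n (x :: params) x))).
{ apply Hi; intros p s Hp Hs Hsat; unfold i.
  apply (los_Delta0 Hw HS HN Hp (F := fun n => kst (s n))).
  - intros n; now apply adm_k.
  - destruct (sy_ne HS) as [E HE]; exists E; split; auto.
    intros n t t' Ht Ht' _; now rewrite !app_kst.
  - apply (ae_all HS); [apply DP1_sat|]; intros t Ht; revert Hsat; apply sat_ext.
    intros n; now rewrite app_kst. }
assert (Hix : i x = iset Om mu EE k x) by now apply rho_const_sub.
assert (Hip : forall p, In p params -> i p = p).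
{ intros p Hp; rewrite Forall_forall in Hpar; destruct (Hpar p Hp) as [[y [Hy Hsm]]| ->].
  - assert (HpN : p ∈ N) by (apply HBN, HB; cbn; auto).
    destruct Hy as [Hyt [Hpy Hymin]].
    apply rho_const_small with y; auto.
  - unfold i; rewrite rho_const_sub; auto using iset_k; now intros z. }
assert (Hmap : map i params = params).
{ rewrite <- (map_id params) at 2; apply map_ext_in; exact Hip. }
(* The default value of [nth] is [x], and [i] turns it into the image of [x], which is the default
   that [defines] prescribes for the image. *)
revert Hel; apply sat_ext; intros n; rewrite <- Hix.
rewrite <- (map_nth i); cbn [map]; now rewrite Hmap.
Qed.

End Image.

(** * Ordinals below [k] are moved by finitely many embeddings *)

Section KunenStep.
Context {V : set_structure} {HZ : ZFCm V} {HPow : Powm V}.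
Variables (w k : V).
Hypothesis Hw : is_omega w.
Hypothesis Hk : ordinal k.

(** The second clause makes the embedding continuous at [k]; the third keeps images of ordinals
    below [k]. Together they make [k] a fixed point. *)
Definition good_sys d Om mu EE : Prop := Sys w d Om mu EE /\
  (forall f, f ∈ Adm Om EE k -> exists b, b ∈ k /\ ae Om mu (fun s => app f s ∈ b)) /\
  (forall b, b ∈ k -> exists e v, e ∈ k /\ is_measure e v /\ small e b /\ small e Om).

Definition fixes Om mu EE a : Prop := app (rho Om mu EE k) (lam Om (fun _ => a)) = a.

#[global] Instance DP4_fixes : DP4 fixes.
Proof. unfold fixes; dfn. Qed.

Section Step.
Variables (d Om mu EE d' Om' mu' EE' : V).
Hypotheses (HP : good_sys d Om mu EE) (HQ : good_sys d' Om' mu' EE').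
Hypotheses (HsO : small d' (pow Om)) (HsE : small d' EE).
Let SP := proj1 HP.
Let SQ := proj1 HQ.
Notation rP := (app (rho Om mu EE k)).
Notation rQ := (app (rho Om' mu' EE' k)).

Variables (f x : V).
Hypotheses (Hf : f ∈ Adm Om EE k) (Hfx : rP f = x).
Hypothesis Hfix : ae Om mu (fun s => fixes Om' mu' EE' (app f s)).

Let Hxk : x ∈ k.
Proof. rewrite <- Hfx; apply (rk_in Hw SP Hk (proj1 (proj2 HP)) (proj2 (proj2 HP)) Hf). Qed.

Variables (K e : V).
Hypothesis HK : forall a, a ∈ x -> app K a ∈ Adm Om EE k /\
  ae Om mu (fun s => app (app K a) s ∈ app f s) /\ rP (app K a) = a.
Hypothesis He : forall a, a ∈ x -> app e a ∈ EE /\ invar Om (app e a) (app (app K a)).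

Definition slice g s := lam Om' (fun t => app (app K (app g t)) s).
(** If [app K a] represents [a] in the first ultrapower, then [g] induces a function of two
    variables; collapsing in the second variable first yields [hstar g]. The map [g |-> hstar g]
    is order preserving into the functions below [f], so the image of [x] in the second
    ultrapower has order type at most [x]. *)
Definition hstar g := lam Om (fun s => rQ (slice g s)).

Instance DF2_slice : DF2 slice.
Proof. unfold slice; dfn. Qed.
Instance DF1_hstar : DF1 hstar.
Proof. unfold hstar; dfn. Qed.

Lemma slice_app g s t : t ∈ Om' -> app (slice g s) t = app (app K (app g t)) s.
Proof. intros Ht; unfold slice; now rewrite app_lam by (assumption || dfn). Qed.

Lemma slice_adm g s : g ∈ Adm Om' EE' x -> s ∈ Om -> slice g s ∈ Adm Om' EE' k.
Proof.
intros Hg Hs; destruct (Adm_inv Hg) as [E [HE Hi]].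
apply (@adm_lam _ _ _ Om' EE' k E); auto; [dfn| |].
- intros t t' Ht Ht' Hp; now rewrite (Hi t t').
- intros t Ht; destruct (HK (Adm_app Hg Ht)) as [H _]; exact (Adm_app H Hs).
Qed.

Lemma hstar_app g s : s ∈ Om -> app (hstar g) s = rQ (slice g s).
Proof. intros Hs; unfold hstar; now rewrite app_lam by (assumption || dfn). Qed.

Lemma hstar_adm g : g ∈ Adm Om' EE' x -> hstar g ∈ Adm Om EE k.
Proof.
intros Hg; destruct (Adm_inv Hg) as [E' [HE' Hi']].
assert (Hte : lam Om' (fun t => app e (app g t)) ∈ Adm Om' EE' EE).
{ apply (@adm_lam _ _ _ Om' EE' EE E'); auto; [dfn| |].
  - intros t t' Ht Ht' Hp; now rewrite (Hi' t t').
  - intros t Ht; apply He, (Adm_app Hg Ht). }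
(* [EE] is small for the second measure, so almost all [t] share one support [E], which then
   supports [hstar g]. *)
destruct (sy_const SQ HsE Hte) as [E [HE HEc]].
apply (@adm_lam _ _ _ Om EE k E); auto; [dfn| |].
- intros s s' Hs Hs' Hp; apply (rho_eq_ae Hw SQ); try now apply slice_adm.
  refine (ae_mono SQ HEc _); try dfn; intros t Ht; rewrite app_lam by (assumption || dfn).
  intros Et; rewrite !slice_app by assumption.
  destruct (He (Adm_app Hg Ht)) as [_ H]; apply H; auto; now rewrite Et.
- intros s Hs; apply (rk_in Hw SQ Hk (proj1 (proj2 HQ)) (proj2 (proj2 HQ))); now apply slice_adm.
Qed.

(** Since [pow Om] is small for the second measure, the quantifiers "almost all" commute. *)
Lemma ae_swap (R : V -> V -> Prop) {HR : DP2 R} E' : E' ∈ EE' ->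
  (forall t t', t ∈ Om' -> t' ∈ Om' -> pair t t' ∈ E' -> forall s, R s t <-> R s t') ->
  ae Om' mu' (fun t => ae Om mu (fun s => R s t)) ->
  ae Om mu (fun s => ae Om' mu' (fun t => R s t)).
Proof.
intros HE' Hi H.
assert (HB : lam Om' (fun t => sep Om (fun s => R s t)) ∈ Adm Om' EE' (pow Om)).
{ apply (@adm_lam _ _ _ Om' EE' (pow Om) E'); auto; [dfn| |].
  - intros t t' Ht Ht' Hp; apply ext; intros s; insep; now rewrite (Hi t t').
  - intros t Ht; rewrite in_pow; intros s; insep; tauto. }
destruct (sy_const SQ HsO HB) as [B [HBO HBc]].
assert (HBc' : ae Om' mu' (fun t => sep Om (fun s => R s t) = B)).
{ refine (ae_mono SQ HBc _); try dfn; intros t Ht; now rewrite app_lam by (assumption || dfn). }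
destruct (ae_ex Hw SQ (ae_and SQ H HBc')) as [t0 [Ht0 [H1 H2]]].
unfold ae in H1; rewrite H2 in H1.
assert (HBm : ae Om mu (fun s => s ∈ B)).
{ unfold ae; replace (sep Om (fun s => s ∈ B)) with B; auto.
  apply ext; intros z; insep; rewrite in_pow in HBO; intuition. }
refine (ae_mono SP HBm _); try dfn; intros s Hs HsB.
refine (ae_mono SQ HBc' _); try dfn; intros t Ht Et.
rewrite <- Et in HsB; insep in HsB; tauto.
Qed.

Lemma hstar_lt g : g ∈ Adm Om' EE' x -> ae Om mu (fun s => app (hstar g) s ∈ app f s).
Proof.
intros Hg; destruct (Adm_inv Hg) as [E' [HE' Hi']].
assert (H : ae Om mu (fun s => ae Om' mu' (fun t => app (app K (app g t)) s ∈ app f s))).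
{ apply (@ae_swap (fun s t => app (app K (app g t)) s ∈ app f s) _ E' HE').
  - intros t t' Ht Ht' Hp s; now rewrite (Hi' t t').
  - apply (ae_all SQ); [dfn|]; intros t Ht; apply HK, (Adm_app Hg Ht). }
refine (ae_mono SP (ae_and SP H Hfix) _); try dfn.
intros s Hs [H1 H2]; rewrite hstar_app by assumption; unfold fixes in H2; rewrite <- H2.
apply (rho_mem Hw SQ); [apply (adm_const SQ), (Adm_app Hf Hs)|now apply slice_adm|].
refine (ae_mono SQ H1 _); try dfn; intros t Ht H3.
rewrite slice_app, app_lam by (assumption || dfn); exact H3.
Qed.

Lemma hstar_mono g1 g2 : g1 ∈ Adm Om' EE' x -> g2 ∈ Adm Om' EE' x ->
  ae Om' mu' (fun t => app g1 t ∈ app g2 t) ->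
  ae Om mu (fun s => app (hstar g1) s ∈ app (hstar g2) s).
Proof.
intros Hg1 Hg2 H; destruct (Adm_inv2 SQ Hg1 Hg2) as [E' [HE' [Hi1 Hi2]]].
assert (H1 : ae Om mu (fun s => ae Om' mu'
  (fun t => app (app K (app g1 t)) s ∈ app (app K (app g2 t)) s))).
{ apply (@ae_swap (fun s t => app (app K (app g1 t)) s ∈ app (app K (app g2 t)) s) _ E' HE').
  - intros t t' Ht Ht' Hp s; now rewrite (Hi1 t t'), (Hi2 t t').
  - refine (ae_mono SQ H _); try dfn; intros t Ht Hlt.
    destruct (HK (Adm_app Hg1 Ht)) as [A1 [_ E1]], (HK (Adm_app Hg2 Ht)) as [A2 [_ E2]].
    apply (rho_mem_iff Hw SP (proj1 Hk) A2 A1); congruence. }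
refine (ae_mono SP H1 _); try dfn; intros s Hs H2; rewrite !hstar_app by assumption.
apply (rho_mem Hw SQ); try now apply slice_adm.
refine (ae_mono SQ H2 _); try dfn; intros t Ht; now rewrite !slice_app.
Qed.

Lemma rQ_le g : g ∈ Adm Om' EE' x -> subset (rQ g) (rP (hstar g)).
Proof.
assert (Hxs : subset x k) by exact (proj1 Hk x Hxk).
revert g; apply (@wf_ind _ _ (fun g f => ae Om' mu' (fun s => app g s ∈ app f s)) (Adm Om' EE' x)
  (fun g => subset (rQ g) (rP (hstar g))) _ (mu_wf Hw SQ (N := x))).
intros g Hg IH z Hz; apply (in_rho Hw SQ _ (Adm_sub Hxs Hg)) in Hz.
destruct Hz as [g' [Hg' [Hlt ->]]].
assert (Hx' : ae Om' mu' (fun t => app g' t ∈ x)).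
{ refine (ae_mono SQ Hlt _); try dfn; intros t Ht H.
  exact (ord_trans (ord_elem Hk Hxk) (Adm_app Hg Ht) H). }
destruct (adm_modify Hw SQ Hg' Hx') as [h [Hh Hgh]].
assert (Hlt' : ae Om' mu' (fun t => app h t ∈ app g t)).
{ refine (ae_mono SQ (ae_and SQ Hlt Hgh) _); try dfn; intros t Ht [H <-]; exact H. }
rewrite (rho_eq_ae Hw SQ Hg' (Adm_sub Hxs Hh) Hgh).
apply (@ord_le_lt _ _ _ (rP (hstar h))).
- apply (rk_ord Hw SP Hk), hstar_adm, Hg.
- now apply IH.
- apply (rk_ord Hw SQ Hk (Adm_sub Hxs Hh)).
- apply (rho_mem Hw SP); try now apply hstar_adm.
  now apply hstar_mono.
Qed.

Lemma step_aux : fixes Om' mu' EE' x.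
Proof.
assert (Hxs : subset x k) by exact (proj1 Hk x Hxk).
apply ext; intros z; split.
- intros Hz; apply (in_rho Hw SQ _ (adm_const SQ Hxk)) in Hz.
  destruct Hz as [g' [Hg' [Hlt ->]]].
  assert (Hx' : ae Om' mu' (fun t => app g' t ∈ x)).
  { refine (ae_mono SQ Hlt _); try dfn; intros t Ht; now rewrite app_lam by (assumption || dfn). }
  destruct (adm_modify Hw SQ Hg' Hx') as [h [Hh Hgh]].
  rewrite (rho_eq_ae Hw SQ Hg' (Adm_sub Hxs Hh) Hgh).
  apply (@ord_le_lt _ _ _ (rP (hstar h))).
  + exact (ord_elem Hk Hxk).
  + now apply rQ_le.
  + apply (rk_ord Hw SQ Hk (Adm_sub Hxs Hh)).
  + rewrite <- Hfx; apply (rho_mem Hw SP Hf); [now apply hstar_adm|now apply hstar_lt].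
- apply (rk_ge Hw SQ Hk Hxk).
Qed.

End Step.

(** The first system is small for the second embedding, which should therefore send the class of [f]
    to the class of the function of images of the values [f s], almost all of which are fixed. Only
    the upper bound has to be derived, by comparing order types through [hstar]; no embedding moves
    an ordinal down. *)
Lemma kunen_step d Om mu EE d' Om' mu' EE' f :
  good_sys d Om mu EE -> good_sys d' Om' mu' EE' ->
  small d' (pow Om) -> small d' EE -> f ∈ Adm Om EE k ->
  ae Om mu (fun s => fixes Om' mu' EE' (app f s)) ->
  fixes Om' mu' EE' (app (rho Om mu EE k) f).
Proof.
intros HP HQ HsO HsE Hf Hfix; set (x := app (rho Om mu EE k) f).
destruct (@choice_fun _ _ x (fun a h => h ∈ Adm Om EE k /\
  ae Om mu (fun s => app h s ∈ app f s) /\ app (rho Om mu EE k) h = a) _) as [K [_ HK]].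
{ intros a Ha; apply (in_rho Hw (proj1 HP) _ Hf) in Ha; destruct Ha as [h [H1 [H2 ->]]]; eauto. }
destruct (@choice_fun _ _ x (fun a E => E ∈ EE /\ forall s s', s ∈ Om -> s' ∈ Om ->
  pair s s' ∈ E -> app (app K a) s = app (app K a) s') _) as [e [_ He]].
{ intros a Ha; destruct (HK a Ha) as [H _]; exact (Adm_inv H). }
exact (@step_aux d Om mu EE d' Om' mu' EE' HP HQ HsO HsE f x Hf eq_refl Hfix K e HK He).
Qed.

Section Kunen.
Variables (dd OO MM EE : V -> V).
Context {DOO : DF1 OO} {DMM : DF1 MM} {DEE : DF1 EE}.
Hypothesis Hgood : forall n, n ∈ w -> good_sys (dd n) (OO n) (MM n) (EE n).
Hypothesis HsO : forall m n, n ∈ w -> m ∈ n -> small (dd n) (pow (OO m)).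
Hypothesis HsE : forall m n, n ∈ w -> m ∈ n -> small (dd n) (EE m).
Hypothesis Hsw : forall n, n ∈ w -> small (dd n) w.

(** If the embedding [m] moves [x], then [x] is below its image and hence the class of a function
    [f] with values below [x]. By induction these values are fixed from some index on, and
    [kunen_step] transfers this to [x]. *)
Lemma fixed_by_almost_all a : a ∈ k -> exists N, N ∈ w /\ forall n, n ∈ w -> subset N n ->
  fixes (OO n) (MM n) (EE n) a.
Proof.
revert a; apply (@trans_ind _ _ (fun a => exists N, N ∈ w /\ forall n, n ∈ w -> subset N n ->
  fixes (OO n) (MM n) (EE n) a) _ k (proj1 Hk)).
intros x Hx IH.
destruct (classic (forall n, n ∈ w -> fixes (OO n) (MM n) (EE n) x)) as [H|H].
{ exists emp; split; [now apply omega_emp|auto]. }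
assert (Hn0 : exists n, n ∈ w /\ ~ fixes (OO n) (MM n) (EE n) x).
{ apply NNPP; intros N1; apply H; intros n Hn; apply NNPP; eauto. }
destruct Hn0 as [m [Hm Hnf]]; clear H.
destruct (Hgood Hm) as [SP [HbP HzP]].
pose proof (adm_const SP Hx) as Hkx.
assert (Hlt : x ∈ app (rho (OO m) (MM m) (EE m) k) (lam (OO m) (fun _ => x))).
{ pose proof (rk_ge Hw SP Hk Hx) as Hge.
  apply (ord_le (ord_elem Hk Hx) (rk_ord Hw SP Hk Hkx)) in Hge; destruct Hge as [H|H]; auto.
  now destruct Hnf. }
apply (in_rho Hw SP _ Hkx) in Hlt; destruct Hlt as [f0 [Hf0 [Hf0x Ex]]].
assert (Hf0x' : ae (OO m) (MM m) (fun s => app f0 s ∈ x)).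
{ refine (ae_mono SP Hf0x _); try dfn; intros t Ht; now rewrite app_lam by (assumption || dfn). }
destruct (adm_modify Hw SP Hf0 Hf0x') as [f [Hf Hff]].
pose proof (Adm_sub (proj1 Hk x Hx) Hf) as Hfk.
rewrite (rho_eq_ae Hw SP Hf0 Hfk Hff) in Ex.
destruct (@choice_fun _ _ x (fun a N => N ∈ w /\ forall n, n ∈ w -> subset N n ->
  fixes (OO n) (MM n) (EE n) a) _ IH) as [F [_ HF]].
destruct (Adm_inv Hf) as [E [HE Hi]].
(* The index from which [app f s] is fixed takes values in omega, a small set, so one index [N1]
   serves almost all [s]. *)
assert (HFA : lam (OO m) (fun s => app F (app f s)) ∈ Adm (OO m) (EE m) w).
{ apply (@adm_lam _ _ _ _ _ _ E); auto; [dfn| |].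
  - intros t t' Ht Ht' Hp; now rewrite (Hi t t').
  - intros t Ht; apply HF, (Adm_app Hf Ht). }
destruct (sy_const SP (Hsw Hm) HFA) as [N1 [HN1 HN1c]].
(* The bound also has to exceed [m], since the system [m] is small only for the measurable cardinals
   of later systems. *)
assert (HN : exists N, N ∈ w /\ subset N1 N /\ m ∈ N).
{ destruct (ord_tri (ord_elem (omega_ord Hw) HN1) (ord_elem (omega_ord Hw) Hm)) as [H|[H|H]].
  - exists (succ m); split; [now apply omega_succ|rewrite in_succ; split; auto].
    intros z Hz; rewrite in_succ; left; exact (ord_trans (ord_elem (omega_ord Hw) Hm) H Hz).
  - subst N1; exists (succ m); split; [now apply omega_succ|rewrite in_succ; split; auto].
    intros z Hz; rewrite in_succ; auto.
  - exists N1; split; auto; split; auto; now intros z. }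
destruct HN as [N [HNw [HN1N HmN]]]; exists N; split; [assumption|].
intros n Hn HNn; rewrite Ex.
apply (kunen_step (Hgood Hm) (Hgood Hn)); auto.
refine (ae_mono SP HN1c _); try dfn.
intros s Hs; rewrite app_lam by (assumption || dfn); intros Es.
apply (HF _ (Adm_app Hf Hs)); auto; rewrite Es; intros z Hz; auto.
Qed.

End Kunen.
End KunenStep.

(** * Iterated ultrapowers *)

Section Iterated.
Context {V : set_structure} {HZ : ZFCm V} {HPow : Powm V}.

(** A set of ordinals is finite iff all its nonempty subsets have a maximum. *)
Definition fin (e : V) : Prop := forall S, subset S e -> (exists x, x ∈ S) ->
  exists m, m ∈ S /\ forall y, y ∈ S -> y ∈ m \/ y = m.

Definition incr (e H s : V) : Prop := (forall i, i ∈ e -> app s i ∈ H) /\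
  forall i j, i ∈ e -> j ∈ e -> i ∈ j -> app s i ∈ app s j.

#[global] Instance DP1_fin : DP1 fin.
Proof. unfold fin; dfn. Qed.
#[global] Instance DP3_incr : DP3 incr.
Proof. unfold incr; dfn. Qed.

(** The iterated ultrapower of length [a] by a normal measure [u] on [d] is presented as the
    ultrapower by functions on [a -> d] depending on finitely many coordinates. *)
Definition it_space (d a : V) : V := funs a d.
(** For a normal measure, the finite product measures are generated by the increasing sequences
    through sets of the measure. This gives the limit measure without recursion along [a]. *)
Definition it_filter (d u a : V) : V := sep (pow (it_space d a)) (fun B => exists e, subset e a /\ fin e /\
  exists H, H ∈ u /\ forall s, s ∈ it_space d a -> incr e H s -> s ∈ B).
Definition agree (d a e : V) : V := sep (prod (it_space d a) (it_space d a)) (fun p => exists s s',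
  p = pair s s' /\ forall i, i ∈ e -> app s i = app s' i).
Definition it_supports (d a : V) : V := repl (sep (pow a) fin) (fun e => agree d a e).

#[global] Instance DF2_it_space : DF2 it_space.
Proof. unfold it_space; dfn. Qed.
#[global] Instance DF3_it_filter : DF3 it_filter.
Proof. unfold it_filter; dfn. Qed.
#[global] Instance DF3_agree : DF3 agree.
Proof. unfold agree; dfn. Qed.
#[global] Instance DF2_it_supports : DF2 it_supports.
Proof. unfold it_supports; dfn. Qed.

Section Fixed.
Variables (w d u a : V).
Hypothesis Hw : is_omega w.
Hypothesis Hwd : w ∈ d.
Hypothesis Hn : is_normal_measure d u.
Hypothesis Ha : ordinal a.
Let Hm := proj1 Hn.
Let Hd := meas_ord Hm.
Let Hu := proj1 (proj2 Hm).
Let Hnp := proj1 (proj2 (proj2 Hm)).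
Let Hc := proj2 (proj2 (proj2 Hm)).
Notation Om := (it_space d a).

Lemma in_it_filter B : B ∈ it_filter d u a <-> subset B Om /\ exists e, subset e a /\ fin e /\
  exists H, H ∈ u /\ forall s, s ∈ it_space d a -> incr e H s -> s ∈ B.
Proof. unfold it_filter; insep; now rewrite in_pow. Qed.

Lemma in_agree e s s' : pair s s' ∈ agree d a e <->
  s ∈ Om /\ s' ∈ Om /\ forall i, i ∈ e -> app s i = app s' i.
Proof.
unfold agree; insep; rewrite in_prod; split.
- intros [[x [y [Hx [Hy E1]]]] [t [t' [E2 H]]]].
  apply pair_inj in E1, E2; destruct E1, E2; subst; auto.
- intros [Hs [Hs' H]]; split; [exists s, s'; auto | exists s, s'; auto].
Qed.

Lemma in_it_supports E : E ∈ it_supports d a <-> exists e, subset e a /\ fin e /\ E = agree d a e.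
Proof.
unfold it_supports; inrepl; split; intros [e He]; exists e.
- destruct He as [He ->]; insep in He; rewrite in_pow in He; tauto.
- insep; rewrite in_pow; tauto.
Qed.

Lemma fin_emp : fin emp.
Proof. intros S HS [x Hx]; destruct (not_in_emp (HS x Hx)). Qed.

Lemma fin_sing i : fin (upair i i).
Proof.
intros S HS [x Hx]; exists x; split; auto; intros y Hy; right.
apply HS, in_sing in Hx; apply HS, in_sing in Hy; congruence.
Qed.

Lemma fin_cup e e' : subset e a -> subset e' a -> fin e -> fin e' -> fin (cup e e').
Proof.
intros Hea Hea' He He' S HS Hne.
destruct (classic (exists x, x ∈ S /\ x ∈ e)) as [H1|H1];
destruct (classic (exists x, x ∈ S /\ x ∈ e')) as [H2|H2].
- destruct (He (sep S (fun x => x ∈ e))) as [m [Hm1 Hm2]].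
  { intros z; insep; tauto. }
  { destruct H1 as [x Hx]; exists x; insep; tauto. }
  destruct (He' (sep S (fun x => x ∈ e'))) as [m' [Hm1' Hm2']].
  { intros z; insep; tauto. }
  { destruct H2 as [x Hx]; exists x; insep; tauto. }
  insep in Hm1; insep in Hm1'.
  assert (Hom : ordinal m) by (apply (ord_elem Ha), Hea; tauto).
  assert (Hom' : ordinal m') by (apply (ord_elem Ha), Hea'; tauto).
  destruct (ord_tri Hom Hom') as [H|H].
  + exists m'; split; [tauto|]; intros y Hy; pose proof (HS y Hy) as Hye.
    rewrite in_cup in Hye; destruct Hye as [Hye|Hye].
    * left; destruct (Hm2 y) as [H3| ->]; [insep; auto| |assumption].
      exact (ord_trans Hom' H H3).
    * apply Hm2'; insep; auto.
  + exists m; split; [tauto|]; intros y Hy; pose proof (HS y Hy) as Hye.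
    rewrite in_cup in Hye; destruct Hye as [Hye|Hye].
    * apply Hm2; insep; auto.
    * destruct (Hm2' y) as [H3| ->]; [insep; auto| |].
      -- destruct H as [->|H]; auto; left; exact (ord_trans Hom H H3).
      -- destruct H as [->|H]; auto.
- apply He; auto; intros y Hy; pose proof (HS y Hy) as Hye.
  rewrite in_cup in Hye; destruct Hye; auto; destruct H2; eauto.
- apply He'; auto; intros y Hy; pose proof (HS y Hy) as Hye.
  rewrite in_cup in Hye; destruct Hye; auto; destruct H1; eauto.
- destruct Hne as [x Hx]; pose proof (HS x Hx) as H; rewrite in_cup in H; exfalso.
  destruct H; [apply H1|apply H2]; eauto.
Qed.

Lemma cup_sub e e' : subset e a -> subset e' a -> subset (cup e e') a.
Proof. intros H1 H2 z; rewrite in_cup; intros [Hz|Hz]; auto. Qed.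

Lemma it_space_ne : exists s, s ∈ Om.
Proof.
exists (lam a (fun _ => w)); unfold it_space; apply lam_funs; [dfn|auto].
Qed.

Definition homogeneous (C e : V) : Prop := forall f, f ∈ funs Om C ->
  (forall s s', s ∈ Om -> s' ∈ Om -> (forall i, i ∈ e -> app s i = app s' i) -> app f s = app f s') ->
  exists c H, c ∈ C /\ H ∈ u /\ forall s, s ∈ Om -> incr e H s -> app f s = c.

Instance DP2_homogeneous : DP2 homogeneous.
Proof. unfold homogeneous; dfn. Qed.

Definition upd (s i t : V) : V :=
  lam a (fun j => iota (fun v => (j = i /\ v = t) \/ (j <> i /\ v = app s j))).

Instance DF3_upd : DF3 upd.
Proof. unfold upd; dfn. Qed.

Lemma upd_same s i t : i ∈ a -> app (upd s i t) i = t.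
Proof.
intros Hi; unfold upd; rewrite app_lam by (assumption || dfn).
apply iota_eq; [auto|intuition].
Qed.

Lemma upd_other s i t j : j ∈ a -> j <> i -> app (upd s i t) j = app s j.
Proof.
intros Hj Hji; unfold upd; rewrite app_lam by (assumption || dfn).
apply iota_eq; [auto|intuition].
Qed.

Lemma upd_in s i t : s ∈ Om -> t ∈ d -> upd s i t ∈ Om.
Proof.
intros Hs Ht; unfold it_space; apply in_funs, maps_iff; split; [unfold upd; apply lam_fun; dfn|].
intros j Hj; destruct (classic (j = i)) as [->|Hji].
- now rewrite upd_same.
- rewrite upd_other by assumption; exact (funs_app Hs Hj).
Qed.

Lemma upd_id s i : s ∈ Om -> upd s i (app s i) = s.
Proof.
intros Hs; apply (@fun_ext _ _ _ _ a); [unfold upd; apply lam_fun; dfn|exact (funs_fun Hs)|].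
intros j Hj; destruct (classic (j = i)) as [->|Hji]; [now rewrite upd_same|now rewrite upd_other].
Qed.

Lemma homogeneous_emp C : homogeneous C emp.
Proof.
intros f Hf Hi; destruct it_space_ne as [s0 Hs0]; exists (app f s0), d; split; [|split].
- exact (funs_app Hf Hs0).
- apply Hu.
- intros s Hs _; apply Hi; auto; intros i Hie; destruct (not_in_emp Hie).
Qed.

(** Adding a new least coordinate: fix its value, homogenize the remaining function,
    and take the diagonal intersection of the homogeneous sets. *)
Lemma homogeneous_step C e i : small d C -> subset e a -> i ∈ a -> (forall j, j ∈ e -> i ∈ j) ->
  homogeneous C e -> homogeneous C (cup (upair i i) e).
Proof.
intros HC Hea Hia Hie HR f Hf Hinv.
assert (Hin : forall j, j ∈ cup (upair i i) e <-> j = i \/ j ∈ e).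
{ intros j; rewrite in_cup, in_sing; tauto. }
destruct (@choice_fun _ _ d (fun t H => H ∈ u /\ exists c, c ∈ C /\
  forall s, s ∈ Om -> incr e H s -> app f (upd s i t) = c) _) as [HH [_ HHr]].
{ intros t Ht; destruct (HR (lam Om (fun s => app f (upd s i t)))) as [c [H [Hcc [HHu Hs]]]].
  - apply lam_funs; [dfn|]; intros s Hs; apply (funs_app Hf), upd_in; auto.
  - intros s s' Hs Hs' Hag; rewrite !app_lam by (assumption || dfn).
    apply Hinv; try now apply upd_in.
    intros j Hj; apply Hin in Hj; destruct Hj as [->|Hj]; [now rewrite !upd_same|].
    assert (j <> i) by (intros ->; destruct (irrefl (Hie _ Hj))).
    rewrite !upd_other; auto.
  - exists H; split; auto; exists c; split; auto; intros s Hs1 Hs2.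
    rewrite <- (Hs s Hs1 Hs2); now rewrite app_lam by (assumption || dfn). }
destruct (@choice_fun _ _ d (fun t c => c ∈ C /\
  forall s, s ∈ Om -> incr e (app HH t) s -> app f (upd s i t) = c) _) as [cc [_ Hcc]].
{ intros t Ht; destruct (HHr t Ht) as [_ H]; exact H. }
destruct (@meas_const _ _ d u Hm C (fun t => app cc t) _ HC) as [c [HcC Hcu]].
{ intros t Ht; now apply Hcc. }
pose proof (proj2 Hn HH (fun t Ht => proj1 (HHr t Ht))) as HD.
exists c, (sep d (fun b => (forall t, t ∈ b -> b ∈ app HH t) /\ app cc b = c)).
split; [assumption|split].
{ apply (@uf_and _ _ d _ Hu); auto; dfn. }
intros s Hs [Hs1 Hs2].
assert (Hi : i ∈ cup (upair i i) e) by (apply Hin; auto).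
pose proof (Hs1 i Hi) as Hsi; insep in Hsi; destruct Hsi as [Hsd [_ Hsc]].
rewrite <- (upd_id i Hs) at 1.
destruct (Hcc _ Hsd) as [_ H]; rewrite (H s Hs), Hsc; auto.
split.
- intros j Hj; assert (Hj' : j ∈ cup (upair i i) e) by (apply Hin; auto).
  pose proof (Hs1 j Hj') as Hsj; insep in Hsj; apply (proj1 (proj2 Hsj)).
  apply Hs2; auto.
- intros j j' Hj Hj'; apply Hs2; apply Hin; auto.
Qed.

(** [homogeneous_step] adds a coordinate below those already treated, so [e] is exhausted from its
    maximum downwards. *)
Lemma rowbottom C e : small d C -> subset e a -> fin e -> homogeneous C e.
Proof.
intros HC Hea He.
assert (Ho : forall j, j ∈ e -> ordinal j) by (intros j Hj; exact (ord_elem Ha (Hea j Hj))).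
assert (Htail : forall i, i ∈ e -> homogeneous C (sep e (fun j => j = i \/ i ∈ j))).
{ intros i Hi; apply NNPP; intros N.
  (* Downward induction: [fin] provides the largest [m] whose tail of [e] is a counterexample. The
     next larger element [l] of [e], if there is one, has a homogeneous tail. *)
  destruct (He (sep e (fun i => ~ homogeneous C (sep e (fun j => j = i \/ i ∈ j))))) as [m [Hm1 Hmax]].
  { intros z; insep; tauto. }
  { exists i; insep; auto. }
  insep in Hm1; destruct Hm1 as [Hme Hmn]; apply Hmn.
  replace (sep e (fun j => j = m \/ m ∈ j)) with (cup (upair m m) (sep e (fun j => m ∈ j))).
  2: { apply ext; intros z; rewrite in_cup, in_sing; insep; intuition congruence. }
  apply homogeneous_step; auto.
  { intros z; insep; intros [Hz _]; auto. }
  { intros j; insep; tauto. }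
  destruct (classic (exists j, j ∈ e /\ m ∈ j)) as [Hex|Hno].
  - destruct (@fnd _ _ (fun j => m ∈ j) _ e Hex) as [l [Hl [Hml Hmin]]].
    replace (sep e (fun j => m ∈ j)) with (sep e (fun j => j = l \/ l ∈ j)).
    + apply NNPP; intros N2; destruct (Hmax l) as [H|H]; [insep; auto| |].
      * exact (asym Hml H).
      * subst l; exact (irrefl Hml).
    + apply ext; intros z; insep; split; intros [Hz H]; (split; [assumption|]).
      * destruct H as [->|H]; auto; exact (ord_trans (Ho z Hz) H Hml).
      * destruct (ord_tri (Ho z Hz) (Ho l Hl)) as [H1|[H1|H1]]; auto.
        destruct (Hmin z H1 Hz H).
  - replace (sep e (fun j => m ∈ j)) with emp; [apply homogeneous_emp|].
    symmetry; apply is_empty_eq; intros z; insep; intros Hz; eauto. }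
destruct (classic (exists x, x ∈ e)) as [Hne|Hem].
- destruct (@fnd _ _ (fun _ => True) _ e) as [l [Hl [_ Hmin]]].
  { destruct Hne as [x Hx]; eauto. }
  replace e with (sep e (fun j => j = l \/ l ∈ j)); [now apply Htail|].
  apply ext; intros z; insep; split; [tauto|]; intros Hz; split; auto.
  destruct (ord_tri (Ho z Hz) (Ho l Hl)) as [H1|[H1|H1]]; auto.
  destruct (Hmin z H1 Hz I).
- replace e with emp; [apply homogeneous_emp|].
  symmetry; apply is_empty_eq; intros z Hz; eauto.
Qed.

(** Countably many finite supports can be realized simultaneously by one sequence through a
    measure one set, hence the iterated ultrapower is well-founded. *)
Lemma it_ccc B : (forall n, n ∈ w -> app B n ∈ it_filter d u a) ->
  exists s, s ∈ Om /\ forall n, n ∈ w -> s ∈ app B n.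
Proof.
intros HB.
destruct (@choice_fun _ _ w (fun n e => subset e a /\ fin e /\ exists H, H ∈ u /\
  forall s, s ∈ it_space d a -> incr e H s -> s ∈ app B n) _) as [e [_ He]].
{ intros n Hnw; exact (proj2 (proj1 (in_it_filter _) (HB n Hnw))). }
destruct (@choice_fun _ _ w (fun n H => H ∈ u /\
  forall s, s ∈ it_space d a -> incr (app e n) H s -> s ∈ app B n) _) as [HH [_ HHr]].
{ intros n Hnw; exact (proj2 (proj2 (He n Hnw))). }
(* Admissible values at [i]: in all the measure one sets, and above the values at those [j] below
   [i] that belong to some support. The sequence takes the least one. *)
pose (Ok := fun i r t => (forall n, n ∈ w -> t ∈ app HH n) /\ t ∈ d /\
  forall n j, n ∈ w -> j ∈ app e n -> j ∈ i -> app r j ∈ t).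
assert (DOk : DP3 Ok) by (unfold Ok; dfn).
pose (G := fun i r => iota (fun t => Ok i r t /\ forall t', t' ∈ t -> ~ Ok i r t')).
assert (DG : DF2 G) by (unfold G; dfn).
destruct (@wf_rec _ _ (fun x y => x ∈ y) a G _ _) as [s [Hs Hsr]].
{ intros S HS [x Hx]; destruct (@fnd _ _ (fun _ => True) _ S) as [b [Hb [_ Hmin]]]; [eauto|].
  exists b; split; auto; intros y Hy Hyb; exact (Hmin y Hyb Hy I). }
assert (Hu' : forall n, n ∈ w -> sep d (fun t => t ∈ app HH n) ∈ u).
{ intros n Hnw; destruct (HHr n Hnw) as [H _].
  replace (sep d (fun t => t ∈ app HH n)) with (app HH n); auto.
  apply ext; intros z; insep; split; [|tauto]; intros Hz; split; auto.
  exact (proj1 Hu _ H z Hz). }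
assert (HOk : forall i, i ∈ a -> Ok i s (app s i)).
{ apply (@trans_ind _ _ (fun i => Ok i s (app s i)) _ a (proj1 Ha)).
  intros i Hi IH.
  assert (Hloc : forall t, Ok i (lam (sep a (fun y => y ∈ i)) (fun y => app s y)) t <-> Ok i s t).
  { intros t; unfold Ok; split; intros [H1 [H2 H3]]; (split; [assumption|split; [assumption|]]);
      intros n j Hnw Hj Hji; specialize (H3 n j Hnw Hj Hji).
    - rewrite app_lam in H3; [assumption|dfn|insep].
      split; auto; exact (ord_trans Ha Hi Hji).
    - rewrite app_lam; [assumption|dfn|insep].
      split; auto; exact (ord_trans Ha Hi Hji). }
  (* The part of the support [app e n] below [i] is empty or has a maximum [m]. As the sequence
     increases along the support, it suffices to exceed its value at [m]. *)
  assert (Hbnd : forall n, n ∈ w -> sep d (fun t => t ∈ app HH n /\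
    forall j, j ∈ app e n -> j ∈ i -> app s j ∈ t) ∈ u).
  { intros n Hnw; apply (@uf_and _ _ d _ Hu); try dfn; auto.
    destruct (classic (exists j, j ∈ app e n /\ j ∈ i)) as [Hex|Hno].
    - destruct (proj1 (proj2 (He n Hnw)) (sep (app e n) (fun j => j ∈ i))) as [m [Hm1 Hmax]].
      { intros z; insep; tauto. }
      { destruct Hex as [j Hj]; exists j; insep; auto. }
      insep in Hm1; destruct Hm1 as [Hme Hmi].
      destruct (IH m Hmi) as [_ [Hmd Hmlt]].
      refine (@uf_mono _ _ d _ Hu _ _ _ _ (@uf_final _ _ d _ Hu Hnp Hc Hd _ Hmd) _); try dfn.
      intros t Ht Hmt j Hj Hji; destruct (Hmax j) as [H| ->]; [insep; auto| |assumption].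
      exact (ord_trans (ord_elem Hd Ht) Hmt (Hmlt n j Hnw Hj H)).
    - apply (@uf_all _ _ d _ Hu); [dfn|]; intros t Ht j Hj Hji; destruct Hno; eauto. }
  pose proof (@uf_inter _ _ d _ Hc w (fun n t => t ∈ app HH n /\
    forall j, j ∈ app e n -> j ∈ i -> app s j ∈ t) _ Hwd Hbnd) as HI.
  destruct (@uf_ex _ _ d _ Hu _ _ HI) as [t [Ht Hti]].
  assert (Hok : Ok i s t).
  { split; [|split]; auto; [intros n Hnw; now apply Hti|].
    intros n j Hnw Hj Hji; now apply (proj2 (Hti n Hnw)). }
  destruct (@ord_min _ _ (fun t => Ok i s t) _ t (ord_elem Hd Ht) Hok) as [b [Hb [Hbok Hbmin]]].
  enough (E : app s i = b) by (rewrite E; exact Hbok).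
  rewrite (Hsr i Hi); unfold G; apply iota_eq.
  - split; [now apply Hloc|]; intros t' Ht' H; apply (Hbmin t' Ht'); now apply Hloc.
  - intros z [Hz Hzmin]; apply Hloc in Hz.
    destruct (ord_tri (ord_elem Hd (proj1 (proj2 Hz))) Hb) as [H1|[H1|H1]]; auto.
    + destruct (Hbmin z H1 Hz).
    + destruct (Hzmin b H1); now apply Hloc. }
exists s.
assert (HsO : s ∈ Om).
{ unfold it_space; apply in_funs, maps_iff; split; auto; intros i Hi; apply HOk; auto. }
split; [assumption|]; intros n Hnw; apply (proj2 (HHr n Hnw)); auto.
pose proof (proj1 (He n Hnw)) as Hen; split.
- intros i Hi; apply (HOk i); auto.
- intros i j Hi Hj Hij; apply (HOk j) with n; auto.
Qed.

Lemma it_filter_intro (P : V -> Prop) {HP : DP1 P} e H : subset e a -> fin e -> H ∈ u ->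
  (forall s, s ∈ Om -> incr e H s -> P s) -> ae Om (it_filter d u a) P.
Proof.
intros He1 He2 HH HPs; apply in_it_filter; split; [intros z; insep; tauto|].
exists e; split; auto; split; auto; exists H; split; auto; intros s Hs Hi; insep; auto.
Qed.

Lemma it_sys : Sys w d Om (it_filter d u a) (it_supports d a).
Proof.
split.
- intros B C HB HBC HC; rewrite in_it_filter in *; split; auto.
  destruct HB as [_ [e [He1 [He2 [H [HH Hs]]]]]]; exists e; split; auto; split; auto.
  exists H; split; auto.
- apply in_it_filter; split; [now intros z|]; exists emp; split; [|split; [exact fin_emp|]].
  + intros z Hz; destruct (not_in_emp Hz).
  + exists d; split; [apply Hu|auto].
- intros B C I HB HC HI; rewrite in_it_filter in *.
  destruct HB as [HBO [e [He1 [He2 [H [HH Hs]]]]]], HC as [HCO [e' [He1' [He2' [H' [HH' Hs']]]]]].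
  split; [intros z Hz; apply HBO; now apply HI|].
  exists (cup e e'); split; [now apply cup_sub|split; [now apply fin_cup|]].
  exists (sep d (fun t => t ∈ H /\ t ∈ H')); split.
  + apply (proj1 (proj2 (proj2 Hu)) _ _ _ HH HH'); intros z; insep; split; [tauto|].
    intros Hz; split; auto; exact (proj1 Hu _ HH z (proj1 Hz)).
  + intros s Hso [H1 H2]; apply HI; split; [apply Hs|apply Hs']; auto; split.
    * intros i Hi; specialize (H1 i); insep in H1; apply H1; rewrite in_cup; auto.
    * intros i j Hi Hj; apply H2; rewrite in_cup; auto.
    * intros i Hi; specialize (H1 i); insep in H1; apply H1; rewrite in_cup; auto.
    * intros i j Hi Hj; apply H2; rewrite in_cup; auto.
- intros E1 E2 HE1 HE2; rewrite in_it_supports in HE1, HE2.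
  destruct HE1 as [e1 [H1 [F1 ->]]], HE2 as [e2 [H2 [F2 ->]]].
  exists (agree d a (cup e1 e2)); split; [|split].
  + apply in_it_supports; exists (cup e1 e2); split; [now apply cup_sub|split; [now apply fin_cup|auto]].
  + intros p; unfold agree; insep; intros [Hp [s [s' [-> H]]]]; split; auto.
    exists s, s'; split; auto; intros i Hi; apply H; rewrite in_cup; auto.
  + intros p; unfold agree; insep; intros [Hp [s [s' [-> H]]]]; split; auto.
    exists s, s'; split; auto; intros i Hi; apply H; rewrite in_cup; auto.
- exists (agree d a emp); apply in_it_supports; exists emp; split; [|split; [exact fin_emp|auto]].
  intros z Hz; destruct (not_in_emp Hz).
- apply small_sub with (succ (succ emp)).
  + apply small_ord, (ord_trans Hd Hwd); auto using omega_succ, omega_emp.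
  + intros z; rewrite in_upair, !in_succ; intros [-> | ->]; auto.
    right; apply ext; intros z; rewrite in_sing, in_succ.
    split; auto; intros [Hz|Hz]; auto; destruct (not_in_emp Hz).
- intros C f HC Hf; rewrite in_Adm in Hf; destruct Hf as [Hf [E [HE Hi]]].
  apply in_it_supports in HE; destruct HE as [e [He1 [He2 ->]]].
  destruct (@rowbottom C e HC He1 He2 f Hf) as [c [H [Hcc [HH Hs]]]].
  + intros s s' Hs Hs' Hag; apply Hi; auto; apply in_agree; auto.
  + exists c; split; auto; now apply it_filter_intro with e H; try dfn.
- exact it_ccc.
Qed.

Lemma it_small d' v : is_measure d' v -> d ∈ d' -> a ∈ d' ->
  small d' Om /\ small d' (pow Om) /\ small d' (it_supports d a).
Proof.
intros Hm' Hdd Had.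
assert (small d' Om).
{ unfold it_space; apply (small_funs Hm'); apply small_ord; assumption. }
split; [assumption|split; [apply (small_pow Hm'); assumption|]].
unfold it_supports; apply small_repl; [dfn|]; apply small_sub with (pow a).
- apply (small_pow Hm'); apply small_ord; assumption.
- intros z; insep; tauto.
Qed.

Lemma coord_adm N i : subset d N -> i ∈ a -> lam Om (fun s => app s i) ∈ Adm Om (it_supports d a) N.
Proof.
intros HN Hi; apply (@adm_lam _ _ _ Om (it_supports d a) N (agree d a (upair i i))).
- dfn.
- apply in_it_supports; exists (upair i i); split; [|split; [apply fin_sing|auto]].
  intros z; rewrite in_sing; now intros ->.
- intros s s' Hs Hs'; rewrite in_agree; intros [_ [_ H]]; apply H; now apply in_sing.
- intros s Hs; apply HN; exact (funs_app Hs Hi).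
Qed.

Lemma coord_lt i j : i ∈ a -> j ∈ a -> i ∈ j -> ae Om (it_filter d u a) (fun s => app s i ∈ app s j).
Proof.
intros Hi Hj Hij; apply it_filter_intro with (cup (upair i i) (upair j j)) d; [dfn| | | |].
- apply cup_sub; intros z; rewrite in_sing; now intros ->.
- apply fin_cup; try apply fin_sing; intros z; rewrite in_sing; now intros ->.
- apply Hu.
- intros s Hs [_ H]; apply H; auto; rewrite in_cup, !in_sing; auto.
Qed.

End Fixed.
End Iterated.

(** * Members of [A] moved by the embeddings *)

Section Kappa.
Context {V : set_structure} {HZ : ZFCm V} {HPow : Powm V}.
Variables (w k : V).
Hypothesis Hw : is_omega w.
Hypothesis Hk : ordinal k.
Hypothesis Hlim : forall b, b ∈ k -> exists e v, e ∈ k /\ b ∈ e /\ is_measure e v.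

Lemma omega_unique w' : is_omega w' -> w = w'.
Proof.
intros Hw'; destruct (ord_tri (omega_ord Hw) (omega_ord Hw')) as [H|[H|H]]; auto; exfalso.
- exact (proj2 Hw' w H (proj1 Hw)).
- exact (proj2 Hw w' H (proj1 Hw')).
Qed.

Lemma meas_omega d v : is_measure d v -> w ∈ d.
Proof.
intros Hm; destruct (proj2 (proj1 Hm)) as [w' [Hw' H]]; now rewrite (omega_unique Hw').
Qed.

Lemma k_succ b : b ∈ k -> succ b ∈ k.
Proof.
intros Hb; destruct (Hlim Hb) as [e [v [He [Hbe Hm]]]].
apply (@ord_le_lt _ _ _ e); auto.
- intros z; rewrite in_succ; intros [Hz| ->]; auto; exact (ord_trans (meas_ord Hm) Hbe Hz).
- apply ord_succ, (ord_elem Hk Hb).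
Qed.

Lemma k_max b b' : b ∈ k -> b' ∈ k -> exists m, m ∈ k /\ b ∈ m /\ b' ∈ m.
Proof.
intros Hb Hb'; destruct (ord_tri (ord_elem Hk Hb) (ord_elem Hk Hb')) as [H|[H|H]].
- exists (succ b'); rewrite !in_succ; auto using k_succ.
- subst; exists (succ b'); rewrite !in_succ; auto using k_succ.
- exists (succ b); rewrite !in_succ; auto using k_succ.
Qed.

Lemma k_meas2 b b' : b ∈ k -> b' ∈ k -> exists e v, e ∈ k /\ b ∈ e /\ b' ∈ e /\ is_measure e v.
Proof.
intros Hb Hb'; destruct (k_max Hb Hb') as [m [Hm [H1 H2]]].
destruct (Hlim Hm) as [e [v [He [Hme Hmv]]]]; exists e, v.
pose proof (meas_ord Hmv) as Ho.
split; [assumption|split; [exact (ord_trans Ho Hme H1)|split; [exact (ord_trans Ho Hme H2)|assumption]]].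
Qed.

(** If [k] is singular, [a0] is its cofinality (or a larger ordinal). *)
Lemma cof_bound : k <> emp -> exists a0, a0 ∈ k /\ forall d Om mu EE, a0 ∈ d -> Sys w d Om mu EE ->
  (exists e v, e ∈ k /\ is_measure e v /\ small e Om) ->
  forall f, f ∈ Adm Om EE k -> exists b, b ∈ k /\ ae Om mu (fun s => app f s ∈ b).
Proof.
intros Hne; destruct (nonempty Hne) as [z0 Hz0].
destruct (classic (exists c g, c ∈ k /\ maps g c k /\
  forall b, b ∈ k -> exists i, i ∈ c /\ b ∈ app g i)) as [[c [g [Hc [Hg Hcof]]]]|Hreg].
(* Singular case: the index of a bound in a cofinal sequence of length [c ∈ d] is constant almost
   everywhere. *)
- exists c; split; [assumption|]; intros d Om mu EE Hcd HS _ f Hf.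
  apply maps_iff in Hg; destruct Hg as [_ Hg].
  destruct (@choice_fun _ _ k (fun b i => i ∈ c /\ b ∈ app g i) _ Hcof) as [F [_ HF]].
  destruct (Adm_inv Hf) as [E [HE Hi]].
  assert (HA : lam Om (fun s => app F (app f s)) ∈ Adm Om EE c).
  { apply (@adm_lam _ _ _ Om EE c E); auto; [dfn| |].
    - intros s s' Hs Hs' Hp; now rewrite (Hi s s').
    - intros s Hs; apply HF, (Adm_app Hf Hs). }
  destruct (sy_const HS (small_ord Hcd) HA) as [i [Hic HiA]].
  exists (app g i); split; auto.
  refine (ae_mono HS HiA _); try dfn; intros s Hs; rewrite app_lam by (assumption || dfn).
  intros <-; apply HF, (Adm_app Hf Hs).
(* Regular case: an unbounded function on [Om], composed with a cover of [Om] of length below [k],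
   would be cofinal in [k]. *)
- exists z0; split; auto; intros d Om mu EE _ HS [e [v [He [Hm [th [g [Hth [Hg Hsurj]]]]]]]] f Hf.
  assert (Hb : exists b, b ∈ k /\ forall s, s ∈ Om -> app f s ∈ b).
  { apply NNPP; intros N; apply Hreg.
    pose (F := fun i => iota (fun v => (app g i ∈ Om /\ v = app f (app g i)) \/ (app g i ∉ Om /\ v = z0))).
    assert (HF : DF1 F) by (unfold F; dfn).
    assert (HF1 : forall i, app g i ∈ Om -> F i = app f (app g i)).
    { intros i Hi; apply iota_eq; [auto|intuition]. }
    assert (HF2 : forall i, app g i ∉ Om -> F i = z0).
    { intros i Hi; apply iota_eq; [auto|intuition]. }
    exists th, (lam th F); split; [exact (ord_trans Hk He Hth)|split].
    - apply lam_maps; auto; intros i Hi; destruct (classic (app g i ∈ Om)) as [H|H].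
      + rewrite (HF1 i H); exact (Adm_app Hf H).
      + now rewrite (HF2 i H).
    - intros b Hbk; assert (Hs : exists s, s ∈ Om /\ app f s ∉ succ b).
      { apply NNPP; intros N1; apply N; exists (succ b); split; [now apply k_succ|].
        intros s Hs; apply NNPP; intros N2; eauto. }
      destruct Hs as [s [Hs Hsb]]; destruct (Hsurj s Hs) as [i [Hi Es]]; exists i; split; auto.
      rewrite app_lam by (assumption || dfn); rewrite HF1 by (rewrite Es; exact Hs); rewrite Es.
      rewrite in_succ in Hsb.
      destruct (ord_tri (ord_elem Hk (Adm_app Hf Hs)) (ord_elem Hk Hbk)) as [H|[H|H]]; tauto. }
  destruct Hb as [b [Hb Hfb]]; exists b; split; auto; apply (ae_all HS); [dfn|auto].
Qed.

Lemma it_good : k <> emp -> exists a0, a0 ∈ k /\ forall d u a, a0 ∈ d -> d ∈ k -> a ∈ k -> is_normal_measure d u ->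
  good_sys w k d (it_space d a) (it_filter d u a) (it_supports d a).
Proof.
intros Hne; destruct (cof_bound Hne) as [a0 [Ha0 H]]; exists a0; split; auto.
intros d u a Had Hd Ha Hn.
assert (HS : Sys w d (it_space d a) (it_filter d u a) (it_supports d a)).
{ apply it_sys; auto; [exact (meas_omega (proj1 Hn))|exact (ord_elem Hk Ha)]. }
split; [assumption|split].
- apply (H d); auto; destruct (k_meas2 Hd Ha) as [e [v [He [Hde [Hae Hm]]]]].
  exists e, v; split; auto; split; auto; exact (proj1 (it_small Hm Hde Hae)).
- intros b Hb; destruct (k_max Hb Hd) as [m [Hm [Hbm Hdm]]].
  destruct (k_meas2 Hm Ha) as [e [v [He [Hme [Hae Hmv]]]]]; exists e, v.
  pose proof (meas_ord Hmv) as Ho.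
  split; auto; split; auto; split; [exact (small_ord (ord_trans Ho Hme Hbm))|].
  exact (proj1 (it_small Hmv (ord_trans Ho Hme Hdm) Hae)).
Qed.

Notation iti d u a x := (iset (it_space d a) (it_filter d u a) (it_supports d a) k x).

Section Det.
Variables (d u : V).
Hypothesis Hn : is_normal_measure d u.
Hypothesis Hdk : d ∈ k.
Hypothesis Hg : forall a, a ∈ k -> good_sys w k d (it_space d a) (it_filter d u a) (it_supports d a).

(** The coordinate functions represent a strictly increasing sequence of [a] ordinals, all of them
    below the image of [d]. *)
Lemma it_reach a : a ∈ k ->
  subset a (app (rho (it_space d a) (it_filter d u a) (it_supports d a) k) (lam (it_space d a) (fun _ => d))).
Proof.
intros Ha; destruct (Hg Ha) as [HS [Hbd Hsz]].
pose proof (ord_elem Hk Ha) as Hao.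
assert (Hds : subset d k) by exact (proj1 Hk d Hdk).
pose proof (meas_omega (proj1 Hn)) as Hwd.
set (c := app (rho (it_space d a) (it_filter d u a) (it_supports d a) k)).
assert (H : forall i, i ∈ a -> subset i (c (lam (it_space d a) (fun s => app s i)))).
{ apply (@trans_ind _ _ (fun i => subset i (c (lam (it_space d a) (fun s => app s i)))) ltac:(unfold c; dfn) a (proj1 Hao)).
  intros i Hi IH j Hj; pose proof (ord_trans Hao Hi Hj) as Hja.
  apply (@ord_le_lt _ _ _ (c (lam (it_space d a) (fun s => app s j)))).
  - apply (rk_ord Hw HS Hk); now apply coord_adm.
  - now apply IH.
  - exact (ord_elem Hao Hja).
  - apply (rho_mem Hw HS); try now apply coord_adm.
    refine (ae_mono HS (coord_lt Hn Hao Hja Hi Hj) _); try dfn.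
    intros s Hs Hlt; now rewrite !app_lam by (assumption || dfn). }
intros i Hi; apply (@ord_le_lt _ _ _ (c (lam (it_space d a) (fun s => app s i)))).
- apply (rk_ord Hw HS Hk); now apply (adm_const HS).
- now apply H.
- exact (ord_elem Hao Hi).
- apply (rho_mem Hw HS); [now apply (adm_const HS)|now apply coord_adm|].
  apply (ae_all HS); [dfn|]; intros s Hs; rewrite !app_lam by (assumption || dfn).
  exact (funs_app Hs Hi).
Qed.

(** The image of [d] is at least the length [a] of the iteration, so the traces on [d] determine
    the sets below every [a]. *)
Lemma fixed_by_iterates_inj x y : subset x k -> subset y k ->
  (forall a, a ∈ k -> iti d u a x = x) -> (forall a, a ∈ k -> iti d u a y = y) ->
  (forall z, z ∈ d -> (z ∈ x <-> z ∈ y)) -> x = y.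
Proof.
intros Hx Hy Hfx Hfy Hxy.
assert (H : forall z, z ∈ k -> (z ∈ x <-> z ∈ y)).
{ intros z Hz; assert (Ha : exists a, a ∈ k /\ z ∈ a).
  { exists (succ z); rewrite in_succ; auto using k_succ. }
  destruct Ha as [a [Hak Hza]].
  destruct (Hg Hak) as [HS [Hbd Hsz']].
  apply (it_reach Hak) in Hza.
  apply (in_rho Hw HS _ (adm_const HS Hdk)) in Hza; destruct Hza as [g [Hg' [Hgd Ez]]].
  (* [z] is represented by a function [g] with values below [d]. For a fixed set [v], membership of
     [z] is thus decided by the trace of [v] on [d]. *)
  assert (Hv : forall v, iti d u a v = v ->
    (z ∈ v <-> ae (it_space d a) (it_filter d u a) (fun s => app g s ∈ v))).
  { intros v Ev; rewrite Ez; rewrite <- Ev at 1; apply (rk_iset Hw HS Hk v Hg'). }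
  rewrite (Hv x (Hfx a Hak)), (Hv y (Hfy a Hak)).
  split; intros H; (refine (ae_mono HS (ae_and HS Hgd H) _); try dfn);
    intros s Hs; rewrite app_lam by (assumption || dfn); intros [H1 H2]; now apply Hxy. }
apply ext; intros z; split; intros Hz; apply H; auto.
Qed.

End Det.

Section Counting.
Variables (a0 A c : V).
Hypothesis Ha0 : forall d u a, a0 ∈ d -> d ∈ k -> a ∈ k -> is_normal_measure d u ->
  good_sys w k d (it_space d a) (it_filter d u a) (it_supports d a).
Hypothesis HA : forall x, x ∈ A -> subset x k.

(** Exceptional sets are determined by a bounded set together with a measure. *)
Definition exceptional x b : Prop := subset x b \/
  (a0 ∈ b /\ exists u, is_normal_measure b u /\ forall a, a ∈ k -> iti b u a x = x).

Instance DP2_exceptional : DP2 exceptional.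
Proof. unfold exceptional; dfn. Qed.

(** Along a sequence of length [e], the witness [b], the trace of the set on it and the measure are
    all constant almost everywhere, because each ranges over a small set. These data determine the
    exceptional set. *)
Lemma exceptional_small l e v : l ∈ k -> e ∈ k -> is_measure e v -> l ∈ e ->
  small e (sep A (fun x => exists b, b ∈ succ l /\ exceptional x b)).
Proof.
intros Hl He Hm Hle; pose proof (meas_ord Hm) as Heo.
pose proof (proj1 (proj2 Hm)) as Hu.
pose proof (k_succ Hl) as Hsl.
assert (Hsle : subset (succ l) e).
{ intros z; rewrite in_succ; intros [Hz| ->]; auto; exact (ord_trans Heo Hle Hz). }
apply (const_small Hm); intros h Hh; apply maps_iff in Hh; destruct Hh as [_ Hh].
assert (HhA : forall t, t ∈ e -> app h t ∈ A) by (intros t Ht; specialize (Hh t Ht); insep in Hh; tauto).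
destruct (@choice_fun _ _ e (fun t b => b ∈ succ l /\ exceptional (app h t) b) _) as [B [_ HB]].
{ intros t Ht; specialize (Hh t Ht); insep in Hh; tauto. }
assert (Hsm : small e (succ l)).
{ destruct (@uf_ex _ _ e _ Hu _ _ (@uf_final _ _ e _ Hu (proj1 (proj2 (proj2 Hm)))
    (proj2 (proj2 (proj2 Hm))) Heo l Hle)) as [t [Ht Hlt]].
  apply small_ord, (@ord_le_lt _ _ _ t); auto.
  - intros z; rewrite in_succ; intros [Hz| ->]; auto; exact (ord_trans (ord_elem Heo Ht) Hlt Hz).
  - apply ord_succ, (ord_elem Heo Hle). }
destruct (@meas_const _ _ e v Hm (succ l) (fun t => app B t) _ Hsm) as [b' [Hb' HBc]].
{ intros t Ht; now apply HB. }
assert (Hb'e : b' ∈ e) by auto.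
assert (Hb'k : b' ∈ k) by exact (ord_trans Hk He Hb'e).
destruct (@meas_const _ _ e v Hm (pow b') (fun t => sep b' (fun z => z ∈ app h t)) _) as [y [Hy Hyc]].
{ apply (small_pow Hm), small_ord, Hb'e. }
{ intros t Ht; rewrite in_pow; intros z; insep; tauto. }
pose proof (@uf_and _ _ e _ Hu _ _ _ _ HBc Hyc) as H1.
(* Either almost all the sets are bounded by [b'] and equal to their trace [y], or almost all are
   fixed by the iterates of a measure on [b']. *)
destruct (@uf_dich _ _ e _ Hu (fun t => subset (app h t) b') _) as [H2|H2].
- exists y; refine (@uf_mono _ _ e _ Hu _ _ _ _ (@uf_and _ _ e _ Hu _ _ _ _ H1 H2) _); try dfn.
  intros t Ht [[_ <-] Hs]; apply ext; intros z; insep; intuition.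
- pose proof (@uf_and _ _ e _ Hu _ _ _ _ H1 H2) as H3.
  (* The value [emp] stands in where there is no such measure, so that all values lie in the small
     set [pow (pow b')]. *)
  destruct (@choice_fun _ _ e (fun t u => u ∈ pow (pow b') /\
    ((a0 ∈ b' /\ exists u, is_normal_measure b' u /\ forall a, a ∈ k -> iti b' u a (app h t) = app h t) ->
     (is_normal_measure b' u /\ forall a, a ∈ k -> iti b' u a (app h t) = app h t))) _) as [F [_ HF]].
  { intros t Ht; destruct (classic (a0 ∈ b' /\ exists u, is_normal_measure b' u /\
      forall a, a ∈ k -> iti b' u a (app h t) = app h t)) as [[Ha [u [Hnu Hfu]]]|Hno].
    - exists u; split; [|auto]; rewrite in_pow; intros z Hz; rewrite in_pow.
      exact (proj1 (proj1 (proj2 (proj1 Hnu))) z Hz).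
    - exists emp; split; [|tauto]; rewrite in_pow; intros z Hz; destruct (not_in_emp Hz). }
  destruct (@meas_const _ _ e v Hm (pow (pow b')) (fun t => app F t) _) as [u [Huu Huc]].
  { apply (small_pow Hm), (small_pow Hm), small_ord, Hb'e. }
  { intros t Ht; now apply HF. }
  pose proof (@uf_and _ _ e _ Hu _ _ _ _ H3 Huc) as H4.
  assert (Hall : forall t, t ∈ e -> ((app B t = b' /\ sep b' (fun z => z ∈ app h t) = y) /\
    ~ subset (app h t) b') /\ app F t = u -> a0 ∈ b' /\ is_normal_measure b' u /\
      (forall a, a ∈ k -> iti b' u a (app h t) = app h t) /\
      forall z, z ∈ b' -> (z ∈ app h t <-> z ∈ y)).
  { intros t Ht [[[E1 E2] Hns] E3]; destruct (HB t Ht) as [_ [Hs|Hfix]]; rewrite E1 in *; [tauto|].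
    split; [tauto|]; destruct (HF t Ht) as [_ HFt]; rewrite E3 in HFt.
    destruct (HFt Hfix) as [Hnu Hfu]; split; [assumption|split; [assumption|]].
    intros z Hz; rewrite <- E2; insep; tauto. }
  destruct (@uf_ex _ _ e _ Hu _ _ H4) as [t0 [Ht0 H5]].
  destruct (Hall t0 Ht0 H5) as [Hab [Hnu [Hf0 Hz0]]].
  exists (app h t0); refine (@uf_mono _ _ e _ Hu _ _ _ _ H4 _); try dfn.
  intros t Ht H6; destruct (Hall t Ht H6) as [_ [_ [Hft Hzt]]].
  apply (@fixed_by_iterates_inj b' u); auto.
  intros z Hz; rewrite Hzt, Hz0; tauto.
Qed.

(** Otherwise [A] could be well-ordered in type at most [k], by the least witness [b]. *)
Lemma counting : cardinal c -> equinumerous A c -> k ∈ c ->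
  ~ (forall x, x ∈ A -> exists b, b ∈ k /\ exceptional x b).
Proof.
intros Hc [f Hf] Hkc Hex; destruct Hf as [Hf Hbij]; apply maps_iff in Hf; destruct Hf as [Hff HfA].
pose proof (proj1 Hc) as Hco.
pose (g := fun j => iota (fun x => x ∈ A /\ app f x = j)).
assert (Dg : DF1 g) by (unfold g; dfn).
assert (Hg : forall j, j ∈ c -> g j ∈ A /\ app f (g j) = j).
{ intros j Hj; apply (@iota_spec _ _ (fun x => x ∈ A /\ app f x = j)).
  destruct (Hbij j Hj) as [x [Hx Hxu]]; apply (rel_app x j Hff) in Hx; destruct Hx as [Hx ->].
  exists x; split; auto; intros z [Hz Ez]; apply Hxu, (rel_app z _ Hff); auto. }
assert (Hr0 : exists r, is_fun r A /\ forall x, x ∈ A -> app r x ∈ k /\ exceptional x (app r x)).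
{ exact (@choice_fun _ _ A (fun x b => b ∈ k /\ exceptional x b) _ Hex). }
destruct Hr0 as [r [_ Hr]].
assert (Hrk : forall j, j ∈ c -> app r (g j) ∈ k) by (intros j Hj; apply Hr, Hg, Hj).
assert (Hro : forall j, j ∈ c -> ordinal (app r (g j))) by (intros j Hj; exact (ord_elem Hk (Hrk j Hj))).
(* Indices are ordered by their witnesses first and by their position in [c] second. *)
pose (E := fun i j => app r (g i) ∈ app r (g j) \/ (app r (g i) = app r (g j) /\ i ∈ j)).
assert (DE : DP2 E) by (unfold E; dfn).
destruct (@wo_collapse _ _ E _ c) as [h [Hh [Hhr [Hinj [Hho Hth]]]]].
{ intros S HS [x Hx].
  destruct (@fnd _ _ (fun _ => True) _ (repl S (fun i => app r (g i)))) as [b [Hb [_ Hbm]]].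
  { exists (app r (g x)); inrepl; eauto. }
  inrepl in Hb; destruct Hb as [i0 [Hi0 ->]].
  destruct (@fnd _ _ (fun i => app r (g i) = app r (g i0)) _ S) as [m [Hm [Em Hmm]]]; [eauto|].
  exists m; split; auto; intros y Hy [H|[H1 H2]].
  - rewrite Em in H; apply (Hbm _ H); auto; inrepl; eauto.
  - apply (Hmm y H2 Hy); congruence. }
{ intros x Hx [H|[_ H]]; exact (irrefl H). }
{ intros x y z Hx Hy Hz [H1|[H1 H1']] [H2|[H2 H2']]; unfold E.
  - left; exact (ord_trans (Hro z Hz) H2 H1).
  - left; congruence.
  - left; congruence.
  - right; split; [congruence|]; exact (ord_trans (ord_elem Hco Hz) H2' H1'). }
{ intros x y Hx Hy; unfold E; destruct (ord_tri (Hro x Hx) (Hro y Hy)) as [H|[H|H]]; auto.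
  destruct (ord_tri (ord_elem Hco Hx) (ord_elem Hco Hy)) as [H1|[H1|H1]]; auto. }
(* The predecessors of [j] index sets that are exceptional with a witness at most [l]. There are
   fewer than [e] of these, so the rank of [j] is below [e]. *)
assert (Hhk : forall j, j ∈ c -> app h j ∈ k).
{ intros j Hj; pose proof (Hrk j Hj) as Hl; set (l := app r (g j)) in *.
  destruct (Hlim Hl) as [e [v [He [Hle Hm]]]].
  apply (ord_trans Hk He).
  destruct (ord_tri (Hho j Hj) (meas_ord Hm)) as [H|H]; auto; exfalso.
  apply (small_not_ge Hm (C := app h j)).
  - apply small_sub with (repl (sep A (fun x => exists b, b ∈ succ l /\ exceptional x b))
      (fun x => app h (app f x))).
    + apply small_repl; [dfn|]; now apply (@exceptional_small l e v).
    + intros z Hz; rewrite (Hhr j Hj) in Hz; inrepl in Hz; destruct Hz as [i [Hi ->]].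
      insep in Hi; destruct Hi as [Hi HE]; inrepl; exists (g i); insep.
      destruct (Hg i Hi) as [HgA Efg]; rewrite Efg; split; auto; split; auto.
      exists (app r (g i)); rewrite in_succ; split; [|now apply Hr].
      destruct HE as [HE|[HE _]]; auto.
  - destruct H as [H|H]; [rewrite H; now intros z|exact (proj1 (Hho j Hj) e H)]. }
pose (th := repl c (fun x => app h x)).
(* All ranks are below [k], so the order type [th] is at most [k] and hence below the cardinal [c],
   to which it is equinumerous. *)
assert (Hthc : th ∈ c).
{ apply (@ord_le_lt _ _ _ k); auto; intros z Hz; unfold th in Hz; inrepl in Hz.
  destruct Hz as [j [Hj ->]]; auto. }
apply (proj2 Hc th Hthc).
pose (q := fun v => iota (fun i => i ∈ c /\ app h i = v)).
assert (Dq : DF1 q) by (unfold q; dfn).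
assert (Hq : forall i, i ∈ c -> q (app h i) = i).
{ intros i Hi; apply iota_eq; auto; intros z [Hz Ez]; now apply Hinj. }
assert (Hqf : is_fun (lam th q) th) by now apply lam_fun.
exists (lam th q); split.
- apply lam_maps; auto; intros v Hv; unfold th in Hv; inrepl in Hv.
  destruct Hv as [i [Hi ->]]; now rewrite Hq.
- intros i Hi; assert (Hit : app h i ∈ th) by (unfold th; inrepl; eauto).
  exists (app h i); split.
  + apply (rel_app _ _ Hqf); split; auto; rewrite app_lam by (assumption || dfn); symmetry; auto.
  + intros v Hv; apply (rel_app _ _ Hqf) in Hv; destruct Hv as [Hv Ev].
    rewrite app_lam in Ev by (assumption || dfn).
    unfold th in Hv; inrepl in Hv; destruct Hv as [i' [Hi' ->]]; rewrite Hq in Ev by assumption.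
    now subst.
Qed.

End Counting.
End Kappa.

(** * The cofinality of an iterable cardinal *)

Section Internal.
Context {V : set_structure} {HZ : ZFCm V} {HPow : Powm V}.
Variables (w M : V).
Hypothesis Hw : is_omega w.

Fixpoint num (n : nat) : V := match n with 0 => emp | S n => succ (num n) end.

Lemma num_omega n : num n ∈ w.
Proof. induction n as [|n IH]; [now apply omega_emp|now apply omega_succ]. Qed.

Lemma num_lt m n : m < n -> num m ∈ num n.
Proof.
intros H; induction H as [|n H IH]; cbn [num]; rewrite in_succ; auto.
Qed.

Lemma num_neq m n : m <> n -> num m <> num n.
Proof.
intros H E; assert (m < n \/ n < m) as [H1|H1] by lia; apply num_lt in H1; rewrite E in H1;
  exact (irrefl H1).
Qed.

Lemma asg_update s i x t : assignment w M s -> i ∈ w ->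
  (is_update w M s i x t <-> assignment w M t /\ app t i = x /\
    forall j, j ∈ w -> j <> i -> app t j = app s j).
Proof.
intros Hs Hi; unfold is_update; split; intros [Ht [H1 H2]]; (split; [assumption|]);
  pose proof (proj1 Ht) as Hft; pose proof (proj1 Hs) as Hfs.
- apply (rel_app _ _ Hft) in H1; split; [symmetry; tauto|].
  intros j Hj Hji; specialize (H2 j (app s j) Hj Hji).
  rewrite (rel_app _ _ Hfs), (rel_app _ _ Hft) in H2; symmetry; apply H2; auto.
- split; [apply (rel_app _ _ Hft); auto|].
  intros j y Hj Hji; rewrite (rel_app _ _ Hfs), (rel_app _ _ Hft); intros [_ ->].
  split; auto; symmetry; auto.
Qed.

Lemma asg_upd s i x : assignment w M s -> x ∈ M -> i ∈ w -> is_update w M s i x (upd w s i x).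
Proof.
intros Hs Hx Hi; apply asg_update; auto; split; [|split].
- unfold assignment in *; rewrite <- in_funs in *.
  change (upd w s i x ∈ it_space M w); apply upd_in; assumption.
- now apply upd_same.
- intros j Hj Hji; now apply upd_other.
Qed.

Fixpoint free_bound (p : formula) : nat := match p with
  | fIn i j | fEq i j => S (Nat.max i j)
  | fNot p => free_bound p
  | fAnd p q => Nat.max (free_bound p) (free_bound q)
  | fEx p => pred (free_bound p)
  end.

Lemma fresh (v : nat -> nat) b : exists K, forall n, n < b -> v n <> K.
Proof.
enough (H : exists K, forall n, n < b -> v n < K).
{ destruct H as [K H]; exists K; intros n Hn; specialize (H n Hn); lia. }
induction b as [|b [K HK]]; [exists 0; lia|].
exists (Nat.max K (S (v b))); intros n Hn.
assert (n < b \/ n = b) as [H| ->] by lia; [specialize (HK n H)|]; lia.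
Qed.

Lemma val_inj (x y : set_model M) : val x = val y -> x = y.
Proof.
destruct x as [x Hx], y as [y Hy]; cbn; intros ->; f_equal; apply proof_irrelevance.
Qed.

(** The quantifiers of a formula of the metatheory receive distinct numerals as names. *)
Lemma truth_ex p : forall v : nat -> nat, exists T0, truth_set w M T0 /\
  forall s (r : nat -> set_model M), assignment w M s ->
    (forall n, n < free_bound p -> app s (num (v n)) = val (r n)) -> (s ∈ T0 <-> sat p r).
Proof.
assert (Hsep : forall P : V -> Prop, DP1 P -> comprehends w M (sep (funs w M) P) P).
{ intros P HP s; insep; now rewrite in_funs. }
induction p as [i j|i j|p IH|p IHp q IHq|p IH]; intros v.
- exists (sep (funs w M) (fun s => exists a b, rel s (num (v i)) a /\ rel s (num (v j)) b /\ a ∈ b)).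
  split; [intros D0 HD; apply (proj1 HD (num (v i)) (num (v j))); auto using num_omega; apply Hsep; dfn|].
  intros s r Hs Hr; insep; rewrite in_funs; cbn [sat].
  change (r i ∈ r j) with (val (r i) ∈ val (r j)).
  rewrite <- !Hr by (cbn; lia); pose proof (proj1 Hs) as Hf; split.
  + intros [_ [x [y [Hx [Hy H]]]]]; rewrite (rel_app _ _ Hf) in Hx; rewrite (rel_app _ _ Hf) in Hy.
    destruct Hx as [_ ->], Hy as [_ ->]; assumption.
  + intros H; split; auto; eexists; eexists; rewrite !(rel_app _ _ Hf); eauto 7 using num_omega.
- exists (sep (funs w M) (fun s => exists a, rel s (num (v i)) a /\ rel s (num (v j)) a)).
  split; [intros D0 HD; apply (proj1 (proj2 HD) (num (v i)) (num (v j))); auto using num_omega; apply Hsep; dfn|].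
  intros s r Hs Hr; insep; rewrite in_funs; cbn [sat]; pose proof (proj1 Hs) as Hf; split.
  + intros [_ [x [Hx Hy]]]; rewrite (rel_app _ _ Hf) in Hx; rewrite (rel_app _ _ Hf) in Hy.
    apply val_inj; rewrite <- !Hr by (cbn; lia); destruct Hx as [_ <-]; tauto.
  + intros H; split; auto; exists (app s (num (v i))); rewrite !(rel_app _ _ Hf).
    split; [auto using num_omega|]; split; [auto using num_omega|].
    rewrite !Hr by (cbn; lia); now rewrite H.
- destruct (IH v) as [T0 [HT HTs]].
  exists (sep (funs w M) (fun s => s ∉ T0)); split.
  + intros D0 HD; apply (proj1 (proj2 (proj2 HD)) T0); [apply HT; exact HD|apply Hsep; dfn].
  + intros s r Hs Hr; insep; rewrite in_funs; cbn [sat]; rewrite (HTs s r Hs Hr).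
    unfold assignment in Hs; tauto.
- destruct (IHp v) as [T0 [HT HTs]], (IHq v) as [T1 [HT1 HTs1]].
  exists (sep (funs w M) (fun s => s ∈ T0 /\ s ∈ T1)); split.
  + intros D0 HD; apply (proj1 (proj2 (proj2 (proj2 HD))) T0 T1); [apply HT; exact HD|apply HT1; exact HD|apply Hsep; dfn].
  + intros s r Hs Hr; insep; rewrite in_funs; cbn [sat].
    rewrite (HTs s r Hs), (HTs1 s r Hs) by (intros n Hn; apply Hr; cbn; lia).
    unfold assignment in Hs; tauto.
- destruct (fresh v (pred (free_bound p))) as [K HK].
  destruct (IH (fun n => match n with 0 => K | S n => v n end)) as [T0 [HT HTs]].
  exists (sep (funs w M) (fun s => exists a t, a ∈ M /\ is_update w M s (num K) a t /\ t ∈ T0)); split.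
  + intros D0 HD; apply (proj2 (proj2 (proj2 (proj2 HD))) (num K) T0); [apply num_omega|apply HT; exact HD|].
    apply Hsep; unfold is_update, assignment; dfn.
  + intros s r Hs Hr; rewrite in_sep by (unfold is_update, assignment; dfn).
    rewrite in_funs; cbn [sat].
    assert (Hupd : forall x t, is_update w M s (num K) (val x) t -> t ∈ T0 <-> sat p (scons x r)).
    { intros x t Ht; apply asg_update in Ht; auto using num_omega; destruct Ht as [Ht [H1 H2]].
      apply HTs; auto; intros [|n] Hn; cbn [scons]; auto.
      rewrite H2 by (apply num_omega || (apply num_neq, HK; lia)); apply Hr; cbn; lia. }
    split.
    * intros [_ [x [t [Hx [Ht HtT]]]]]; exists (exist _ x Hx).
      now apply (Hupd (exist _ x Hx) t).
    * intros [x Hx]; split; [exact Hs|]; exists (val x), (upd w s (num K) (val x)).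
      assert (Hu : is_update w M s (num K) (val x) (upd w s (num K) (val x))).
      { apply asg_upd; auto using num_omega; exact (proj2_sig x). }
      split; [exact (proj2_sig x)|split; auto]; now apply (Hupd x).
Qed.

(** A sequence of the metatheory need not be a set of the universe, so it can be matched only at
    finitely many numerals. *)
Lemma asg_ex (r : nat -> set_model M) m : exists s, assignment w M s /\
  forall n, n < m -> app s (num n) = val (r n).
Proof.
induction m as [|m [s [Hs Hsr]]].
- exists (lam w (fun _ => val (r 0))); split; [|lia].
  apply lam_maps; [dfn|]; intros _ _; exact (proj2_sig (r 0)).
- pose proof (@asg_upd s (num m) (val (r m)) Hs (proj2_sig (r m)) (num_omega m)) as Hu.
  exists (upd w s (num m) (val (r m))); apply asg_update in Hu; auto using num_omega.
  destruct Hu as [H1 [H2 H3]]; split; auto; intros n Hn.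
  assert (n < m \/ n = m) as [H| ->] by lia; auto.
  rewrite H3; auto using num_omega; apply num_neq; lia.
Qed.

Lemma fo_internal (Q : set_model M -> set_model M -> Prop) :
  fo_definable Q -> internally_definable Q.
Proof.
intros [p [r Hp]].
destruct (truth_ex p (fun n => n)) as [T0 [HT HTs]].
(* Positions 0 and 1 are overwritten by the two arguments; [r 0] is a filler there. *)
destruct (asg_ex (fun n => match n with 0 => r 0 | 1 => r 0 | S (S n) => r n end) (free_bound p))
  as [s [Hs Hsr]].
exists w, (num 0), (num 1), T0, s.
split; [assumption|split; [now apply is_empty_eq|split; [now apply is_succ_eq|split; [assumption|split; [assumption|]]]]].
assert (Hu : forall x y t u, is_update w M s (num 0) (val x) t -> is_update w M t (num 1) (val y) u ->
  (u ∈ T0 <-> Q x y)).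
{ intros x y t u Ht Hu; apply asg_update in Ht; auto using num_omega; destruct Ht as [Ht [Ht1 Ht2]].
  apply asg_update in Hu; auto using num_omega; destruct Hu as [Hu [Hu1 Hu2]].
  rewrite Hp; apply HTs; auto; intros [|[|n]] Hn; cbn [scons]; auto.
  - rewrite Hu2; auto using num_omega; now apply num_neq.
  - rewrite Hu2, Ht2; auto using num_omega; try (now apply num_neq); exact (Hsr (S (S n)) Hn). }
intros x y; split.
- intros HQ.
  assert (Ht : is_update w M s (num 0) (val x) (upd w s (num 0) (val x))).
  { apply asg_upd; auto using num_omega; exact (proj2_sig x). }
  exists (upd w s (num 0) (val x)), (upd w (upd w s (num 0) (val x)) (num 1) (val y)).
  assert (Hu' : is_update w M (upd w s (num 0) (val x)) (num 1) (val y)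
    (upd w (upd w s (num 0) (val x)) (num 1) (val y))).
  { apply asg_upd; auto using num_omega; [exact (proj1 Ht)|exact (proj2_sig y)]. }
  split; auto; split; auto; now apply (Hu x y _ _ Ht Hu').
- intros [t [u [Ht [Hu' HuT]]]]; now apply (Hu x y t u).
Qed.

(** Makes the preceding development of ultrafilters available inside the model [M]. *)
Lemma model_zfcm : ZFC_minus (@internally_definable V M) -> ZFCm (set_model M).
Proof.
intros [H1 H2 H3 H4 H5 H6 H7 H8]; split; auto.
- intros Q HQ; apply H6; now apply fo_internal.
- intros Q HQ; apply H7; now apply fo_internal.
Qed.

End Internal.

Section UltrafilterCof.
Context {X : set_structure} {HX : ZFCm X}.
Variables (k : X) (U : X -> Prop).
Hypotheses (Hk : ordinal k) (Hu : ultrafilter k U) (Hn : nonprincipal k U) (Hc : complete k U)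
  (Hnorm : normal k U).

(** Otherwise [b |-> max (x ∩ b)] would be a regressive function which is not constant on a
    measure one set. *)
Lemma no_omega_cofinal x : subset x k -> (forall a, a ∈ k -> exists b, b ∈ x /\ a ∈ b) ->
  (exists a, a ∈ k) ->
  ~ (forall b, b ∈ k -> (exists c, c ∈ x /\ c ∈ b) ->
     exists m, m ∈ x /\ m ∈ b /\ forall c, c ∈ x -> c ∈ b -> c ∈ m \/ c = m).
Proof.
intros Hxk Hub [a0 Ha0] Hmax.
pose (P := fun a b => a ∈ x /\ a ∈ b /\ forall c, c ∈ x -> c ∈ b -> c ∈ a \/ c = a).
assert (DP : DP2 P) by (unfold P; dfn).
destruct (classic (exists a, a ∈ k /\ U (sep k (fun b => P a b)))) as [[a [Ha HUa]]|Hno].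
(* If one [a] were the maximum below almost all [b], a larger element [a'] of [x] would still be
   below almost all of them. *)
- destruct (Hub a Ha) as [a' [Ha' Haa]].
  pose proof (@uf_final _ _ k U Hu Hn Hc Hk a' (Hxk _ Ha')) as HF.
  destruct (@uf_ex _ _ k U Hu _ _ (@uf_and _ _ k U Hu _ _ _ _ HUa HF)) as [b [Hb [[_ [_ H1]] H2]]].
  destruct (H1 a' Ha' H2) as [H3| ->]; [exact (asym H3 Haa)|exact (irrefl Haa)].
(* If no [a] is the maximum for almost all [b], the diagonal intersection gives almost all [b] below
   which [x] has no maximum at all. *)
- pose (F := fun a => sep k (fun b => ~ P a b)).
  assert (DF : DF1 F) by (unfold F; dfn).
  assert (HD : U (sep k (fun b => forall a, a ∈ b -> ~ P a b))).
  { apply (Hnorm (f := lam k F)).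
    - split; [now apply lam_fun|]; intros a y Hay.
      rewrite (rel_app _ _ (lam_fun (F := F) k)) in Hay; destruct Hay as [Ha ->].
      rewrite app_lam by (assumption || dfn); unfold F.
      destruct (@uf_dich _ _ k U Hu (fun b => P a b) _) as [H|H]; auto; destruct Hno; eauto.
    - intros b; insep; split; intros [Hb H]; (split; [assumption|]).
      + intros a y Hab Hay; rewrite (rel_app _ _ (lam_fun (F := F) k)) in Hay.
        destruct Hay as [Ha ->]; rewrite app_lam by (assumption || dfn); unfold F; insep; auto.
      + intros a Hab; pose proof (ord_trans Hk Hb Hab) as Ha.
        specialize (H a (F a) Hab); rewrite (rel_app _ _ (lam_fun (F := F) k)) in H.
        rewrite app_lam in H by (assumption || dfn); specialize (H (conj Ha eq_refl)).
        unfold F in H; insep in H; tauto. }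
  destruct (Hub a0 Ha0) as [x0 [Hx0 _]].
  pose proof (@uf_final _ _ k U Hu Hn Hc Hk x0 (Hxk _ Hx0)) as HF.
  destruct (@uf_ex _ _ k U Hu _ _ (@uf_and _ _ k U Hu _ _ _ _ HD HF)) as [b [Hb [H1 H2]]].
  destruct (Hmax b Hb) as [m [Hm1 [Hm2 Hm3]]]; [eauto|].
  apply (H1 m Hm2); split; auto.
Qed.

End UltrafilterCof.

Section Cofinality.
Context {V : set_structure} {HZ : ZFCm V} {HPow : Powm V}.
Variables (w k : V).
Hypothesis Hw : is_omega w.

Lemma fin_nat n : n ∈ w -> fin n.
Proof.
revert n; apply (omega_ind Hw); [exact _|exact fin_emp|].
intros n Hn IH; unfold succ; apply (@fin_cup _ _ w (omega_ord Hw)); auto.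
- exact (proj1 (omega_ord Hw) n Hn).
- intros z; rewrite in_sing; now intros ->.
- apply fin_sing.
Qed.

(** A cofinal sequence of type omega yields a cofinal [x] with a maximum below every bound that it
    meets. A model containing [x] with a normal ultrafilter then contradicts [no_omega_cofinal]. *)
Theorem iterable_cof : iterable_cardinal k -> forall b, (forall n, n ∈ w -> app b n ∈ k) ->
  ~ (forall a, a ∈ k -> exists n, n ∈ w /\ a ∈ app b n).
Proof.
intros [[[Hk _] [w' [_ Hwk]]] Hit] b Hb Hcof.
(* Only the values of [b] exceeding all earlier ones are kept, since [b] need not be increasing. *)
pose (x := sep (repl w (fun n => app b n)) (fun y => exists n, n ∈ w /\ y = app b n /\
  forall m, m ∈ n -> app b m ∈ app b n)).
assert (Hin : forall y, y ∈ x <-> exists n, n ∈ w /\ y = app b n /\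
  forall m, m ∈ n -> app b m ∈ app b n).
{ intros y; unfold x; insep; inrepl; split; [tauto|]; intros H; split; auto.
  destruct H as [n [Hn [E _]]]; eauto. }
assert (Hxk : subset x k) by (intros y; rewrite Hin; intros [n [Hn [-> _]]]; auto).
destruct (Hit x Hxk) as [M [U [kM [HM [HZM [_ [HkM [HxM [_ [[Hu [Hn [Hc [Hnorm _]]]] _]]]]]]]]]].
pose proof (model_zfcm Hw HZM) as HX.
assert (HkMM : k ∈ M) by (rewrite <- HkM; exact (proj2_sig kM)).
assert (Hkm : forall y : set_model M, y ∈ kM <-> val y ∈ k).
{ intros y; change (y ∈ kM) with (val y ∈ val kM); now rewrite HkM. }
pose (xM := exist (fun y => y ∈ M) x HxM : set_model M).
assert (HkO : forall y, y ∈ k -> y ∈ M) by (intros y Hy; exact (HM k HkMM y Hy)).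
assert (Hord : @ordinal (set_model M) kM).
{ split.
  - intros y Hy z Hz; apply Hkm; apply Hkm in Hy; exact (ord_trans Hk Hy Hz).
  - intros y Hy z Hz t Ht; apply Hkm in Hy.
    exact (ord_trans (ord_elem Hk Hy) Hz Ht). }
apply (@no_omega_cofinal _ HX kM (fun y => val y ∈ U) Hord Hu Hn Hc Hnorm xM).
- intros y Hy; apply Hkm, Hxk, Hy.
- intros a Ha; apply Hkm in Ha; destruct (Hcof _ Ha) as [n0 [Hn0 Han0]].
  destruct (@ord_min _ _ (fun n => n ∈ w /\ val a ∈ app b n) _ n0) as [n [_ [[Hnw Han] Hmin]]].
  { exact (ord_elem (omega_ord Hw) Hn0). }
  { auto. }
  assert (Hbx : app b n ∈ x).
  { apply Hin; exists n; split; auto; split; auto; intros m Hm.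
    pose proof (ord_trans (omega_ord Hw) Hnw Hm) as Hmw.
    assert (Hna : val a ∉ app b m) by (intros H; exact (Hmin m Hm (conj Hmw H))).
    destruct (ord_tri (ord_elem Hk (Hb m Hmw)) (ord_elem Hk (Hb n Hnw))) as [H|[H|H]]; auto.
    - rewrite <- H in Han; tauto.
    - destruct Hna; exact (ord_trans (ord_elem Hk (Hb m Hmw)) H Han). }
  exists (exist _ (app b n) (HkO _ (Hb n Hnw))); split; [exact Hbx|exact Han].
- exists (exist _ w' (HkO _ Hwk)); apply Hkm; exact Hwk.
- intros be Hbe [c [Hcx Hcb]]; apply Hkm in Hbe.
  destruct (Hcof _ Hbe) as [N [HN HbN]].
  (* [app b N] exceeds [be], so every record below [be] occurs before [N]. The finitely many indices
     concerned have a maximum. *)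
  assert (Hrec : forall n, n ∈ w -> (forall m, m ∈ n -> app b m ∈ app b n) -> app b n ∈ val be -> n ∈ N).
  { intros n Hnw Hrn Hnb; pose proof (ord_elem Hk Hbe) as Hbo.
    destruct (ord_tri (ord_elem (omega_ord Hw) Hnw) (ord_elem (omega_ord Hw) HN)) as [H|[H|H]]; auto.
    - subst N; destruct (asym Hnb HbN).
    - specialize (Hrn N H); destruct (asym HbN); exact (ord_trans Hbo Hnb Hrn). }
  destruct (@fin_nat N HN (sep N (fun n => (forall m, m ∈ n -> app b m ∈ app b n) /\ app b n ∈ val be)))
    as [n [Hn1 Hn2]].
  { intros z; insep; tauto. }
  { change (val c ∈ x) in Hcx; apply Hin in Hcx; destruct Hcx as [n [Hnw [E Hrn]]].
    change (val c ∈ val be) in Hcb; rewrite E in Hcb; exists n; insep; auto. }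
  insep in Hn1; destruct Hn1 as [HnN [Hrn Hnb]].
  pose proof (ord_trans (omega_ord Hw) HN HnN) as Hnw.
  exists (exist _ (app b n) (HkO _ (Hb n Hnw))); split; [|split].
  + change (app b n ∈ x); apply Hin; eauto.
  + exact Hnb.
  + intros c' Hc' Hcb'; change (val c' ∈ x) in Hc'; change (val c' ∈ val be) in Hcb'.
    apply Hin in Hc'; destruct Hc' as [m [Hmw [E Hrm]]]; rewrite E in Hcb'.
    destruct (Hn2 m) as [H|H]; [insep; auto| |].
    * left; change (val c' ∈ app b n); rewrite E; auto.
    * right; apply val_inj; cbn; now rewrite E, H.
Qed.

End Cofinality.

(** * The theorem *)

Section Final.
Context {V : set_structure} {HZ : ZFCm V} {HPow : Powm V}.

Lemma equinumerous_small d y a : equinumerous y a -> a ∈ d -> small d y.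
Proof.
intros [f [Hf Hbij]] Ha; apply maps_iff in Hf; destruct Hf as [Hff Hfa].
pose (q := fun i => iota (fun x => x ∈ y /\ app f x = i)).
assert (Dq : DF1 q) by (unfold q; dfn).
exists a, (lam a q); split; [assumption|split; [now apply lam_fun|]].
intros x Hx; exists (app f x); split; auto; rewrite app_lam by (auto || dfn).
apply iota_eq; auto; intros z [Hz Ez].
destruct (Hbij (app f x) (Hfa x Hx)) as [t [_ Ht]].
rewrite <- (Ht z), <- (Ht x); auto; apply (rel_app _ _ Hff); auto.
Qed.

Lemma params_small k params z0 : ordinal k -> z0 ∈ k ->
  (forall b b', b ∈ k -> b' ∈ k -> exists m, m ∈ k /\ b ∈ m /\ b' ∈ m) ->
  Forall (fun p => in_H k p \/ p = k) params ->
  exists p0, p0 ∈ k /\ forall d, ordinal d -> p0 ∈ d ->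
    Forall (fun p => (exists y, is_trcl y p /\ small d y) \/ p = k) params.
Proof.
intros Hk Hz0 Hmax H; induction H as [|p l Hp Hl [p0 [Hp0 IH]]].
- exists z0; split; auto.
- destruct Hp as [[y [a [Hy [[_ Heq] Ha]]]]| ->].
  + destruct (Hmax a p0 Ha Hp0) as [m [Hm [Ham Hpm]]]; exists m; split; auto.
    intros d Hd Hmd; constructor.
    * left; exists y; split; auto; apply (equinumerous_small Heq); exact (ord_trans Hd Hmd Ham).
    * apply IH; auto; exact (ord_trans Hd Hmd Hpm).
  + exists p0; split; auto; intros d Hd Hpd; constructor; auto.
Qed.

(** A measurable cardinal, a normal measure on it and a length are coded as one set, because
    dependent choice acts on the elements of a set. *)
Definition triple (d u a : V) : V := pair (pair d u) a.
Definition triple1 (p : V) : V := iota (fun d => exists u a, p = triple d u a).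
Definition triple2 (p : V) : V := iota (fun u => exists d a, p = triple d u a).
Definition triple3 (p : V) : V := iota (fun a => exists d u, p = triple d u a).

#[global] Instance DF3_triple : DF3 triple.
Proof. unfold triple; dfn. Qed.
#[global] Instance DF1_triple1 : DF1 triple1.
Proof. unfold triple1; dfn. Qed.
#[global] Instance DF1_triple2 : DF1 triple2.
Proof. unfold triple2; dfn. Qed.
#[global] Instance DF1_triple3 : DF1 triple3.
Proof. unfold triple3; dfn. Qed.

Lemma triple_inj d u a d' u' a' : triple d u a = triple d' u' a' -> d = d' /\ u = u' /\ a = a'.
Proof.
intros E; apply pair_inj in E; destruct E as [E ->]; apply pair_inj in E; tauto.
Qed.

Lemma triple_proj d u a : triple1 (triple d u a) = d /\ triple2 (triple d u a) = u /\ triple3 (triple d u a) = a.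
Proof.
split; [|split]; (apply iota_eq; [eauto|]); intros z [y [x E]]; apply triple_inj in E;
  symmetry; tauto.
Qed.

End Final.

Theorem theorem1p3 :
  forall (V : set_structure) (hV : ZFC V) (k A : V),
    iterable_cardinal k ->
    limit_of_measurables k ->
    (forall x : V, x ∈ A -> subset x k) ->
    (exists (phi : formula) (params : list V),
        Sigma1 phi /\
        Forall (fun p => in_H k p \/ p = k) params /\
        (forall x : V, x ∈ A <-> defines phi params x)) ->
    (exists c : V, has_card A c /\ k ∈ c) ->
    exists x y : V,
      x ∈ A /\ y ∈ A /\ x <> y /\
      unbounded_in k (fun b => b ∈ x /\ b ∈ y).
Proof.
intros V hV k A Hit Hlim0 HA [phi [params [Hphi [Hpar Hdef]]]] [c [[Hc HAc] Hkc]].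
pose proof (proj1 hV : ZFCm V) as HZ.
pose proof (proj2 hV : Powm V) as HPow.
pose proof (proj1 (proj1 (proj1 Hit))) as Hk.
destruct (proj2 (proj1 Hit)) as [w [Hw Hwk]].
assert (Hlim : forall b, b ∈ k -> exists e v, e ∈ k /\ b ∈ e /\ is_measure e v).
{ intros b Hb; destruct (Hlim0 b Hb) as [e [He [[Hunc [v Hv]] Hbe]]].
  exists e, v; split; auto; split; auto; split; auto. }
assert (Hne : k <> emp) by (intros E; rewrite E in Hwk; exact (not_in_emp Hwk)).
destruct (it_good Hw Hk Hlim Hne) as [a1 [Ha1 Hgood1]].
destruct (params_small Hk Hwk (k_max Hk Hlim) Hpar) as [p0 [Hp0 Hparams]].
(* Measurable cardinals above [a0] are large enough to fix [k] and all parameters. *)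
destruct (k_max Hk Hlim Ha1 Hp0) as [a0 [Ha0 [H1 H2]]].
assert (Hgood : forall d u a, a0 ∈ d -> d ∈ k -> a ∈ k -> is_normal_measure d u ->
  good_sys w k d (it_space d a) (it_filter d u a) (it_supports d a)).
{ intros d u a Had Hd Ha Hn; apply Hgood1; auto.
  exact (ord_trans (ord_elem Hk Hd) Had H1). }
assert (Hx : exists x, x ∈ A /\ forall b, b ∈ k -> ~ exceptional k a0 x b).
{ apply NNPP; intros N; apply (counting Hw Hk Hlim Hgood HA Hc HAc Hkc).
  intros x Hx; apply NNPP; intros N1; apply N; exists x; split; auto.
  intros b Hb He; apply N1; eauto. }
destruct Hx as [x [HxA Hxe]].
pose proof (HA x HxA) as Hxk.
pose (I := fun p => iset (it_space (triple1 p) (triple3 p)) (it_filter (triple1 p) (triple2 p) (triple3 p))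
  (it_supports (triple1 p) (triple3 p)) k x).
assert (DI : DF1 I) by (unfold I; dfn).
assert (EI : forall p, I p = iset (it_space (triple1 p) (triple3 p)) (it_filter (triple1 p) (triple2 p) (triple3 p))
  (it_supports (triple1 p) (triple3 p)) k x) by reflexivity.
clearbody I.
(* Codes of iterations that move [x]. They form a set because a measure on [d] is a set of subsets
   of [k]. *)
pose (X := sep (prod (prod k (pow (pow k))) k) (fun p => exists d u a, p = triple d u a /\ d ∈ k /\ a ∈ k /\
  a0 ∈ d /\ is_normal_measure d u /\ I p <> x)).
assert (HX : forall p, p ∈ X -> triple1 p ∈ k /\ triple3 p ∈ k /\ a0 ∈ triple1 p /\ is_normal_measure (triple1 p) (triple2 p) /\
  I p <> x).
{ intros p; unfold X; insep; intros [_ [d [u [a [-> H]]]]].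
  destruct (triple_proj d u a) as [-> [-> ->]]; tauto. }
assert (Hnext : forall b b', b ∈ k -> b' ∈ k -> exists q, q ∈ X /\ b ∈ triple1 q /\ b' ∈ triple1 q).
{ intros b b' Hb Hb'; destruct (k_max Hk Hlim Hb Hb') as [m [Hm [Hbm Hbm']]].
  destruct (k_meas2 Hk Hlim Hm Ha0) as [d [v [Hd [Hmd [Had Hmv]]]]].
  destruct (nmeas_exists Hmv) as [u Hn].
  pose proof (meas_ord Hmv) as Hdo.
  assert (Ha : exists a, a ∈ k /\ I (triple d u a) <> x).
  { apply NNPP; intros N; apply (Hxe d Hd); right; split; auto; exists u; split; auto.
    intros a Ha; apply NNPP; intros N1; apply N; exists a; split; [assumption|].
    destruct (triple_proj d u a) as [E1 [E2 E3]]; rewrite EI, E1, E2, E3; exact N1. }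
  destruct Ha as [a [Ha HI]]; exists (triple d u a).
  destruct (triple_proj d u a) as [E1 [E2 E3]]; rewrite E1; split; [|split].
  - unfold X; insep; split; [|exists d, u, a; auto 10].
    rewrite in_prod; exists (pair d u), a; split; [|auto].
    rewrite in_prod; exists d, u; split; auto; split; auto.
    rewrite in_pow; intros z Hz; rewrite in_pow; intros t Ht.
    apply (ord_trans Hk Hd), (proj1 (proj1 (proj2 (proj1 Hn))) z Hz t Ht).
  - exact (ord_trans Hdo Hmd Hbm).
  - exact (ord_trans Hdo Hmd Hbm'). }
destruct (Hnext _ _ Hwk Hwk) as [q0 [Hq0 _]].
destruct (@dep_choice _ _ w Hw X (fun p q => triple1 p ∈ triple1 q /\ triple3 p ∈ triple1 q) _ q0 Hq0)
  as [f [Hf [_ Hfs]]].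
{ intros p Hp; destruct (HX p Hp) as [Hd [Ha _]]; destruct (Hnext _ _ Hd Ha) as [q Hq].
  exists q; tauto. }
apply maps_iff in Hf; destruct Hf as [_ HfX].
(* Dependent choice relates neighbours only. Both the cardinals and the lengths of earlier
   iterations must lie below later cardinals, so that the earlier systems are small for the later
   ones. *)
assert (Hmono : forall n, n ∈ w -> forall m, m ∈ n ->
  triple1 (app f m) ∈ triple1 (app f n) /\ triple3 (app f m) ∈ triple1 (app f n)).
{ apply (@omega_ind _ _ w Hw (fun n => forall m, m ∈ n ->
    triple1 (app f m) ∈ triple1 (app f n) /\ triple3 (app f m) ∈ triple1 (app f n)) _).
  - intros m Hm; destruct (not_in_emp Hm).
  - intros n Hn IH m Hm; rewrite in_succ in Hm; destruct (Hfs n Hn) as [F1 F2].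
    destruct Hm as [Hm| ->]; auto.
    destruct (HX _ (HfX _ (omega_succ Hw Hn))) as [Hd _].
    destruct (IH m Hm) as [G1 G2]; pose proof (ord_elem Hk Hd) as Ho.
    split; [exact (ord_trans Ho F1 G1)|exact (ord_trans Ho F1 G2)]. }
assert (HIA : forall n, n ∈ w -> I (app f n) ∈ A).
{ intros n Hn; destruct (HX _ (HfX n Hn)) as [Hd [Ha [Had [Hnm _]]]].
  destruct (Hgood _ _ _ Had Hd Ha Hnm) as [HS [Hbd Hsz]].
  apply Hdef; rewrite EI; apply (iset_defines Hw HS Hk Hbd Hsz Hphi); auto.
  - apply Hparams; [exact (ord_elem Hk Hd)|exact (ord_trans (ord_elem Hk Hd) Had H2)].
  - now apply Hdef. }
apply NNPP; intros Hcontra.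
assert (Hbdd : forall n, n ∈ w -> exists b, b ∈ k /\ forall y, y ∈ x -> y ∈ I (app f n) -> b ∉ y).
{ intros n Hn; apply NNPP; intros N; apply Hcontra.
  exists x, (I (app f n)); split; [assumption|split; [auto|split]].
  - destruct (HX _ (HfX n Hn)) as [_ [_ [_ [_ H]]]]; auto.
  - intros b Hb; apply NNPP; intros N1; apply N; exists b; split; auto.
    intros y Hy Hy' Hby; apply N1; exists y; auto. }
destruct (@choice_fun _ _ w (fun n b => b ∈ k /\ forall y, y ∈ x -> y ∈ I (app f n) -> b ∉ y) _ Hbdd)
  as [g [_ Hg]].
(* The bounds [app g n] of the intersections would be cofinal in [k]. *)
apply (iterable_cof Hw Hit (b := g)); [intros n Hn; now apply Hg|].
intros a Ha; pose proof (k_succ Hk Hlim Ha) as Hsa.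
(* Non-exceptionality at [succ a] gives an element of [x] strictly above [a]. *)
assert (Hy : exists y, y ∈ x /\ y ∉ succ a).
{ apply NNPP; intros N; apply (Hxe _ Hsa); left; intros y Hy; apply NNPP; eauto. }
destruct Hy as [y [Hy Hya]]; pose proof (Hxk y Hy) as Hyk.
destruct (@fixed_by_almost_all _ _ _ w k Hw Hk (fun n => triple1 (app f n)) (fun n => it_space (triple1 (app f n)) (triple3 (app f n)))
  (fun n => it_filter (triple1 (app f n)) (triple2 (app f n)) (triple3 (app f n)))
  (fun n => it_supports (triple1 (app f n)) (triple3 (app f n))) _ _ _) with (a := y) as [n [Hn Hfix]]; auto.
{ intros n Hn; destruct (HX _ (HfX n Hn)) as [Hd [Ha' [Had [Hnm _]]]]; now apply Hgood. }
{ intros m n Hn Hm; destruct (HX _ (HfX n Hn)) as [_ [_ [_ [Hnm _]]]].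
  destruct (Hmono n Hn m Hm) as [M1 M2]; exact (proj1 (proj2 (it_small (proj1 Hnm) M1 M2))). }
{ intros m n Hn Hm; destruct (HX _ (HfX n Hn)) as [_ [_ [_ [Hnm _]]]].
  destruct (Hmono n Hn m Hm) as [M1 M2]; exact (proj2 (proj2 (it_small (proj1 Hnm) M1 M2))). }
{ intros n Hn; destruct (HX _ (HfX n Hn)) as [_ [_ [_ [Hnm _]]]].
  apply small_ord; exact (meas_omega Hw (proj1 Hnm)). }
exists n; split; auto.
destruct (HX _ (HfX n Hn)) as [Hd [Ha' [Had [Hnm _]]]].
destruct (Hgood _ _ _ Had Hd Ha' Hnm) as [HS _].
specialize (Hfix n Hn (fun z Hz => Hz)); unfold fixes in Hfix.
(* The embedding [n] sends [y ∈ x] to a member of the image of [x], and this member is [y] itself.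
   So [y] lies in the intersection and is at most [app g n]. *)
assert (HyI : y ∈ I (app f n)).
{ rewrite EI; rewrite <- Hfix at 1; apply (rk_iset Hw HS Hk x (adm_const HS Hyk)).
  apply (ae_all HS); [dfn|]; intros s Hs; now rewrite app_lam by (assumption || dfn). }
destruct (Hg n Hn) as [Hgk Hgn]; specialize (Hgn y Hy HyI).
pose proof (ord_elem Hk Hgk) as Hgo; pose proof (ord_elem Hk Hyk) as Hyo.
rewrite in_succ in Hya.
assert (Hay : a ∈ y).
{ destruct (ord_tri (ord_elem Hk Ha) Hyo) as [H|[H|H]]; auto; subst; tauto. }
destruct (ord_tri Hyo Hgo) as [H|[H|H]]; [exact (ord_trans Hgo H Hay)|now rewrite <- H|tauto].
Qed.
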